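(* Let $F$ be a function in $H^\infty (\mathbb{D}^\infty )$. Then there is a representative $\widetilde{F}$ of the boundary function of $F$ on the distinguished boundary $\mathbb{T}^\infty$ such that \[\widetilde{F}(\tau)=\lim_{\theta\to 0^+}F(b_\theta (\tau ))\] for almost every $\tau\in\mathbb{T}^\infty$. In fact, for every $\tau\in\mathbb{T}^\infty$, we have \[\widetilde{F}(\tau')=\lim_{\theta\to 0^+}F(b_\theta (\tau' ))\] for almost every $\tau'\in T(\tau )$.
   Context: $\mathbb{D}$ is the open unit disc, $\mathbb{T}$ the unit circle, $\mathbb{T}^\infty$ the countably infinite product of circles, equipped with its normalized Haar measure $m_\infty$; ''almost every $\tau\in\mathbb{T}^\infty$'' refers to $m_\infty$. Let $p_1=2,p_2=3,\ldots$ be the primes in increasing order. $H^\infty(\mathbb{D}^\infty)$ is the space of functions in $L^\infty(\mathbb{T}^\infty,m_\infty)$ all of whose Fourier coefficients with at least one negative index vanish; the element of $L^\infty(\mathbb{T}^\infty)$ is called the boundary function of $F$, and a representative of it is a (everywhere defined) measurable function on $\mathbb{T}^\infty$ in this $m_\infty$-equivalence class. With $b_\beta$ ($\beta$ a finitely supported multi-index of nonnegative integers) denoting the Fourier coefficients of $F$, the value $F(z)$ is well defined at every point $z=(z_1,z_2,\ldots)\in\mathbb{D}^\infty$ with $z_j\to 0$ by $F(z)=\lim_{n\to\infty}F_n(z_1,\ldots,z_n)$, where $F_n(z_1,\ldots,z_n)=\sum b_\beta z^\beta$ is the bounded analytic function on $\mathbb{D}^n$ obtained by summing over the multi-indices $\beta$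 supported on the first $n$ coordinates (the existence of this limit is a known fact due to Cole and Gamelin). For $\tau=(\tau_1,\tau_2,\ldots)\in\mathbb{T}^\infty$ and $\theta\ge 0$, set $b_\theta(\tau)=(p_1^{-\theta}\tau_1,p_2^{-\theta}\tau_2,\ldots)$. The Kronecker flow is $T_t((z_1,z_2,\ldots))=(p_1^{-it}z_1,p_2^{-it}z_2,\ldots)$, $t\in\mathbb{R}$, and $T(\tau)=\{T_t(\tau):t\in\mathbb{R}\}$ is the orbit of $\tau$, equipped with linear measure, i.e. Lebesgue measure in the parameter $t\in\mathbb{R}$; ''almost every $\tau'\in T(\tau)$'' refers to this measure. *)

(* Defs.v *)
From HB Require Import structures.
From mathcomp Require Import all_boot all_order all_algebra finmap.
From mathcomp Require Import all_classical all_reals all_analysis.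
From mathcomp Require Import complex summability.

Set Implicit Arguments.
Unset Strict Implicit.
Unset Printing Implicit Defensive.

Import Order.TTheory GRing.Theory Num.Theory.
Import numFieldNormedType.Exports.

Local Open Scope classical_set_scope.
Local Open Scope ring_scope.

Lemma ex_prime_above m : exists p, (m < p)%N && prime p.
Proof. by have [p mp pp] := prime_above m; exists p; rewrite mp pp. Qed.

(* Primes in increasing order, indexed from 0: the prime p_j of the usual
   numbering p_1 = 2, p_2 = 3, ... is [nth_prime j.-1]. All sequences of
   coordinates below are likewise indexed from 0. *)
Fixpoint nth_prime (j : nat) : nat :=
  if j is k.+1 then ex_minn (ex_prime_above (nth_prime k)) else 2%N.

(* Complex numbers; viewing R[i] as a numClosedFieldType is what gives it the
   topology of its norm. *)
Definition Cplx (R : realType) : numClosedFieldType := R[i].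

Definition complex_measurable d (T : measurableType d) (R : realType)
    (f : T -> Cplx R) : Prop :=
  measurable_fun setT (fun x => complex.Re (f x)) /\
  measurable_fun setT (fun x => complex.Im (f x)).

Definition complex_integral d (T : measurableType d) (R : realType)
    (mu : {measure set T -> \bar R}) (f : T -> Cplx R) : Cplx R :=
  Complex (\int[mu]_x complex.Re (f x)) (\int[mu]_x complex.Im (f x)).

Definition circle (R : realType) : Type := {z : Cplx R | `|z| == 1}.

Lemma circle1_subproof (R : realType) : `|1 : Cplx R| == 1.
Proof. by rewrite normr1. Qed.

HB.instance Definition _ (R : realType) := Choice.on (circle R).
HB.instance Definition _ (R : realType) :=
  isPointed.Build (circle R) (exist _ 1 (circle1_subproof R)).

Lemma circle_mul_subproof (R : realType) (a z : circle R) :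
  `|sval a * sval z| == 1.
Proof. by rewrite normrM (eqP (svalP a)) (eqP (svalP z)) mulr1. Qed.

Definition circle_mul (R : realType) (a z : circle R) : circle R :=
  exist _ (sval a * sval z) (circle_mul_subproof a z).

(* The infinite torus carries the smallest sigma-algebra making the real and
   imaginary parts of all coordinates measurable; as the product is countable
   and the circle is second countable, this is its Borel sigma-algebra. *)
Definition torus_generators (R : realType) : set (set (nat -> circle R)) :=
  [set A | exists (j : nat) (B : set R), measurable B /\
    (A = [set tau | B (complex.Re (sval (tau j)))] \/
     A = [set tau | B (complex.Im (sval (tau j)))])].

Definition torus (R : realType) :
    measurableType (sigma_display (@torus_generators R)) :=
  g_sigma_algebraType (@torus_generators R).

Definition torus_mul (R : realType) (a tau : torus R) : torus R :=
  fun j => circle_mul (a j) (tau j).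

(* The normalized Haar measure: being a probability measure is part of the type
   of m. *)
Definition is_haar (R : realType) (m : probability (torus R) R) : Prop :=
  forall (a : torus R) (A : set (torus R)), measurable A ->
    m (torus_mul a @^-1` A) = m A.

Definition multi_index := {fsfun nat -> int with 0%R}.

Definition monomial (R : realType) (z : nat -> Cplx R) (a : multi_index) :
    Cplx R :=
  \prod_(j <- finsupp a) z j ^ a j.

Definition coords (R : realType) (tau : torus R) : nat -> Cplx R :=
  fun j => sval (tau j).

Definition fourier (R : realType) (m : probability (torus R) R)
    (F : torus R -> Cplx R) (a : multi_index) : Cplx R :=
  complex_integral m (fun tau => F tau * (monomial (coords tau) a)^*).

Definition in_Linfty (R : realType) (m : probability (torus R) R)
    (F : torus R -> Cplx R) : Prop :=
  complex_measurable F /\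
  (Lnorm m +oo (fun tau => (complex.Re `|F tau|)%:E) < +oo)%E.

(* An element of L^infinity is given by any of its measurable representatives;
   fourier and point_value below only depend on the almost-everywhere class. *)
Definition in_Hinfty (R : realType) (m : probability (torus R) R)
    (F : torus R -> Cplx R) : Prop :=
  in_Linfty m F /\
  forall a : multi_index, (exists j, a j < 0) -> fourier m F a = 0.

Definition first_indices (n : nat) : set multi_index :=
  [set b | (forall j, 0 <= b j) /\ (forall j, (n <= j)%N -> b j = 0)].

(* [summability.sum] is the unordered sum, the limit along finite sets of
   indices. *)
Definition point_value_n (R : realType) (m : probability (torus R) R)
    (F : torus R -> Cplx R) (n : nat) (z : nat -> Cplx R) : Cplx R :=
  summability.sum (fun b : multi_index =>
    if b \in first_indices n then fourier m F b * monomial z b else 0).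

Definition point_value (R : realType) (m : probability (torus R) R)
    (F : torus R -> Cplx R) (z : nat -> Cplx R) : Cplx R :=
  lim (point_value_n m F n z @[n --> \oo]).

Definition b_theta (R : realType) (theta : R) (tau : torus R) : nat -> Cplx R :=
  fun j => real_complex R ((nth_prime j)%:R `^ (- theta)) * sval (tau j).

(* p^(-it) = cos (t ln p) - i sin (t ln p) *)
Definition prime_twist (R : realType) (t : R) (j : nat) : Cplx R :=
  let s := t * ln (nth_prime j)%:R in Complex (cos s) (- sin s).

Lemma prime_twist_subproof (R : realType) (t : R) j :
  `|prime_twist t j| == 1.
Proof.
by rewrite /prime_twist normc_def /= sqrrN cos2Dsin2 sqrtr1.
Qed.

Definition kronecker_flow (R : realType) (t : R) (tau : torus R) : torus R :=
  torus_mul (fun j => exist _ (prime_twist t j) (prime_twist_subproof t j)) tau.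

(* Main.v *)
(** Idea. Fejer means turn the Fourier series of [F], restricted to the first [n]
variables, into polynomials bounded on the torus. Along
[theta + it |-> b_theta (T_t tau)] such a polynomial is a finite exponential sum
with frequencies [>= 0], so Poisson's formula in the right half plane gives a
maximum principle. Monomials involving a variable of index [>= n] have frequency
at least [ln p_n]; hence adding variables after the first [n] changes the mean at
[b_theta tau] by [O (p_n^-theta)], and the means converge to [F (b_theta tau)].

A Fatou theorem for bounded limits of exponential sums gives, on every orbit, a
limit as [theta -> 0+] for almost every [t]. To avoid weak limits of measures,
the coefficients are divided by [1 + frequency]: the boundary values become
uniformly Lipschitz, so their limit is differentiable almost everywhere, and at
a point of differentiability the original sums have a limit.

The set of points where the limit fails is measurable and null on every orbit,
hence null by Fubini and the invariance of Haar measure. The limit function has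
the same Fourier coefficients as [F], and so equals [F] almost everywhere. *)

Require Import Defs.
From HB Require Import structures.
From mathcomp Require Import all_boot all_order all_algebra finmap.
From mathcomp Require Import all_classical all_reals all_analysis.
From mathcomp Require Import measurable_realfun.
From mathcomp Require Import complex summability.
From mathcomp Require Import ring lra.
Import Order.TTheory GRing.Theory Num.Theory.
Import numFieldNormedType.Exports.
Local Open Scope classical_set_scope.
Local Open Scope ring_scope.
Set Implicit Arguments.
Unset Strict Implicit.
Unset Printing Implicit Defensive.
Local Notation leb := lebesgue_measure.

(** The Fejer kernel in several variables is nonnegative with integral one, so bounds on the real
    and imaginary parts of the boundary function pass to all means with the same constant, whatever
    the number of variables. Taking the degree equal to the number of variables gives one sequence
    of polynomials for all points [b_theta tau]. Convergence of the means is known only inside, for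
    [theta > 0], and not at the boundary points of a prescribed orbit. Dividing a coefficient of
    frequency [l] by [1 + l] amounts to integrating [exp (- x)] times the sum over the interior
    points [x > 0], so the modified boundary values converge everywhere by dominated convergence. If
    [g] is the modified sum, the original one is [g - g']; under Poisson's integral the derivative
    falls on the kernel, and what has to converge as [theta -> 0+] is a symmetric difference
    quotient of a Lipschitz function. Real and imaginary parts are handled separately, since the
    integrals are real; both occur in the formula because, by Cauchy-Riemann, the normal derivative
    of one is the tangential derivative of the other. *)

(** * Integration and calculus on the half line *)

Lemma Rintegral_dominated_cvg d (T : measurableType d) (R : realType)
    (mu : {measure set T -> \bar R}) (D : set T) (f_ : nat -> T -> R) (f g : T -> R) :
  measurable D -> (forall n, measurable_fun D (f_ n)) ->
  (forall x, D x -> f_ n x @[n --> \oo] --> f x) ->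
  mu.-integrable D (EFin \o g) ->
  (forall n x, D x -> `|f_ n x| <= g x) ->
  mu.-integrable D (EFin \o f) /\
  \int[mu]_(x in D) f_ n x @[n --> \oo] --> \int[mu]_(x in D) f x.
Proof.
move=> mD mf cf ig fg.
have mF : measurable_fun D f by exact: measurable_fun_cvg mf cf.
have iF : mu.-integrable D (EFin \o f).
  apply: (le_integrable mD _ _ ig); first exact/measurable_EFinP.
  move=> x Dx /=; rewrite lee_fin.
  apply: le_trans (ler_norm _); apply: (cvgr_to_le (cvg_norm (cf _ Dx))).
  by apply: nearW => n; exact: fg.
split => //; apply: fine_cvg; rewrite fineK; last exact: integrable_fin_num.
apply: (@dominated_cvg _ _ _ mu D mD (fun n => EFin \o f_ n) (EFin \o f) (EFin \o g)) => //.
- by move=> n; exact/measurable_EFinP.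
- by move=> x Dx; apply: cvg_EFin; [exact: nearW|exact: cf].
Qed.



Lemma integrable_dominated d (T : measurableType d) (R : realType)
    (mu : {measure set T -> \bar R}) (D : set T) (f g : T -> R) :
  measurable D -> measurable_fun D f -> (forall x, D x -> `|f x| <= g x) ->
  mu.-integrable D (EFin \o g) -> mu.-integrable D (EFin \o f).
Proof.
move=> mD mf fg; apply: le_integrable => //; first exact/measurable_EFinP.
by move=> x Dx; rewrite /= lee_fin (le_trans (fg _ Dx)) ?ler_norm.
Qed.

Lemma integrable_scale d (T : measurableType d) (R : realType)
    (mu : {measure set T -> \bar R}) (D : set T) (k : R) (f : T -> R) :
  measurable D -> mu.-integrable D (EFin \o f) ->
  mu.-integrable D (EFin \o (fun x => k * f x)).
Proof. by move=> mD fi; exact: (integrableZl mD k fi). Qed.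

Lemma integrable_add d (T : measurableType d) (R : realType)
    (mu : {measure set T -> \bar R}) (D : set T) (f g : T -> R) :
  measurable D -> mu.-integrable D (EFin \o f) -> mu.-integrable D (EFin \o g) ->
  mu.-integrable D (EFin \o (fun x => f x + g x)).
Proof. by move=> mD fi gi; exact: (integrableD mD fi gi). Qed.

Lemma integrable_sub d (T : measurableType d) (R : realType)
    (mu : {measure set T -> \bar R}) (D : set T) (f g : T -> R) :
  measurable D -> mu.-integrable D (EFin \o f) -> mu.-integrable D (EFin \o g) ->
  mu.-integrable D (EFin \o (fun x => f x - g x)).
Proof. by move=> mD fi gi; exact: (integrableB mD fi gi). Qed.

Lemma measurable_half_line (R : realType) :
  @measurable _ (measurableTypeR R) `[(0 : R), +oo[.
Proof. exact: measurable_itv. Qed.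

Lemma Rintegral_half_line_FTC (R : realType) (f F : R -> R) (l : R) :
  (forall x : R, is_derive x 1 F (f x)) -> continuous f ->
  leb.-integrable `[0, +oo[ (EFin \o f) -> F x @[x --> +oo] --> l ->
  \int[leb]_(x in `[0, +oo[) f x = l - F 0.
Proof.
move=> dF cf intf Fl.
have mf : measurable_fun setT f by exact: continuous_measurable_fun.
pose f_ n x := f x * \1_(`[0, n%:R]%classic : set R) x.
have [] := @Rintegral_dominated_cvg _ _ R leb `[0, +oo[%classic f_ f (fun x => `|f x|).
- exact: measurable_half_line.
- move=> n; apply: measurable_funM; first exact: measurable_funTS.
  by apply: measurable_indic; exact: measurable_itv.
- move=> x; rewrite /= in_itv /= andbT => x0.
  apply: cvg_near_cst; near=> n; rewrite /f_ indicE mem_set ?mulr1//=.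
  rewrite in_itv /= x0 /=; near: n; exact: nbhs_infty_ger.
- exact: integrable_norm.
- move=> n x _; rewrite /f_ normrM indicE; case: (_ \in _) => /=.
    by rewrite normr1 mulr1.
  by rewrite normr0 mulr0.
move=> _ cf_; have cF : continuous F.
  by move=> x; apply: differentiable_continuous; apply/derivable1_diffP; case: (dF x).
(* The index is [n.+1] because the fundamental theorem is applied on a nondegenerate interval. *)
have fE n : \int[leb]_(x in `[0, +oo[) f_ n.+1 x = F n.+1%:R - F 0.
  rewrite -[RHS]/(fine ((F n.+1%:R)%:E - (F 0)%:E)).
  rewrite -(@continuous_FTC2 _ f F); first last.
  - by move=> x _; rewrite derive1E; exact: derive_val.
  - split; first by move=> x _; case: (dF x).
    + by apply: cvg_at_right_filter; exact: cF.
    + by apply: cvg_at_left_filter; exact: cF.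
  - exact: continuous_subspaceT.
  - by [].
  rewrite Rintegral_mkcond [in RHS]integral_mkcond; congr fine.
  apply: eq_integral => x _.
  rewrite /patch /f_ indicE.
  have [xn|xn] := boolP (x \in `[0, n.+1%:R]%classic); last by rewrite mulr0; case: ifP.
  rewrite mulr1 mem_set//; move/set_mem: xn => /=.
  by rewrite !in_itv/= andbT => /andP[].
apply: (@cvg_unique _ _ (\int[leb]_(x in `[0, +oo[) f_ n.+1 x @[n --> \oo])) => //.
  by move: cf_; rewrite -cvg_shiftS.
rewrite /= (funext fE); apply: cvgB; last exact: cvg_cst.
by apply: (cvg_comp _ _ _ Fl); have := @cvgr_idn R; rewrite -cvg_shiftS.
Unshelve. all: by end_near. Qed.

Lemma continuous_measurable_on (R : realType) (D : set R) (f : R -> R) :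
  continuous f -> measurable_fun D f.
Proof. by move=> cf; apply: measurable_funTS; exact: continuous_measurable_fun. Qed.

Lemma is_derive_continuous (R : realType) (F f : R -> R) :
  (forall x : R, is_derive x 1 F (f x)) -> continuous F.
Proof.
by move=> dF x; apply: differentiable_continuous; apply/derivable1_diffP; case: (dF x).
Qed.

Lemma is_derive_compM (R : realType) (f : R -> R) (b x df : R) :
  is_derive (b * x) 1 f df -> is_derive x 1 (fun y => f (b * y)) (b * df).
Proof.
move=> fdf; have -> : (fun y => f (b * y)) = f \o (b \*: id) by [].
apply: is_derive_eq (@is_derive1_comp _ _ _ _ _ _ fdf (is_deriveZ b (is_derive_id x 1))) _.
by rewrite mulrC; congr (_ * _); rewrite /GRing.scale /= mulr1.
Qed.

Lemma is_derive_mul (R : realType) (f g : R -> R) (x df dg : R) :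
  is_derive x 1 f df -> is_derive x 1 g dg ->
  is_derive x 1 (fun y => f y * g y) (df * g x + f x * dg).
Proof.
by move=> fdf gdg; apply: is_derive_eq (is_deriveM fdf gdg) _; rewrite addrC mulrC.
Qed.

Lemma is_derive_add (R : realType) (f g : R -> R) (x df dg : R) :
  is_derive x 1 f df -> is_derive x 1 g dg ->
  is_derive x 1 (fun y => f y + g y) (df + dg).
Proof. by move=> fdf gdg; exact: is_deriveD. Qed.

Lemma is_derive_expRN (R : realType) (a x : R) :
  is_derive x 1 (fun y => expR (- (a * y))) (- a * expR (- (a * x))).
Proof.
have -> : (fun y => expR (- (a * y))) = (fun y => expR (- a * y)).
  by apply/funext => y; rewrite mulNr.
by rewrite -mulNr; exact: is_derive_compM (is_derive_expR _).
Qed.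

Lemma cvg_expRN_infty (R : realType) (a : R) : 0 < a ->
  expR (- (a * x)) @[x --> +oo] --> 0.
Proof.
move=> a0; apply: (cvg_comp (fun x => a * x) (fun x => expR (- x))); last exact: cvgr_expR.
exact: gt0_cvgMry.
Qed.

Lemma normr_cos_le1 (R : realType) (x : R) : `|cos x| <= 1.
Proof. by rewrite ler_norml cos_geN1 cos_le1. Qed.

Lemma normr_sin_le1 (R : realType) (x : R) : `|sin x| <= 1.
Proof. by rewrite ler_norml sin_geN1 sin_le1. Qed.

Lemma normr_cvg0 (R : realType) (T : Type) (F : set_system T) (FF : Filter F)
    (f g : T -> R) :
  (forall x, `|f x| <= g x) -> g @ F --> 0 -> f @ F --> 0.
Proof.
move=> fg g0; apply: (@squeeze_cvgr _ _ _ _ (fun x => - g x) g) => //.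
  by apply: nearW => x; rewrite -ler_norml.
by rewrite -oppr0; exact: cvgN.
Qed.

(** * Cosine and sine transforms behind Poisson's kernel *)

Lemma is_derive_damped_trig (R : realType) (a b x : R) : 0 < a ->
  is_derive x 1 (fun y => expR (- (a * y)) * ((b * sin (b * y) - a * cos (b * y)) / (a ^+ 2 + b ^+ 2)))
   (expR (- (a * x)) * cos (b * x)).
Proof.
move=> a0; have ab : a ^+ 2 + b ^+ 2 != 0.
  by rewrite gt_eqF// ltr_pwDl ?exprn_gt0// sqr_ge0.
have ds := is_derive_compM (is_derive_sin (b * x)).
have dc := is_derive_compM (is_derive_cos (b * x)).
by apply: is_derive_eq; rewrite /GRing.scale /=; field.
Qed.

Lemma integrable_expRN_half_line (R : realType) (a : R) : 0 < a ->
  leb.-integrable `[(0 : R), +oo[ (EFin \o (fun y => expR (- (a * y)))).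
Proof.
move=> a0; apply/integrableP; split.
  apply/measurable_EFinP; apply: continuous_measurable_on.
  by apply: is_derive_continuous => x; exact: is_derive_expRN.
under eq_integral do rewrite /= ger0_norm ?expR_ge0//.
pose G (y : R) : R := - a^-1 * expR (- (a * y)).
have dG (x : R) : is_derive x 1 G (expR (- (a * x))).
  by apply: is_derive_eq; rewrite /GRing.scale /=; field; rewrite gt_eqF.
have cG := is_derive_continuous dG.
rewrite (@ge0_continuous_FTC2y _ _ G 0 0).
- by rewrite ltry.
- by move=> x _; exact: expR_ge0.
- apply: continuous_subspaceT.
  by apply: is_derive_continuous => x; exact: is_derive_expRN.
- by rewrite -[X in _ --> X](mulr0 (- a^-1)); apply: cvgM; [exact: cvg_cst|exact: cvg_expRN_infty].
- by move=> x _; case: (dG x).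
- by apply: cvg_at_right_filter; exact: cG.
- by move=> x _; rewrite derive1E; exact: derive_val.
Qed.

Lemma Rintegral_damped_cos (R : realType) (a b : R) : 0 < a ->
  \int[leb]_(y in `[(0 : R), +oo[) (expR (- (a * y)) * cos (b * y)) =
  a / (a ^+ 2 + b ^+ 2).
Proof.
move=> a0.
have ab : a ^+ 2 + b ^+ 2 != 0.
  by rewrite gt_eqF// ltr_pwDl ?exprn_gt0// sqr_ge0.
have cf : continuous (fun y => expR (- (a * y)) * cos (b * y)).
  apply: (is_derive_continuous (fun x => is_derive_mul (is_derive_expRN a x)
    (is_derive_compM (is_derive_cos (b * x))))).
rewrite (@Rintegral_half_line_FTC R _ _ 0 (fun x => is_derive_damped_trig b x a0)) //.
- by rewrite !mulr0 oppr0 expR0 cos0 sin0; field.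
- apply: (integrable_dominated _ _ _ (integrable_expRN_half_line a0)).
  + exact: measurable_half_line.
  + exact: continuous_measurable_on.
  + move=> x _; rewrite normrM ger0_norm ?expR_ge0//.
    by rewrite ler_piMr ?expR_ge0// ler_norml cos_geN1 cos_le1.
- pose K := (`|b| + a) / (a ^+ 2 + b ^+ 2).
  have Kcvg : K * expR (- (a * x)) @[x --> +oo] --> 0.
    by rewrite -(mulr0 K); apply: cvgM; [exact: cvg_cst|exact: cvg_expRN_infty].
  apply: (@squeeze_cvgr _ _ _ _ (fun x => - (K * expR (- (a * x)))) _ _ _ _ _ Kcvg); last first.
    by rewrite -oppr0; exact: cvgN.
  apply: nearW => x; rewrite -ler_norml normrM mulrC (@ger0_norm _ (expR _)) ?expR_ge0//.
  rewrite ler_wpM2r ?expR_ge0// /K normrM normfV (@ger0_norm _ (_ + _ ^+ 2)) ?addr_ge0 ?sqr_ge0//.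
  rewrite ler_wpM2r ?invr_ge0 ?addr_ge0 ?sqr_ge0//.
  apply: le_trans (ler_normB _ _) _; rewrite !normrM (ger0_norm (ltW a0)).
  apply: lerD; apply: ler_piMr; rewrite ?normr_ge0 ?(ltW a0)//.
    by rewrite ler_norml sin_geN1 sin_le1.
  by rewrite ler_norml cos_geN1 cos_le1.
Qed.

(** A majorant of product form yields both the integrability of each slice and the absolute
    convergence of the double integral. *)
Lemma Rintegral_swap d1 d2 (T1 : measurableType d1) (T2 : measurableType d2)
    (R : realType) (m1 : {sigma_finite_measure set T1 -> \bar R})
    (m2 : {sigma_finite_measure set T2 -> \bar R}) (D1 : set T1) (D2 : set T2)
    (h : T1 -> T2 -> R) (p : T1 -> R) (q : T2 -> R) :
  measurable D1 -> measurable D2 ->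
  measurable_fun setT (fun z : T1 * T2 => h z.1 z.2) ->
  m1.-integrable D1 (EFin \o p) -> m2.-integrable D2 (EFin \o q) ->
  (forall x, D1 x -> 0 <= p x) -> (forall y, D2 y -> 0 <= q y) ->
  (forall x y, D1 x -> D2 y -> `|h x y| <= p x * q y) ->
  \int[m1]_(x in D1) \int[m2]_(y in D2) h x y =
  \int[m2]_(y in D2) \int[m1]_(x in D1) h x y.
Proof.
move=> mD1 mD2 mh ip iq p0 q0 hpq.
have ih1 x : D1 x -> m2.-integrable D2 (EFin \o h x).
  move=> Dx; apply: (@integrable_dominated _ _ _ m2 D2 (h x) (fun y => p x * q y)) => //.
  - apply: measurable_funTS.
    exact: (measurableT_comp mh (pair1_measurable x)).
  - by move=> y Dy; exact: hpq.
  - exact: (integrableZl mD2 (p x) iq).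
have ih2 y : D2 y -> m1.-integrable D1 (EFin \o h ^~ y).
  move=> Dy; apply: (@integrable_dominated _ _ _ m1 D1 (h ^~ y) (fun x => p x * q y)) => //.
  - apply: measurable_funTS.
    exact: (measurableT_comp mh (pair2_measurable y)).
  - by move=> x Dx; exact: hpq.
  - exact: (integrableZr mD1 (q y) ip).
(* Extension by zero outside [D1] times [D2], so that Fubini applies on the full product. *)
pose f (z : T1 * T2) := (h z.1 z.2 * (\1_D1 z.1 * \1_D2 z.2))%:E.
have mf : measurable_fun setT f.
  apply/measurable_EFinP/measurable_funM => //.
  have mi1 : measurable_fun setT (\1_D1 : T1 -> R) by exact: measurable_indic.
  have mi2 : measurable_fun setT (\1_D2 : T2 -> R) by exact: measurable_indic.
  apply: measurable_funM.
    exact: (measurableT_comp mi1 measurable_fst).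
  exact: (measurableT_comp mi2 measurable_snd).
have intf : (m1 \x m2)%E.-integrable setT f.
  apply/(integrable12ltyP m1 m2 mf).
  pose M := fine (\int[m2]_(y in D2) (q y)%:E).
  have Mq : (\int[m2]_(y in D2) (q y)%:E)%E = M%:E.
    by rewrite /M fineK//; exact: integrable_fin_num.
  apply: (@le_lt_trans _ _ (\int[m1]_(x in D1) (p x * M)%:E)%E); last first.
    have := integrableZr mD1 M ip => /(integrable_fin_num mD1).
    by rewrite ltey_eq => ->.
  rewrite [leRHS]integral_mkcond/=; apply: ge0_le_integral => //.
  - by move=> x _; exact: integral_ge0.
  - have := measurable_fun_fubini_tonelli_F (m2 := m2) (abse \o f).
    apply; first exact: measurableT_comp.
    by move=> ?; exact: abse_ge0.
  - apply/(measurable_restrictT _ mD1).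
    by case/integrableP: (integrableZr mD1 M ip).
  - move=> x _; rewrite patchE; case: ifPn => [/set_mem Dx|/negP Dx].
      rewrite EFinM -Mq -ge0_integralZl//; first last.
      + by rewrite lee_fin p0.
      + by case/integrableP: iq.
      rewrite [leRHS]integral_mkcond; apply: ge0_le_integral => //=.
      + exact: (measurableT_comp (measurableT_comp (@abse_measurable R setT) mf)
          (pair1_measurable x)).
      + apply/(measurable_restrictT _ mD2).
        by case/integrableP: (integrableZl mD2 (p x) iq).
      + move=> y _; have [yD|yD] := boolP (y \in D2).
          rewrite patchE !indicE (mem_set Dx) yD !mulr1 -EFinM lee_fin.
          by apply: hpq => //; exact/set_mem.
        by rewrite patchE !indicE (negbTE yD) !mulr0 normr0; exact: lexx.
    rewrite integral0_eq; first exact: lexx.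
    move=> y _; rewrite /f /= indicE memNset ?mul0r ?mulr0 ?normr0//.
    by move=> Dx'; apply: Dx; exact/mem_set.
have := Fubini intf => swap.
rewrite /Rintegral; congr fine.
transitivity (\int[m1]_x \int[m2]_y f (x, y))%E.
  rewrite integral_mkcond; apply: eq_integral => x _; rewrite patchE /f /=.
  have [Dx|Dx] := boolP (x \in D1).
    rewrite fineK; last by apply: integrable_fin_num => //; apply: ih1; exact/set_mem.
    rewrite integral_mkcond; apply: eq_integral => y _; rewrite patchE !indicE Dx mul1r.
    by have [yD|yD] := boolP (y \in D2); rewrite ?mulr1 ?mulr0.
  by rewrite integral0_eq// => y _; rewrite indicE (negbTE Dx) mul0r mulr0.
rewrite swap; symmetry.
rewrite integral_mkcond; apply: eq_integral => y _; rewrite patchE /f /=.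
have [Dy|Dy] := boolP (y \in D2).
  rewrite fineK; last by apply: integrable_fin_num => //; apply: ih2; exact/set_mem.
  rewrite integral_mkcond; apply: eq_integral => x _; rewrite patchE !indicE Dy mulr1.
  by have [xD|xD] := boolP (x \in D1); rewrite ?mulr1 ?mulr0.
by rewrite integral0_eq// => x _; rewrite !indicE (negbTE Dy) !mulr0.
Qed.

Lemma integrable_oneDsqrV (R : realType) :
  leb.-integrable `[(0 : R), +oo[ (EFin \o (fun y => (oneDsqr y)^-1)).
Proof.
apply/integrableP; split.
  by apply/measurable_EFinP; apply: continuous_measurable_on; exact: continuous_oneDsqrV.
have inv_ge0 (x : R) : 0 <= (oneDsqr x)^-1 by rewrite invr_ge0 addr_ge0// sqr_ge0.
under eq_integral do rewrite /= ger0_norm//.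
by rewrite integral0y_oneDsqr ltry.
Qed.

Lemma is_derive_atan_affine (R : realType) (d x y : R) : 0 < d ->
  is_derive y 1 (fun y => atan (d^-1 * (y - x))) (d / (d ^+ 2 + (y - x) ^+ 2)).
Proof.
move=> d0; have -> : (fun y => atan (d^-1 * (y - x))) = atan \o (fun y => d^-1 * (y - x)) by [].
have dd : d ^+ 2 + (y - x) ^+ 2 != 0 by rewrite gt_eqF// ltr_pwDl ?exprn_gt0// sqr_ge0.
have d1 : 1 + (d^-1 * (y - x)) ^+ 2 != 0 by rewrite gt_eqF// ltr_pwDl// sqr_ge0.
have dl : is_derive y 1 (fun y => d^-1 * (y - x)) d^-1.
  by apply: is_derive_eq; rewrite /GRing.scale /= subr0 mulr1.
apply: is_derive_eq (is_derive1_comp (is_derive1_atan _) dl) _.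
rewrite /GRing.scale /=; field.
by rewrite dd gt_eqF.
Qed.

(* Damping by [expR (- d u)] makes the double integral absolutely convergent. *)
Lemma damped_cos_oneDsqr (R : realType) (x d : R) : 0 < d ->
  \int[leb]_(u in `[(0 : R), +oo[) (expR (- (d * u)) * cos (x * u) / oneDsqr u) =
  2^-1 * \int[leb]_(y in `[(0 : R), +oo[)
     (expR (- (1 * y)) * (atan (d^-1 * (y - x)) + atan (d^-1 * (y - - x)))).
Proof.
move=> d0; have mD := @measurable_half_line R.
pose T y := atan (d^-1 * (y - x)) + atan (d^-1 * (y - - x)).
pose T' y := d / (d ^+ 2 + (y - x) ^+ 2) + d / (d ^+ 2 + (y - - x) ^+ 2).
have dT (y : R) : is_derive y 1 T (T' y).
  by apply: is_derive_add; exact: is_derive_atan_affine.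
have den z : 0 < d ^+ 2 + z ^+ 2 by rewrite ltr_pwDl ?exprn_gt0// sqr_ge0.
have cT' : continuous T'.
  have cK z : continuous (fun y : R => d / (d ^+ 2 + (y - z) ^+ 2)).
    move=> y; apply: cvgM; first exact: cvg_cst.
    apply: cvgV; first by rewrite gt_eqF.
    apply: cvgD; first exact: cvg_cst.
    apply: (cvg_comp (fun y => y - z) (fun y => y ^+ 2)); last exact: exprn_continuous.
    by apply: cvgB; [exact: cvg_id|exact: cvg_cst].
  by move=> y; apply: cvgD; exact: cK.
have cT := is_derive_continuous dT.
have e0 y : 0 <= expR (- (1 * y)) :> R by exact: expR_ge0.
have ce : continuous (fun y : R => expR (- (1 * y))) := is_derive_continuous (is_derive_expRN 1).
have T_le_pi y : `|T y| <= pi.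
  apply: le_trans (ler_normD _ _) _; rewrite [leRHS]splitr; apply: lerD; rewrite ler_norml.
    by rewrite !ltW// ?atan_ltpi2 ?atan_gtNpi2.
  by rewrite !ltW// ?atan_ltpi2 ?atan_gtNpi2.
have iT : leb.-integrable `[(0 : R), +oo[ (EFin \o (fun y => expR (- (1 * y)) * T y)).
  apply: (integrable_dominated mD _ _ (integrable_scale pi mD (integrable_expRN_half_line ltr01))).
  - by apply: continuous_measurable_on => y; apply: cvgM; [exact: ce|exact: cT].
  - by move=> y _; rewrite normrM ger0_norm// mulrC ler_wpM2r//; exact: T_le_pi.
have iT' : leb.-integrable `[(0 : R), +oo[ (EFin \o (fun y => expR (- (1 * y)) * T' y)).
  apply: (integrable_dominated mD _ _ (integrable_scale (2 * d^-1) mD (integrable_expRN_half_line ltr01))).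
  - by apply: continuous_measurable_on => y; apply: cvgM; [exact: ce|exact: cT'].
  - have K0 z : 0 <= d / (d ^+ 2 + z ^+ 2) by rewrite divr_ge0// ltW.
    have K1 z : d / (d ^+ 2 + z ^+ 2) <= d^-1.
      rewrite ler_pdivrMr// mulrDr expr2 mulrA mulVf ?gt_eqF// mul1r.
      by rewrite lerDl mulr_ge0 ?sqr_ge0// invr_ge0 ltW.
    move=> y _; rewrite normrM ger0_norm// mulrC ler_wpM2r// ger0_norm ?addr_ge0//.
    by rewrite mulr_natl mulr2n lerD.
(* [1 / oneDsqr u] is written as the cosine transform of [exp (- y)]; the swap then has the majorant
   [exp (- d u) exp (- y)]. *)
transitivity (\int[leb]_(u in `[(0 : R), +oo[) \int[leb]_(y in `[(0 : R), +oo[)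
    (expR (- (d * u)) * cos (x * u) * (expR (- (1 * y)) * cos (u * y)))).
  apply: eq_Rintegral => u _; rewrite RintegralZl//; last first.
    apply: (integrable_dominated mD _ _ (integrable_expRN_half_line ltr01)).
      apply: continuous_measurable_on; apply: (is_derive_continuous (fun y =>
        is_derive_mul (is_derive_expRN 1 y) (is_derive_compM (is_derive_cos (u * y))))).
    move=> y _; rewrite normrM ger0_norm// ler_piMr ?normr_cos_le1//.
  by rewrite Rintegral_damped_cos// expr1n /oneDsqr div1r.
rewrite (@Rintegral_swap _ _ _ _ R leb leb _ _ _ (fun u => expR (- (d * u)))
    (fun y => expR (- (1 * y)))) //; first last.
- move=> u y _ _; rewrite !normrM !(ger0_norm (expR_ge0 _)).
  apply: ler_pM; rewrite ?mulr_ge0 ?expR_ge0 ?normr_ge0//;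
    by rewrite ler_piMr ?expR_ge0 ?normr_cos_le1.
- exact: integrable_expRN_half_line.
- exact: integrable_expRN_half_line.
- have m1 b : measurable_fun setT (fun u : measurableTypeR R => expR (- (b * u))).
    exact: continuous_measurable_on (is_derive_continuous (is_derive_expRN b)).
  have mc : measurable_fun setT (cos : measurableTypeR R -> measurableTypeR R).
    exact: continuous_measurable_on (@continuous_cos R).
  apply: measurable_funM; apply: measurable_funM.
  + exact: (measurableT_comp (m1 d) measurable_fst).
  + by apply: (measurableT_comp mc); apply: measurable_funM.
  + exact: (measurableT_comp (m1 1) measurable_snd).
  + by apply: (measurableT_comp mc); apply: measurable_funM.
(* The product of two cosines is half the sum of those of [(y - x) u] and [(y + x) u]; integrating
   in [u] produces the two Poisson kernels that make up [T']. *)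
transitivity (\int[leb]_(y in `[(0 : R), +oo[) (2^-1 * (expR (- (1 * y)) * T' y))).
  apply: eq_Rintegral => y _.
  transitivity (\int[leb]_(u in `[(0 : R), +oo[) (2^-1 * expR (- (1 * y)) *
     (expR (- (d * u)) * cos ((y - x) * u) + expR (- (d * u)) * cos ((y - - x) * u)))).
    apply: eq_Rintegral => u _.
    by rewrite mulrBl opprK mulrDl cosB cosD [u * y]mulrC; field.
  have ii b : leb.-integrable `[(0 : R), +oo[ (EFin \o (fun u => expR (- (d * u)) * cos (b * u))).
    apply: (integrable_dominated mD _ _ (integrable_expRN_half_line d0)).
      apply: continuous_measurable_on; apply: (is_derive_continuous (fun y =>
        is_derive_mul (is_derive_expRN d y) (is_derive_compM (is_derive_cos (b * y))))).
    move=> v _; rewrite normrM ger0_norm ?expR_ge0// ler_piMr ?expR_ge0 ?normr_cos_le1//.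
  rewrite RintegralZl//; last exact: integrable_add.
  by rewrite RintegralD// !Rintegral_damped_cos// mulrA.
rewrite RintegralZl//; congr (_ * _).
(* Integration by parts: [exp (- y) T y] vanishes at infinity, and at [0] because [atan] is odd. *)
have dG (y : R) : is_derive y 1 (fun y => expR (- (1 * y)) * T y)
    (expR (- (1 * y)) * T' y - expR (- (1 * y)) * T y).
  by apply: is_derive_eq (is_derive_mul (is_derive_expRN 1 y) (dT y)) _; ring.
apply/subr0_eq; rewrite -RintegralB//.
rewrite (@Rintegral_half_line_FTC R _ _ 0 dG).
- by rewrite /T !sub0r opprK mulrN atanN addNr mulr0 oppr0.
- by move=> y; apply: cvgB; apply: cvgM; (exact: ce || exact: cT' || exact: cT).
- exact: integrable_sub.
- apply: (@normr_cvg0 _ _ _ _ _ (fun y => pi * expR (- (1 * y)))).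
    move=> y; rewrite normrM ger0_norm// mulrC ler_wpM2r//; exact: T_le_pi.
  rewrite -(mulr0 pi); apply: cvgM; first exact: cvg_cst.
  exact: cvg_expRN_infty.
Qed.

Lemma cvg_atan_sg (R : realType) (a : R) :
  atan (n.+1%:R * a) @[n --> \oo] --> pi / 2 * Num.sg a.
Proof.
have key (b : R) : 0 < b -> atan (n.+1%:R * b) @[n --> \oo] --> pi / 2.
  move=> b0; apply: (cvg_comp (fun n => n.+1%:R * b) atan); last exact: cvgy_atan.
  apply/cvgryPge => A; near=> n; rewrite -ler_pdivrMr//.
  apply: (@le_trans _ _ n%:R); last by rewrite ler_nat.
  by near: n; exact: nbhs_infty_ger.
have [a0|a0|->] := ltrgt0P a.
- by rewrite gtr0_sg// mulr1; exact: key.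
- rewrite ltr0_sg// mulrN1 -[a]opprK; under eq_fun do rewrite mulrN atanN.
  by apply: cvgN; apply: key; rewrite oppr_gt0.
- by rewrite sgr0 mulr0; under eq_fun do rewrite mulr0 atan0; exact: cvg_cst.
Unshelve. all: by end_near. Qed.

(** The damping is removed along [d = 1 / (n + 1)]: the arctangents become multiples of signs, and
    half of [pi] times the integral of [exp (- y)] over [y > x] remains. *)
Lemma Rintegral_cos_oneDsqr (R : realType) (x : R) : 0 <= x ->
  \int[leb]_(u in `[(0 : R), +oo[) (cos (x * u) / oneDsqr u) = pi / 2 * expR (- x).
Proof.
move=> x0; have mD := @measurable_half_line R.
have ce : continuous (fun y : R => expR (- (1 * y))) := is_derive_continuous (is_derive_expRN 1).
pose I d := \int[leb]_(u in `[(0 : R), +oo[) (expR (- (d * u)) * cos (x * u) / oneDsqr u).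
have odV (u : R) : 0 <= (oneDsqr u)^-1 by rewrite invr_ge0 addr_ge0// sqr_ge0.
have lhs : I n.+1%:R^-1 @[n --> \oo] --> \int[leb]_(u in `[(0 : R), +oo[) (cos (x * u) / oneDsqr u).
  have [] := @Rintegral_dominated_cvg _ _ R leb `[0, +oo[%classic
    (fun n u => expR (- (n.+1%:R^-1 * u)) * cos (x * u) / oneDsqr u)
    (fun u => cos (x * u) / oneDsqr u) (fun u => (oneDsqr u)^-1) => //.
  - move=> n; apply: continuous_measurable_on => u; apply: cvgM; last exact: continuous_oneDsqrV.
    apply: (is_derive_continuous (fun y => is_derive_mul (is_derive_expRN n.+1%:R^-1 y)
      (is_derive_compM (is_derive_cos (x * y))))).
  - move=> u _; rewrite -[X in _ --> X]mul1r; under eq_fun do rewrite -mulrA.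
    apply: cvgM; last exact: cvg_cst.
    rewrite [X in _ --> X](_ : 1 = expR (- (0 * u))); last by rewrite mul0r oppr0 expR0.
    apply: (cvg_comp (fun n : nat => - (n.+1%:R^-1 * u)) expR); last exact: continuous_expR.
    by apply: cvgN; apply: cvgM; [exact: cvg_harmonic|exact: cvg_cst].
  - exact: integrable_oneDsqrV.
  - move=> n u; rewrite /= in_itv /= andbT => u0.
    rewrite !normrM (ger0_norm (odV _)) ger0_norm ?expR_ge0//.
    rewrite ler_piMl// mulr_ile1 ?expR_ge0 ?normr_ge0 ?normr_cos_le1//.
    by rewrite -expR0 ler_expR oppr_le0 mulr_ge0// invr_ge0.
pose g y := expR (- (1 * y)) * (pi / 2 * Num.sg (y - x) + pi / 2 * Num.sg (y - - x)).
have [ig cg] : leb.-integrable `[(0 : R), +oo[ (EFin \o g) /\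
    \int[leb]_(y in `[(0 : R), +oo[) (expR (- (1 * y)) *
      (atan (n.+1%:R^-1^-1 * (y - x)) + atan (n.+1%:R^-1^-1 * (y - - x)))) @[n --> \oo]
    --> \int[leb]_(y in `[(0 : R), +oo[) g y.
  apply: (@Rintegral_dominated_cvg _ _ R leb `[0, +oo[%classic (fun n y => expR (- (1 * y)) * (atan (n.+1%:R^-1^-1 * (y - x)) + atan (n.+1%:R^-1^-1 * (y - - x)))) g (fun u => pi * expR (- (1 * u)))).
  - exact: mD.
  - move=> n; apply: continuous_measurable_on => y; apply: cvgM; first exact: ce.
    by apply: cvgD; [exact: (is_derive_continuous (fun y => @is_derive_atan_affine R n.+1%:R^-1 x y _))|
      exact: (is_derive_continuous (fun y => @is_derive_atan_affine R n.+1%:R^-1 (- x) y _))].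
  - move=> y _; apply: cvgM; first exact: cvg_cst.
    by apply: cvgD; under eq_fun do rewrite invrK; exact: cvg_atan_sg.
  - by apply: integrable_scale => //; exact: integrable_expRN_half_line.
  - move=> n y _; rewrite normrM ger0_norm ?expR_ge0// mulrC ler_wpM2r ?expR_ge0//.
    apply: le_trans (ler_normD _ _) _; rewrite [leRHS]splitr; apply: lerD; rewrite ler_norml.
      by rewrite !ltW// ?atan_ltpi2 ?atan_gtNpi2.
    by rewrite !ltW// ?atan_ltpi2 ?atan_gtNpi2.
have rhs : I n.+1%:R^-1 @[n --> \oo] --> 2^-1 * \int[leb]_(y in `[(0 : R), +oo[) g y.
  rewrite /I; under eq_fun do rewrite damped_cos_oneDsqr//.
  by apply: cvgM; first exact: cvg_cst.
rewrite (cvg_unique _ lhs rhs) //.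
(* The signs cancel for [0 <= y < x] and add up to [2] for [y > x]; the point [y = x] is
   negligible. *)
have -> : \int[leb]_(y in `[(0 : R), +oo[) g y =
    \int[leb]_(y in `[(0 : R), +oo[) ((fun y => pi * expR (- (1 * y))) \_ `[x, +oo[) y.
  rewrite /Rintegral; congr fine; apply: ae_eq_integral => //.
  - by case/integrableP: ig.
  - apply/measurable_EFinP; apply/measurable_restrict => //.
    apply: measurable_funM => //; exact: continuous_measurable_on.
  exists [set x]; split; [exact: measurable_set1|exact: lebesgue_measure_set1|].
  move=> y /=; apply: contra_notP => yx; rewrite in_itv/= andbT => y0; congr EFin.
  rewrite patchE /g; case: ifPn => [/set_mem/=|/negP xy].
    rewrite in_itv /= andbT => xy; have {xy yx}xy : x < y.
      by rewrite lt_neqAle xy andbT; apply/eqP => /esym.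
    have p1 : 0 < y - x by rewrite subr_gt0.
    have p2 : 0 < y - - x by rewrite opprK ltr_pwDl// (le_lt_trans x0).
    by rewrite (gtr0_sg p1) (gtr0_sg p2) mulr1 -splitr mulrC.
  have {}xy : y < x by rewrite ltNge; apply/negP => yx'; apply: xy; rewrite inE/= in_itv/= yx'.
  have p1 : y - x < 0 by rewrite subr_lt0.
  have p2 : 0 < y - - x by rewrite opprK ltr_wpDl// (le_lt_trans y0).
  rewrite (ltr0_sg p1) (gtr0_sg p2).
  by rewrite mulr1 mulrN1 addNr mulr0.
rewrite -Rintegral_mkcondr (_ : `[0, +oo[ `&` `[x, +oo[ = `[x, +oo[)%classic; last first.
  by apply/seteqP; split => y /=; rewrite !in_itv/= !andbT; [case|move=> xy; split => //; apply: le_trans xy].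
pose G (y : R) : R := - pi * expR (- (1 * y)).
have dG (y : R) : is_derive y 1 G (pi * expR (- (1 * y))).
  by apply: is_derive_eq; rewrite /GRing.scale /=; ring.
have cG := is_derive_continuous dG.
rewrite (@Rintegral_ge0_continuous_FTC2y _ _ G x 0) //.
- by rewrite /G mul1r; field.
- by move=> y _; rewrite mulr_ge0 ?expR_ge0 ?pi_ge0.
- by apply: continuous_subspaceT => y; apply: cvgM; [exact: cvg_cst|exact: ce].
- rewrite -[X in _ --> X](mulr0 (- pi)); apply: cvgM; first exact: cvg_cst.
  exact: cvg_expRN_infty.
- by apply: cvg_at_right_filter; exact: cG.
- by move=> y _; rewrite derive1E; exact: derive_val.
Qed.

Lemma integrable_sin_oneDsqr (R : realType) (b : R) :
  leb.-integrable `[(0 : R), +oo[ (EFin \o (fun v => v * sin (b * v) / oneDsqr v ^+ 2)).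
Proof.
have mD := @measurable_half_line R.
have od (v : R) : 0 < oneDsqr v by rewrite ltr_pwDl// sqr_ge0.
apply: (integrable_dominated mD _ _ (integrable_oneDsqrV R)).
  apply: continuous_measurable_on => v; apply: cvgM.
    apply: cvgM; first exact: cvg_id.
    exact: (is_derive_continuous (fun y => is_derive_compM (is_derive_sin (b * y)))).
  apply: cvgV; first by rewrite gt_eqF// exprn_gt0.
  by apply: (cvg_comp oneDsqr (fun y => y ^+ 2)); [exact: continuous_oneDsqr|exact: exprn_continuous].
move=> v _; rewrite !normrM normfV normrX (gtr0_norm (od v)).
rewrite ler_pdivrMr ?exprn_gt0// expr2 mulrA mulVf ?gt_eqF// mul1r.
apply: (@le_trans _ _ `|v|); first by apply: ler_piMr; rewrite ?normr_sin_le1.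
have := sqr_ge0 (`|v| - 2^-1); rewrite /oneDsqr -[v ^+ 2]real_normK ?num_real//.
by nra.
Qed.

(** Integration by parts against [sin (x v) / oneDsqr v] reduces this to the cosine transform. The
    kernel [v / oneDsqr v ^+ 2] comes from differentiating Poisson's kernel. *)
Lemma Rintegral_sin_oneDsqr (R : realType) (x : R) : 0 <= x ->
  \int[leb]_(v in `[(0 : R), +oo[) (v * sin (x * v) / oneDsqr v ^+ 2) =
  pi / 4 * (x * expR (- x)).
Proof.
move=> x0; have mD := @measurable_half_line R.
have od (v : R) : 0 < oneDsqr v by rewrite ltr_pwDl// sqr_ge0.
pose F (v : R) : R := - 2^-1 * (sin (x * v) / oneDsqr v).
have dF (v : R) : is_derive v 1 F (v * sin (x * v) / oneDsqr v ^+ 2 -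
    x / 2 * (cos (x * v) / oneDsqr v)).
  have odv : 1 + v * v != 0 by rewrite -expr2 gt_eqF// od.
  have ds := is_derive_compM (is_derive_sin (x * v)).
  have dV : is_derive v 1 (fun y : R => (oneDsqr y)^-1) (- (oneDsqr v) ^- 2 * (2 * v)).
    have od' : is_derive v 1 (fun y : R => oneDsqr y) (2 * v).
      by apply: is_derive_eq; rewrite /GRing.scale /=; ring.
    have odn : oneDsqr v != 0 by rewrite gt_eqF.
    exact: is_deriveV odn od'.
  have dF0 := is_derive_mul (is_derive_cst (- 2^-1 : R) v 1) (is_derive_mul ds dV).
  rewrite /F; apply: (is_derive_eq dF0).
  by rewrite /cst /oneDsqr; field.
have cc : continuous (fun v : R => cos (x * v) / oneDsqr v).
  move=> v; apply: cvgM; last exact: continuous_oneDsqrV.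
  exact: (is_derive_continuous (fun y => is_derive_compM (is_derive_cos (x * y)))).
have cs : continuous (fun v : R => v * sin (x * v) / oneDsqr v ^+ 2).
  move=> v; apply: cvgM.
    apply: cvgM; first exact: cvg_id.
    exact: (is_derive_continuous (fun y => is_derive_compM (is_derive_sin (x * y)))).
  apply: cvgV; first by rewrite gt_eqF// exprn_gt0.
  by apply: (cvg_comp oneDsqr (fun y => y ^+ 2)); [exact: continuous_oneDsqr|exact: exprn_continuous].
have ic : leb.-integrable `[(0 : R), +oo[ (EFin \o (fun v => cos (x * v) / oneDsqr v)).
  apply: (integrable_dominated mD _ _ (integrable_oneDsqrV R)).
    exact: continuous_measurable_on.
  move=> v _; rewrite normrM normfV (gtr0_norm (od v)).
  by apply: ler_piMl; [rewrite invr_ge0 ltW|exact: normr_cos_le1].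
have is_ := integrable_sin_oneDsqr x.
have ic2 := integrable_scale (x / 2) mD ic.
have F0 : F v @[v --> +oo] --> 0.
  rewrite /F -(mulr0 (- 2^-1)); apply: cvgM; first exact: cvg_cst.
  apply: (@normr_cvg0 _ _ _ _ _ (fun v => (oneDsqr v)^-1)).
    move=> v; rewrite normrM normfV (gtr0_norm (od v)).
    by apply: ler_piMl; [rewrite invr_ge0 ltW|exact: normr_sin_le1].
  apply/gtr0_cvgV0; first by apply: nearW => v; exact: od.
  apply: (@ger_cvgy _ _ _ _ (fun v => v ^+ 2)); last exact: cvgr_expr2.
  by apply: nearW => v; rewrite /oneDsqr lerDr.
have := Rintegral_half_line_FTC dF _ (integrable_sub mD is_ ic2) F0.
rewrite RintegralB// RintegralZl// Rintegral_cos_oneDsqr//.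
rewrite [F 0]/F mulr0 sin0 mul0r mulr0 subr0 => H.
transitivity (x / 2 * (pi / 2 * expR (- x))); last by field.
apply/eqP; rewrite -subr_eq0; apply/eqP; apply: H.
by move=> v; apply: cvgB; [exact: cs|apply: cvgM; [exact: cvg_cst|exact: cc]].
Qed.

(** * Almost everywhere differentiability of Lipschitz functions *)

Lemma ae_imply d (T : measurableType d) (R : realType) (mu : {measure set T -> \bar R})
    (P Q : T -> Prop) :
  (forall x, P x -> Q x) -> (\forall x \ae mu, P x) -> \forall x \ae mu, Q x.
Proof.
by move=> PQ [N [mN N0 PN]]; exists N; split => // x nQ; apply: PN => /PQ.
Qed.

(* The Lebesgue-Stieltjes measure of [h] has a Radon-Nikodym density on bounded
   intervals, and Lebesgue's differentiation theorem applies to its primitive. *)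
Lemma nondecreasing_lipschitz_derivable_ae (R : realType) (h : R -> R) (C : R) :
  0 < C -> (forall x y, x <= y -> 0 <= h y - h x <= C * (y - x)) ->
  \forall t \ae (@lebesgue_measure R), derivable h t 1.
Proof.
move=> C0 hC.
have hnd : nondecreasing h by move=> x y xy; rewrite -subr_ge0; case/andP: (hC _ _ xy).
have hlip x y : `|h x - h y| <= C * `|x - y|.
  wlog xy : x y / y <= x => [H|].
    by case: (leP y x) => [/H//|/ltW/H]; rewrite distrC (distrC y).
  by have /andP[h0 h1] := hC _ _ xy; rewrite !ger0_norm// subr_ge0.
have hc : continuous h.
  move=> x; apply/cvgrPdist_lt => e e0; near=> y.
  apply: le_lt_trans (hlip _ _) _; rewrite mulrC -ltr_pdivlMr//; near: y.
  by apply/nbhs_ballP; exists (e / C) => //=; exact: divr_gt0.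
have hrc : right_continuous h by exact: right_continuousW.
pose H := isCumulative.Build R _ R h hnd hrc.
pose f : cumulative R R := HB.pack h H.
pose nu : {measure set (measurableTypeR R) -> \bar R} := lebesgue_stieltjes_measure f.
have nuE a b : a <= b -> nu `]a, b]%classic = (h b - h a)%:E.
  move=> ab; rewrite /nu /= /lebesgue_stieltjes_measure /measure_extension.
  by rewrite measurable_mu_extE/=; [rewrite wlength_itv_bnd|exact: is_ocitv].
(* Absolute continuity: a cover by half-open intervals of total length below [e / C] has total
   increment of [h] at most [e]. *)
have nu0 A : leb A = 0%E -> nu A = 0%E.
  move=> A0; apply/eqP; rewrite eq_le; apply/andP; split; last exact: outer_measure_ge0.
  apply/lee_addgt0Pr => e e0; rewrite add0e.
  have eC : 0 < e / C by rewrite divr_gt0.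
  have : (ereal_inf [set (\sum_(0 <= k <oo) wlength idfun (X k))%E | X in @measurable_cover _ (ocitv_type R) A] < (e / C)%:E)%E.
    by move: A0; rewrite /lebesgue_measure /lebesgue_stieltjes_measure/= /measure_extension /mu_ext => ->; rewrite lte_fin.
  case/ereal_inf_lt => _ [X cX <-] Xe.
  apply: (@le_trans _ _ (\sum_(0 <= k <oo) wlength f (X k))%E).
    by apply: ereal_inf_lbound; exists X.
  apply: (@le_trans _ _ (\sum_(0 <= k <oo) (C%:E * wlength idfun (X k)))%E).
    apply: lee_nneseries => [k _ _|k _]; first exact: wlength_ge0.
    have [mX _] := cX; have := mX k => /ocitvP[->|[ab ab12 ->]].
      by rewrite !wlength0 mule0.
    have ab12W := ltW ab12.
    rewrite (wlength_itv_bnd f)// (wlength_itv_bnd idfun)// -EFinM lee_fin.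
    by have /andP[] := hC _ _ (ltW ab12).
  rewrite nneseriesZl; last by move=> k _; exact: wlength_ge0.
  rewrite (_ : e%:E = C%:E * (e / C)%:E)%E; last by rewrite -EFinM mulrCA divff ?mulr1// gt_eqF.
  by rewrite lee_pmul2l// ?lte_fin// ltW.
have main (N : nat) : \forall t \ae (@lebesgue_measure R), `|t| < N.+1%:R -> derivable h t 1.
  set M : R := N.+1%:R.
  have mD : measurable (`]- M, M]%classic : set (measurableTypeR R)) by exact: measurable_itv.
  have M0 : - M <= M by rewrite (@le_trans _ _ 0)// ?oppr_le0 /M ler0n.
  have Doo : (nu `](- M)%R, M]%classic < +oo)%E by rewrite nuE// ltry.
  (* The Radon-Nikodym theorem is used for a finite measure, hence the restriction to a bounded
     interval. *)
  pose nuD := charge_of_finite_measure (mfrestr mD Doo).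
  have dom : nuD `<< leb.
    apply/null_content_dominatesP => A mA A0.
    rewrite /nuD /charge_of_finite_measure /mfrestr /mrestr.
    apply: nu0; apply/eqP; rewrite eq_le measure_ge0 andbT -A0.
    by apply: le_measure; rewrite ?inE//; exact: measurableI.
  pose phi x := fine (Radon_Nikodym nuD leb x).
  have iphi : leb.-integrable setT (EFin \o phi).
    apply: eq_integrable (Radon_Nikodym_integrable dom) => // x _ /=.
    by rewrite /phi fineK// Radon_Nikodym_fin_num.
  have hE x : - M < x <= M ->
      \int[leb]_(t in `]- M, x]) phi t = h x - h (- M).
    move=> /andP[Mx xM]; have mx : measurable (`]- M, x]%classic : set (measurableTypeR R)) by exact: measurable_itv.
    have nuDE : nuD `]- M, x]%classic = (h x - h (- M))%:E.
      rewrite -nuE ?ltW//; transitivity (nu (`]- M, x]%classic `&` `]- M, M]%classic)) => //.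
      congr (nu _); apply/seteqP; split => y /=; rewrite !in_itv/=; first by case.
      by move=> /andP[-> yx]; split => //=; apply: le_trans xM.
    have hx := etrans (esym nuDE) (Radon_Nikodym_integral dom mx).
    rewrite /Rintegral -[RHS]/(fine (h x - h (- M))%:E) hx.
    by congr fine; apply: eq_integral => t _; rewrite /phi fineK// Radon_Nikodym_fin_num.
  have liphi : locally_integrable [set: R] phi.
    exact: open_integrable_locally openT iphi.
  have iphiS y : leb.-integrable [set` Interval (BRight (- M)) (BRight y)] (EFin \o phi).
    by apply: integrableS iphi => //; exact: measurable_itv.
  have := FTC1 iphiS liphi.
  apply: ae_imply => t /= Ft.
  rewrite ltr_norml => /andP[Mt tM].
  have [dF _] := Ft Mt.
  (* Near [t], [h] is its value at [- M] plus a primitive of the density, which [FTC1]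
     differentiates almost everywhere. *)
  apply: (near_eq_derivable (f := fun x => h (- M) + \int[leb]_(s in `]- M, x]) phi s)).
    near=> y; rewrite hE; first by rewrite addrC subrK.
    apply/andP; split; near: y; first exact: lt_nbhsr.
    exact: lt_le_nbhsl.
  by apply: derivableD => //; exact: derivable_cst.
have := ae_foralln main; apply: ae_imply => t ht.
by apply: (ht (Num.truncn `|t|)); exact: truncnS_gt.
Unshelve. all: by end_near. Qed.

(** Adding a linear function of slope [|K| + 1] makes [g] nondecreasing, with increments at most
    twice that slope; the extra [1] keeps the constant positive. *)
Lemma lipschitz_derivable_ae (R : realType) (g : R -> R) (K : R) :
  (forall x y, `|g x - g y| <= K * `|x - y|) ->
  \forall t \ae (@lebesgue_measure R), derivable g t 1.
Proof.
move=> gK; have K1 : 0 < `|K| + 1 by rewrite ltr_wpDl.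
have : \forall t \ae (@lebesgue_measure R), derivable (fun x => g x + (`|K| + 1) * x) t 1.
  apply: (@nondecreasing_lipschitz_derivable_ae R _ (2 * (`|K| + 1))).
    by rewrite mulr_gt0.
  move=> x y xy; have := gK y x; rewrite (@ger0_norm _ (y - x)) ?subr_ge0// => gxy.
  have : `|g y - g x| <= (`|K| + 1) * (y - x).
    apply: le_trans gxy _; rewrite ler_wpM2r ?subr_ge0//.
    by rewrite (le_trans (ler_norm _))// lerDl.
  rewrite ler_norml => /andP[]; set L := `|K| + 1.
  by move=> *; apply/andP; split; nra.
apply: ae_imply => t dt; have -> : g = (fun x => (g x + (`|K| + 1) * x) + - ((`|K| + 1) * x)).
  by apply/funext => x; rewrite addrK.
apply: derivableD => //; apply: derivableN.
Qed.

(** * Exponential sums in the half plane *)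

Lemma Rintegral_sum d (T : measurableType d) (R : realType)
    (mu : {measure set T -> \bar R}) (D : set T) (I : Type) (s : seq I) (F : I -> T -> R) :
  measurable D -> (forall i, mu.-integrable D (EFin \o F i)) ->
  mu.-integrable D (EFin \o (fun x => \sum_(i <- s) F i x)) /\
  \int[mu]_(x in D) \sum_(i <- s) F i x = \sum_(i <- s) \int[mu]_(x in D) F i x.
Proof.
move=> mD iF; elim: s => [|i s [IH1 IH2]].
  rewrite big_nil; split.
    by apply: eq_integrable (@integrable0 _ _ _ mu D) => // x _; rewrite /= big_nil.
  under eq_Rintegral do rewrite big_nil.
  by rewrite Rintegral_cst// mul0r.
split.
  apply: eq_integrable (integrable_add mD (iF i) IH1) => // x _.
  by rewrite /= big_cons.
rewrite big_cons -IH2 -RintegralD//.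
by apply: eq_Rintegral => x _; rewrite big_cons.
Qed.

(* [(a, b, l)] stands for the summand [(a + i b) exp (- l (x + i t))];
   [expsum L x t] is the real part of the sum and [expsum (rot L) x t] its
   imaginary part. *)
Definition expsum (R : realType) (L : seq (R * R * R)) (x t : R) : R :=
  \sum_(p <- L) expR (- (p.2 * x)) * (p.1.1 * cos (p.2 * t) + p.1.2 * sin (p.2 * t)).

Definition rot (R : realType) (L : seq (R * R * R)) : seq (R * R * R) :=
  [seq (p.1.2, - p.1.1, p.2) | p <- L].

(** Corresponds to multiplying the sum by [exp (l (x + i t))]. *)
Definition shift (R : realType) (l : R) (L : seq (R * R * R)) : seq (R * R * R) :=
  [seq (p.1, p.2 - l) | p <- L].

(** The inverse of [1 - d/ds] on exponential sums in the variable [s = x + i t]. *)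
Definition resolvent (R : realType) (L : seq (R * R * R)) : seq (R * R * R) :=
  [seq (p.1.1 / (1 + p.2), p.1.2 / (1 + p.2), p.2) | p <- L].

Lemma expsum_rotK (R : realType) (L : seq (R * R * R)) x t :
  expsum (rot (rot L)) x t = - expsum L x t.
Proof.
rewrite /expsum /rot !big_map -sumrN; apply: eq_bigr => p _ /=.
by rewrite !mulNr -opprD mulrN.
Qed.

Lemma expsum_ext (R : realType) (L : seq (R * R * R)) (F : R * R * R -> R) x t :
  {in L, forall p, expR (- (p.2 * x)) * (p.1.1 * cos (p.2 * t) + p.1.2 * sin (p.2 * t)) = F p} ->
  expsum L x t = \sum_(p <- L) F p.
Proof. by move=> LF; rewrite /expsum; apply: eq_big_seq. Qed.

Lemma continuous_expsum (R : realType) (L : seq (R * R * R)) x : continuous (expsum L x).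
Proof.
apply: (@is_derive_continuous R _ (fun t => \sum_(p <- L)
  expR (- (p.2 * x)) * (p.1.1 * (p.2 * - sin (p.2 * t)) + p.1.2 * (p.2 * cos (p.2 * t))))).
move=> t; rewrite /expsum; elim: L => [|p L IH].
  by under eq_fun do rewrite big_nil; rewrite big_nil; exact: is_derive_cst.
under eq_fun do rewrite big_cons; rewrite big_cons.
apply: is_derive_add => //.
have dc := is_derive_compM (is_derive_cos (p.2 * t)).
have ds := is_derive_compM (is_derive_sin (p.2 * t)).
by apply: is_derive_eq; rewrite /GRing.scale /=; ring.
Qed.

Lemma continuous_expsum_l (R : realType) (L : seq (R * R * R)) t :
  continuous (fun x => expsum L x t).
Proof.
  apply: (@is_derive_continuous R _ (fun x => \sum_(p <- L)
  (- p.2 * expR (- (p.2 * x)) * (p.1.1 * cos (p.2 * t) + p.1.2 * sin (p.2 * t))))).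
move=> x; rewrite /expsum; elim: L => [|p L IH].
  by under eq_fun do rewrite big_nil; rewrite big_nil; exact: is_derive_cst.
under eq_fun do rewrite big_cons; rewrite big_cons.
apply: is_derive_add => //; apply: is_derive_eq (is_derive_mul (is_derive_expRN p.2 x)
  (is_derive_cst (p.1.1 * cos (p.2 * t) + p.1.2 * sin (p.2 * t)) x 1)) _.
by rewrite mulr0 addr0.
Qed.

(** Integrable majorant of the differentiated Poisson kernel; it rests on [|v| <= v ^ 2 + 1 / 4]. *)
Lemma kernel_le (R : realType) (v : R) : `|v / oneDsqr v ^+ 2| <= (oneDsqr v)^-1.
Proof.
have od : 0 < oneDsqr v by rewrite ltr_pwDl// sqr_ge0.
rewrite normrM normfV normrX (gtr0_norm od).
rewrite ler_pdivrMr ?exprn_gt0// expr2 mulrA mulVf ?gt_eqF// mul1r.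
have := sqr_ge0 (`|v| - 2^-1); rewrite /oneDsqr -[v ^+ 2]real_normK ?num_real//.
by nra.
Qed.

Lemma integrable_cos_oneDsqr (R : realType) (b : R) :
  leb.-integrable `[(0 : R), +oo[ (EFin \o (fun v => cos (b * v) / oneDsqr v)).
Proof.
have mD := @measurable_half_line R.
apply: (integrable_dominated mD _ _ (integrable_oneDsqrV R)).
  apply: continuous_measurable_on => v; apply: cvgM; last exact: continuous_oneDsqrV.
  exact: (is_derive_continuous (fun y => is_derive_compM (is_derive_cos (b * y)))).
have od (v : R) : 0 < oneDsqr v by rewrite ltr_pwDl// sqr_ge0.
move=> v _; rewrite normrM normfV (gtr0_norm (od v)).
by apply: ler_piMl; [rewrite invr_ge0 ltW|exact: normr_cos_le1].
Qed.

(** Adding the values at [t + x v] and [t - x v] leaves [2 cos (p.2 x v)] times the term at [t], and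
    the cosine transform turns this into [exp (- p.2 x)]; here the sign of the frequencies
    enters. *)
Lemma expsum_poisson (R : realType) (L : seq (R * R * R)) (x t : R) :
  {in L, forall p, 0 <= p.2} -> 0 <= x ->
  expsum L x t = pi^-1 * \int[leb]_(v in `[(0 : R), +oo[)
    ((expsum L 0 (t + x * v) + expsum L 0 (t - x * v)) / oneDsqr v).
Proof.
move=> L0 x0; have mD := @measurable_half_line R.
pose F (p : R * R * R) v := 2 * (p.1.1 * cos (p.2 * t) + p.1.2 * sin (p.2 * t)) *
   (cos ((p.2 * x) * v) / oneDsqr v).
have iF p : leb.-integrable `[(0 : R), +oo[ (EFin \o F p).
  by apply: integrable_scale => //; exact: integrable_cos_oneDsqr.
transitivity (pi^-1 * \int[leb]_(v in `[(0 : R), +oo[) \sum_(p <- L) F p v); last first.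
  congr (_ * _); apply: eq_Rintegral => v _; rewrite /expsum -big_split/= big_distrl/=.
  apply: eq_bigr => p _; rewrite /F mulr0 oppr0 expR0 !mul1r.
  have -> : p.2 * (t + x * v) = p.2 * t + p.2 * x * v by ring.
  have -> : p.2 * (t - x * v) = p.2 * t - p.2 * x * v by ring.
  by rewrite cosD sinD cosB sinB; ring.
have [_ ->] := Rintegral_sum L mD iF.
rewrite mulr_sumr; apply: expsum_ext => p pL; rewrite /F RintegralZl//; last exact: integrable_cos_oneDsqr.
rewrite Rintegral_cos_oneDsqr ?mulr_ge0 ?L0//.
have p0 : pi != 0 :> R by rewrite gt_eqF ?pi_gt0.
by move: p0; generalize (pi : R) => P p0; field.
Qed.

(** Maximum principle: Poisson's kernel is positive and has mass one, so the constant is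
    unchanged. *)
Lemma expsum_le (R : realType) (L : seq (R * R * R)) (M x t : R) :
  {in L, forall p, 0 <= p.2} -> 0 <= x -> (forall t, `|expsum L 0 t| <= M) ->
  `|expsum L x t| <= M.
Proof.
move=> L0 x0 LM; have mD := @measurable_half_line R.
have od (v : R) : 0 < oneDsqr v by rewrite ltr_pwDl// sqr_ge0.
rewrite expsum_poisson// normrM gtr0_norm ?invr_gt0 ?pi_gt0// mulrC ler_pdivrMr ?pi_gt0//.
have cl (s : R) : continuous (fun v => expsum L 0 (t + s * v)).
  move=> v; apply: (cvg_comp (fun v => t + s * v) (expsum L 0)); last exact: continuous_expsum.
  by apply: cvgD; [exact: cvg_cst|apply: cvgM; [exact: cvg_cst|exact: cvg_id]].
have bnd v : `|(expsum L 0 (t + x * v) + expsum L 0 (t - x * v)) / oneDsqr v| <= 2 * M * (oneDsqr v)^-1.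
  rewrite normrM normfV (gtr0_norm (od v)); apply: ler_wpM2r; first by rewrite invr_ge0 ltW.
  by rewrite (le_trans (ler_normD _ _))// mulr_natl mulr2n lerD.
have iM := integrable_scale (2 * M) mD (integrable_oneDsqrV R).
have iL : leb.-integrable `[(0 : R), +oo[ (EFin \o (fun v =>
    (expsum L 0 (t + x * v) + expsum L 0 (t - x * v)) / oneDsqr v)).
  apply: (integrable_dominated mD _ _ iM) => //.
  apply: continuous_measurable_on => v; apply: cvgM; last exact: continuous_oneDsqrV.
  apply: cvgD; first exact: cl.
  by under eq_fun do rewrite -mulNr; rewrite -mulNr; exact: cl.
apply: le_trans (le_normr_Rintegral mD iL) _.
apply: (@le_trans _ _ (\int[leb]_(v in `[(0 : R), +oo[) (2 * M * (oneDsqr v)^-1))).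
  by apply: le_Rintegral => //; exact: integrable_norm.
rewrite RintegralZl//; last exact: integrable_oneDsqrV.
rewrite /Rintegral integral0y_oneDsqr /=.
by rewrite le_eqVlt; apply/orP; left; apply/eqP; field.
Qed.

(** Lowering all frequencies by [l] multiplies the boundary values by a unimodular factor, and
    [exp (- l x)] can be taken out. The factor mixes real and imaginary parts, whence [2 * M]. *)
Lemma expsum_decay (R : realType) (L : seq (R * R * R)) (M l x : R) :
  0 <= x -> {in L, forall p, l <= p.2} ->
  (forall t, `|expsum L 0 t| <= M) -> (forall t, `|expsum (rot L) 0 t| <= M) ->
  `|expsum L x 0| <= 2 * M * expR (- (l * x)).
Proof.
move=> x0 Ll LM rM.
have sE t : expsum (shift l L) 0 t = cos (l * t) * expsum L 0 t - sin (l * t) * expsum (rot L) 0 t.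
  rewrite /expsum /shift /rot !big_map/= !mulr_sumr -sumrB; apply: eq_bigr => p _ /=.
  rewrite !mulr0 !oppr0 !expR0 !mul1r !mulrBl cosB sinB; ring.
have sx : expsum L x 0 = expR (- (l * x)) * expsum (shift l L) x 0.
  rewrite /expsum /shift big_map mulr_sumr; apply: eq_bigr => p _ /=.
  by rewrite !mulr0 mulrA -expRD; congr (expR _ * _); ring.
rewrite sx normrM (ger0_norm (expR_ge0 _)) mulrC ler_wpM2r ?expR_ge0//.
apply: expsum_le => //.
  by move=> _ /mapP[p pL ->] /=; rewrite subr_ge0 Ll.
move=> t; rewrite sE (le_trans (ler_normB _ _))// mulr_natl mulr2n !normrM.
by apply: lerD; apply: le_trans (ler_piMl _ _) _; rewrite ?normr_ge0 ?normr_cos_le1 ?normr_sin_le1.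
Qed.

(** If [g] is the resolvent of [f], then [g' = g - f], so the derivative of [g (i t)] in [t] is
    [i (g - f)]; this is its real part. *)
Lemma is_derive_resolvent (R : realType) (L : seq (R * R * R)) (t : R) :
  {in L, forall p, 0 <= p.2} ->
  is_derive t 1 (expsum (resolvent L) 0) (expsum (rot L) 0 t - expsum (rot (resolvent L)) 0 t).
Proof.
elim: L => [|p L IH] L0.
  rewrite /expsum /=; under eq_fun do rewrite big_nil.
  by rewrite !big_nil subrr; exact: is_derive_cst.
have p1 : 1 + p.2 != 0 by rewrite gt_eqF// ltr_pwDl// L0// mem_head.
have {}IH := IH (fun q qL => L0 q (mem_behead (s := p :: L) qL)).
have -> : expsum (resolvent (p :: L)) 0 = fun t => (p.1.1 / (1 + p.2) * cos (p.2 * t) +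
    p.1.2 / (1 + p.2) * sin (p.2 * t)) + expsum (resolvent L) 0 t.
  by apply/funext => s; rewrite /expsum /resolvent /= big_cons/= mulr0 oppr0 expR0 mul1r.
have dc := is_derive_compM (is_derive_cos (p.2 * t)).
have ds := is_derive_compM (is_derive_sin (p.2 * t)).
have dp : is_derive t 1 (fun t => p.1.1 / (1 + p.2) * cos (p.2 * t) +
    p.1.2 / (1 + p.2) * sin (p.2 * t)) ((1 - (1 + p.2)^-1) * (p.1.2 * cos (p.2 * t) - p.1.1 * sin (p.2 * t))).
  by apply: is_derive_eq; rewrite /GRing.scale /=; field.
apply: is_derive_eq (is_derive_add dp IH) _.
by rewrite /expsum /resolvent /rot /= !big_cons/= !mulr0 !oppr0 !expR0; field.
Qed.

(** Expresses boundary values of the resolvent by interior values of the sum, which is what lets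
    them pass to the limit. *)
Lemma resolvent_integral (R : realType) (L : seq (R * R * R)) (t : R) :
  {in L, forall p, 0 <= p.2} ->
  expsum (resolvent L) 0 t = \int[leb]_(x in `[(0 : R), +oo[) (expR (- (1 * x)) * expsum L x t).
Proof.
move=> L0; have mD := @measurable_half_line R.
(* The absolute value makes [F p] integrable for every triple [p], as [Rintegral_sum] asks, and
   changes nothing on [L]. *)
pose l (p : R * R * R) := 1 + `|p.2|.
have l0 p : 0 < l p by rewrite /l ltr_pwDl.
pose F p x := (p.1.1 * cos (p.2 * t) + p.1.2 * sin (p.2 * t)) * expR (- (l p * x)).
have iF p : leb.-integrable `[(0 : R), +oo[ (EFin \o F p).
  by apply: integrable_scale => //; exact: integrable_expRN_half_line.
transitivity (\int[leb]_(x in `[(0 : R), +oo[) \sum_(p <- L) F p x); last first.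
  apply: eq_Rintegral => x _; rewrite /expsum mulr_sumr; apply: eq_big_seq => p pL.
  rewrite /F /l (ger0_norm (L0 _ pL)).
  have -> : - ((1 + p.2) * x) = - (1 * x) + - (p.2 * x) by ring.
  by rewrite expRD; ring.
have [_ ->] := Rintegral_sum L mD iF.
rewrite /resolvent /expsum big_map; apply: eq_big_seq => p pL /=.
rewrite /F RintegralZl//; last exact: integrable_expRN_half_line.
have := @Rintegral_damped_cos R (l p) 0 (l0 p).
under eq_Rintegral do rewrite mul0r cos0 mulr1.
move=> ->; rewrite mulr0 oppr0 expR0 expr0n addr0 /l (ger0_norm (L0 _ pL)).
have p1 : 1 + p.2 != 0 by rewrite gt_eqF// ltr_pwDl// L0.
by field.
Qed.

Lemma resolvent_le (R : realType) (L : seq (R * R * R)) (M t : R) :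
  {in L, forall p, 0 <= p.2} -> (forall t, `|expsum L 0 t| <= M) ->
  `|expsum (resolvent L) 0 t| <= M.
Proof.
move=> L0 LM; have mD := @measurable_half_line R.
have ie := integrable_expRN_half_line (@ltr01 R).
rewrite resolvent_integral//.
have bnd x : x \in `[(0 : R), +oo[ -> `|expR (- (1 * x)) * expsum L x t| <= M * expR (- (1 * x)).
  rewrite in_itv /= andbT => x0; rewrite normrM ger0_norm ?expR_ge0// mulrC.
  by apply: ler_wpM2r; [exact: expR_ge0|exact: expsum_le].
have cx := @continuous_expsum_l R L t.
have iL : leb.-integrable `[(0 : R), +oo[ (EFin \o (fun x => expR (- (1 * x)) * expsum L x t)).
  apply: (integrable_dominated mD _ _ (integrable_scale M mD ie)) => //.
  apply: continuous_measurable_on => x; apply: cvgM; last exact: cx.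
  exact: (is_derive_continuous (is_derive_expRN 1)).
apply: le_trans (le_normr_Rintegral mD iL) _.
apply: (@le_trans _ _ (\int[leb]_(x in `[(0 : R), +oo[) (M * expR (- (1 * x))))).
  by apply: le_Rintegral => //; [exact: integrable_norm|exact: integrable_scale].
rewrite RintegralZl//.
have := @Rintegral_damped_cos R 1 0 ltr01.
under eq_Rintegral do rewrite mul0r cos0 mulr1.
by move=> ->; rewrite expr0n addr0 expr1n divr1 mulr1.
Qed.

Lemma rot_resolvent (R : realType) (L : seq (R * R * R)) :
  rot (resolvent L) = resolvent (rot L).
Proof. by rewrite /rot /resolvent -!map_comp; apply: eq_map => p /=; rewrite mulNr. Qed.

(** Mean value theorem: both terms of the derivative are bounded by [M], the second because taking
    the resolvent preserves bounds. *)
Lemma resolvent_lipschitz (R : realType) (L : seq (R * R * R)) (M s t : R) :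
  {in L, forall p, 0 <= p.2} -> (forall t, `|expsum (rot L) 0 t| <= M) ->
  `|expsum (resolvent L) 0 s - expsum (resolvent L) 0 t| <= 2 * M * `|s - t|.
Proof.
move=> L0 LM; wlog st : s t / t <= s => [H|].
  by case: (leP t s) => [/H//|/ltW/H]; rewrite distrC (distrC t).
move: st; rewrite le_eqVlt => /predU1P[->|st]; first by rewrite !subrr normr0 mulr0.
have rL0 : {in rot L, forall p, 0 <= p.2} by move=> _ /mapP[p pL ->]; exact: (L0 _ pL).
have [||c _ ->] := @MVT R (expsum (resolvent L) 0)
  (fun t => expsum (rot L) 0 t - expsum (rot (resolvent L)) 0 t) t s st.
- by move=> x _; exact: is_derive_resolvent.
- by apply: continuous_subspaceT; exact: continuous_expsum.
rewrite normrM ler_wpM2r// (le_trans (ler_normB _ _))// mulr_natl mulr2n lerD//.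
by rewrite rot_resolvent; exact: resolvent_le.
Qed.

(** This is [f = g - g'] for the resolvent [g]: the first integral is Poisson's formula for the real
    part of [g], and the second is the tangential derivative of Poisson's formula for its imaginary
    part, moved onto the kernel. The identity is checked term by term. *)
Lemma expsum_resolvent (R : realType) (L : seq (R * R * R)) (x t : R) :
  {in L, forall p, 0 <= p.2} -> 0 < x ->
  expsum L x t = pi^-1 * \int[leb]_(v in `[(0 : R), +oo[)
      ((expsum (resolvent L) 0 (t + x * v) + expsum (resolvent L) 0 (t - x * v)) / oneDsqr v)
    - 2 / pi * \int[leb]_(v in `[(0 : R), +oo[)
      (x^-1 * (expsum (rot (resolvent L)) 0 (t + x * v) - expsum (rot (resolvent L)) 0 (t - x * v))
       * (v / oneDsqr v ^+ 2)).
Proof.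
move=> L0 x0; have mD := @measurable_half_line R.
rewrite -expsum_poisson ?ltW//; last by move=> _ /mapP[p pL ->]; exact: (L0 _ pL).
pose F (p : R * R * R) v := - 2 * x^-1 * ((p.1.1 * cos (p.2 * t) + p.1.2 * sin (p.2 * t)) / (1 + p.2)) *
   (v * sin ((p.2 * x) * v) / oneDsqr v ^+ 2).
have iF p : leb.-integrable `[(0 : R), +oo[ (EFin \o F p).
  by apply: integrable_scale => //; exact: integrable_sin_oneDsqr.
have -> : \int[leb]_(v in `[(0 : R), +oo[)
      (x^-1 * (expsum (rot (resolvent L)) 0 (t + x * v) - expsum (rot (resolvent L)) 0 (t - x * v))
       * (v / oneDsqr v ^+ 2)) = \int[leb]_(v in `[(0 : R), +oo[) \sum_(p <- L) F p v.
  apply: eq_Rintegral => v _.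
  rewrite /expsum /rot /resolvent !big_map -sumrB mulr_sumr mulr_suml; apply: eq_big_seq => p pL /=.
  rewrite /F !mulr0 oppr0 expR0 !mul1r.
  have -> : p.2 * (t + x * v) = p.2 * t + p.2 * x * v by ring.
  have -> : p.2 * (t - x * v) = p.2 * t - p.2 * x * v by ring.
  by rewrite cosD sinD cosB sinB; ring.
have [_ ->] := Rintegral_sum L mD iF.
rewrite mulr_sumr /expsum /resolvent big_map -sumrB; apply: eq_big_seq => p pL /=.
rewrite /F RintegralZl//; last exact: integrable_sin_oneDsqr.
rewrite Rintegral_sin_oneDsqr ?mulr_ge0 ?L0// ?ltW//.
have p1 : 1 + p.2 != 0 by rewrite gt_eqF// ltr_pwDl// L0.
have p0 : pi != 0 :> R by rewrite gt_eqF ?pi_gt0.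
have x1 : x != 0 by rewrite gt_eqF.
by move: p0; generalize (pi : R) => P p0; field; rewrite p0 p1 x1.
Qed.

Lemma lipschitz_continuous (R : realType) (f : R -> R) (K : R) :
  (forall s t, `|f s - f t| <= K * `|s - t|) -> continuous f.
Proof.
move=> fK s; have K0 : 0 <= K.
  by have := fK 1 0; rewrite subr0 normr1 mulr1; apply: le_trans; exact: normr_ge0.
apply/cvgrPdist_le => e e0; near=> r.
apply: le_trans (fK _ _) _; apply: (@le_trans _ _ ((K + 1) * `|s - r|)).
  by rewrite ler_wpM2r// lerDl.
rewrite mulrC -ler_pdivlMr ?ltr_wpDl//; near: r.
apply/nbhs_ballP; exists (e / (K + 1)) => /=; first by rewrite divr_gt0// ltr_wpDl.
by move=> r; rewrite /ball/= => /ltW.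
Unshelve. all: by end_near. Qed.

(* Poisson representation of [u], the limit of real parts of exponential sums,
   by the boundary values [a], [b] of the real and imaginary parts of the
   resolvent; these are Lipschitz, which replaces weak-* compactness. *)
Lemma limit_expsum_boundary (R : realType) (L : nat -> seq (R * R * R)) (M : R)
    (u v : R -> R -> R) :
  (forall n, {in L n, forall p, 0 <= p.2}) ->
  (forall n t, `|expsum (L n) 0 t| <= M) -> (forall n t, `|expsum (rot (L n)) 0 t| <= M) ->
  (forall x t, 0 < x -> expsum (L n) x t @[n --> \oo] --> u x t) ->
  (forall x t, 0 < x -> expsum (rot (L n)) x t @[n --> \oo] --> v x t) ->
  exists a b : R -> R, [/\ forall t, `|a t| <= M,
    forall s t, `|a s - a t| <= 2 * M * `|s - t|,
    forall s t, `|b s - b t| <= 2 * M * `|s - t| &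
    forall x t, 0 < x -> u x t =
      pi^-1 * \int[leb]_(v in `[(0 : R), +oo[) ((a (t + x * v) + a (t - x * v)) / oneDsqr v)
      - 2 / pi * \int[leb]_(v in `[(0 : R), +oo[)
        (x^-1 * (b (t + x * v) - b (t - x * v)) * (v / oneDsqr v ^+ 2))].
Proof.
move=> L0 LM rM Lu Lv; have mD := @measurable_half_line R.
have od (s : R) : 0 < oneDsqr s by rewrite ltr_pwDl// sqr_ge0.
have odV (s : R) : 0 <= (oneDsqr s)^-1 by rewrite invr_ge0 ltW.
have M0 : 0 <= M by exact: le_trans (LM 0%N 0).
have rL0 n : {in rot (L n), forall p, 0 <= p.2} by move=> _ /mapP[p pL ->]; exact: (L0 _ _ pL).
(* The limit is the integral of [exp (- x) w x t] over the open half line, since [w] is known only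
   for [x > 0]. *)
have key (K : nat -> seq (R * R * R)) (w : R -> R -> R) :
    (forall n, {in K n, forall p, 0 <= p.2}) -> (forall n t, `|expsum (K n) 0 t| <= M) ->
    (forall x t, 0 < x -> expsum (K n) x t @[n --> \oo] --> w x t) ->
    exists a : R -> R, forall t, expsum (resolvent (K n)) 0 t @[n --> \oo] --> a t.
  move=> K0 KM Kw.
  exists (fun t => \int[leb]_(x in `](0 : R), +oo[) (expR (- (1 * x)) * w x t)) => t.
  have mDo : @measurable _ (measurableTypeR R) `](0 : R), +oo[ by exact: measurable_itv.
  have ie := integrable_expRN_half_line (@ltr01 R).
  have mexp n : measurable_fun setT (fun x : measurableTypeR R => expR (- (1 * x)) * expsum (K n) x t).
    apply: continuous_measurable_on => x; apply: cvgM.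
      exact: (is_derive_continuous (is_derive_expRN 1)).
    exact: continuous_expsum_l.
  have bnd n (x : R) : 0 <= x -> `|expR (- (1 * x)) * expsum (K n) x t| <= M * expR (- (1 * x)).
    move=> x0; rewrite normrM ger0_norm ?expR_ge0// mulrC.
    by apply: ler_wpM2r; [exact: expR_ge0|exact: expsum_le].
  have [|||||_] := @Rintegral_dominated_cvg _ _ R leb `]0, +oo[%classic
    (fun n x => expR (- (1 * x)) * expsum (K n) x t) (fun x => expR (- (1 * x)) * w x t)
    (fun x => M * expR (- (1 * x))).
  - exact: mDo.
  - by move=> n; exact: measurable_funTS.
  - move=> x; rewrite /= in_itv /= andbT => x0.
    by apply: cvgM; [exact: cvg_cst|exact: Kw].
  - apply: integrableS (integrable_scale M mD ie) => //.
    by apply: subset_itvr; rewrite bnd_simp.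
  - by move=> n x; rewrite /= in_itv /= andbT => /ltW x0; exact: bnd.
  apply: cvg_trans; apply: near_eq_cvg; apply: nearW => n.
  rewrite resolvent_integral// Rintegral_itv_obnd_cbnd//.
  apply: integrableS (_ : leb.-integrable `[(0 : R), +oo[ _) => //.
    by apply: subset_itvr; rewrite bnd_simp.
  apply: (integrable_dominated mD _ _ (integrable_scale M mD ie)); first exact: measurable_funTS.
  by move=> x; rewrite /= in_itv /= andbT => x0; exact: bnd.
have [a wa] := key L u L0 LM Lu.
have [b wb] := key (fun n => rot (L n)) v rL0 rM Lv.
have wb' t : expsum (rot (resolvent (L n))) 0 t @[n --> \oo] --> b t.
  by rewrite (funext (fun n => congr1 (fun K => expsum K 0 t) (rot_resolvent (L n)))); exact: wb.
have cvg_bound (f g : nat -> R) (l k B : R) : f n @[n --> \oo] --> l -> g n @[n --> \oo] --> k ->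
    (forall n, `|f n - g n| <= B) -> `|l - k| <= B.
  move=> fl gk fgB; apply: (cvgr_to_le (cvg_norm (cvgB fl gk))).
  by apply: nearW => n; exact: fgB.
have aM t : `|a t| <= M.
  rewrite -[a t]subr0; apply: (cvg_bound _ (fun=> 0) _ _ _ (wa t)); first exact: cvg_cst.
  by move=> n; rewrite subr0; exact: resolvent_le.
have aL s t : `|a s - a t| <= 2 * M * `|s - t|.
  by apply: (cvg_bound _ _ _ _ _ (wa s) (wa t)) => n; exact: resolvent_lipschitz.
(* Applying [rot] twice changes the sign, so the constant for [b] comes from the bound on [L]
   itself. *)
have bL s t : `|b s - b t| <= 2 * M * `|s - t|.
  apply: (cvg_bound _ _ _ _ _ (wb s) (wb t)) => n; apply: resolvent_lipschitz => // r.
  by rewrite expsum_rotK normrN.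
exists a, b; split=> // x t x0.
have clin (f : R -> R) (s : R) : continuous f -> continuous (fun v => f (t + s * v)).
  move=> cf r; apply: (cvg_comp (fun v => t + s * v) f); last exact: cf.
  by apply: cvgD; [exact: cvg_cst|apply: cvgM; [exact: cvg_cst|exact: cvg_id]].
have clinN (f : R -> R) (s : R) : continuous f -> continuous (fun v => f (t - s * v)).
  by move=> cf; under eq_fun do rewrite -mulNr; exact: clin.
have cQ : continuous (fun v : R => v / oneDsqr v ^+ 2).
  move=> s; apply: cvgM; first exact: cvg_id.
  apply: cvgV; first by rewrite gt_eqF// exprn_gt0.
  by apply: (cvg_comp oneDsqr (fun y => y ^+ 2)); [exact: continuous_oneDsqr|exact: exprn_continuous].
apply: (cvg_unique _ (Lu x t x0)) => //=.
rewrite (funext (fun n => @expsum_resolvent R (L n) x t (L0 n) x0)).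
have cw n : continuous (expsum (resolvent (L n)) 0) by exact: continuous_expsum.
have cr n : continuous (expsum (rot (resolvent (L n))) 0) by exact: continuous_expsum.
apply: cvgB; apply: cvgM; try exact: cvg_cst.
  have [|||||_ //] := @Rintegral_dominated_cvg _ _ R leb `[0, +oo[%classic
    (fun n v => (expsum (resolvent (L n)) 0 (t + x * v) + expsum (resolvent (L n)) 0 (t - x * v)) / oneDsqr v)
    (fun v => (a (t + x * v) + a (t - x * v)) / oneDsqr v) (fun v => 2 * M * (oneDsqr v)^-1).
  - exact: mD.
  - move=> n; apply: continuous_measurable_on => s; apply: cvgM; last exact: continuous_oneDsqrV.
    by apply: cvgD; [exact: clin|exact: clinN].
  - move=> s _; apply: cvgM; last exact: cvg_cst.
    by apply: cvgD; exact: wa.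
  - by apply: integrable_scale => //; exact: integrable_oneDsqrV.
  - move=> n s _; rewrite normrM [X in _ * X]ger0_norm//; apply: ler_wpM2r => //.
    by rewrite (le_trans (ler_normD _ _))// mulr_natl mulr2n lerD// resolvent_le.
have [|||||_ //] := @Rintegral_dominated_cvg _ _ R leb `[0, +oo[%classic
    (fun n v => x^-1 * (expsum (rot (resolvent (L n))) 0 (t + x * v) - expsum (rot (resolvent (L n))) 0 (t - x * v))
       * (v / oneDsqr v ^+ 2))
    (fun v => x^-1 * (b (t + x * v) - b (t - x * v)) * (v / oneDsqr v ^+ 2))
    (fun v => 2 * M * x^-1 * (oneDsqr v)^-1).
- exact: mD.
- move=> n; apply: continuous_measurable_on => s; apply: cvgM; last exact: cQ.
  apply: cvgM; first exact: cvg_cst.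
  by apply: cvgB; [exact: clin|exact: clinN].
- move=> s _; apply: cvgM; last exact: cvg_cst.
  apply: cvgM; first exact: cvg_cst.
  by apply: cvgB; exact: wb'.
- by apply: integrable_scale => //; exact: integrable_oneDsqrV.
- move=> n s; rewrite /= in_itv /= andbT => s0.
  rewrite !normrM (@ger0_norm _ x^-1) ?invr_ge0 ?(ltW x0)//.
  apply: ler_pM; rewrite ?mulr_ge0 ?normr_ge0 ?invr_ge0 ?(ltW x0)//.
    rewrite mulrC; apply: ler_wpM2r; first by rewrite invr_ge0 ltW.
    by rewrite (le_trans (ler_normB _ _))// mulr_natl mulr2n lerD// rot_resolvent resolvent_le.
  by rewrite -normrM; exact: kernel_le.
Qed.

(** One dominated convergence argument in the representation by [a] and [b] serves twice: along
    sequences tending to [x > 0] it gives continuity, which later reduces convergence at [0] to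
    rational points, and along sequences tending to [0] it gives the boundary limit. *)
Lemma limit_expsum_fatou (R : realType) (L : nat -> seq (R * R * R)) (M : R)
    (u v : R -> R -> R) :
  (forall n, {in L n, forall p, 0 <= p.2}) ->
  (forall n t, `|expsum (L n) 0 t| <= M) -> (forall n t, `|expsum (rot (L n)) 0 t| <= M) ->
  (forall x t, 0 < x -> expsum (L n) x t @[n --> \oo] --> u x t) ->
  (forall x t, 0 < x -> expsum (rot (L n)) x t @[n --> \oo] --> v x t) ->
  (forall x t : R, 0 < x -> u y t @[y --> x] --> u x t) /\
  \forall t \ae (@lebesgue_measure R), cvg (u x t @[x --> 0^'+]).
Proof.
move=> L0 LM rM Lu Lv; have mD := @measurable_half_line R.
have [a [b [aM aL bL uE]]] := limit_expsum_boundary L0 LM rM Lu Lv.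
have M0 : 0 <= M by exact: le_trans (LM 0%N 0).
have od (s : R) : 0 < oneDsqr s by rewrite ltr_pwDl// sqr_ge0.
have odV (s : R) : 0 <= (oneDsqr s)^-1 by rewrite invr_ge0 ltW.
have ca := lipschitz_continuous aL.
have cb := lipschitz_continuous bL.
have clin (f : R -> R) (t s : R) : continuous f -> continuous (fun v => f (t + s * v)).
  move=> cf r; apply: (cvg_comp (fun v => t + s * v) f); last exact: cf.
  by apply: cvgD; [exact: cvg_cst|apply: cvgM; [exact: cvg_cst|exact: cvg_id]].
have clinN (f : R -> R) (t s : R) : continuous f -> continuous (fun v => f (t - s * v)).
  by move=> cf; under eq_fun do rewrite -mulNr; exact: clin.
have cQ : continuous (fun v : R => v / oneDsqr v ^+ 2).
  move=> s; apply: cvgM; first exact: cvg_id.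
  apply: cvgV; first by rewrite gt_eqF// exprn_gt0.
  by apply: (cvg_comp oneDsqr (fun y => y ^+ 2)); [exact: continuous_oneDsqr|exact: exprn_continuous].
have cvg_shift (f : R -> R) (t s : R) (e : nat -> R) (y : R) : continuous f -> e n @[n --> \oo] --> y ->
    f (t + e n * s) @[n --> \oo] --> f (t + y * s).
  move=> cf ey; apply: (cvg_comp (fun n => t + e n * s) f); last exact: cf.
  by apply: cvgD; [exact: cvg_cst|apply: cvgM; [exact: ey|exact: cvg_cst]].
have cvg_shiftN (f : R -> R) (t s : R) (e : nat -> R) (y : R) : continuous f -> e n @[n --> \oo] --> y ->
    f (t - e n * s) @[n --> \oo] --> f (t - y * s).
  move=> cf ey; apply: (cvg_comp (fun n => t - e n * s) f); last exact: cf.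
  by apply: cvgB; [exact: cvg_cst|apply: cvgM; [exact: ey|exact: cvg_cst]].
(* dominated convergence along [e n --> y], given the limit [q] of the difference quotients *)
have seqlim (t : R) (e : nat -> R) (y : R) (q : R -> R) : (forall n, 0 < e n) ->
    e n @[n --> \oo] --> y ->
    (forall s, 0 <= s -> (e n)^-1 * (b (t + e n * s) - b (t - e n * s)) @[n --> \oo] --> q s) ->
    u (e n) t @[n --> \oo] -->
      pi^-1 * \int[leb]_(v in `[(0 : R), +oo[) ((a (t + y * v) + a (t - y * v)) / oneDsqr v)
      - 2 / pi * \int[leb]_(v in `[(0 : R), +oo[) (q v * (v / oneDsqr v ^+ 2)).
  move=> e0 ey eq; rewrite (funext (fun n => uE (e n) t (e0 n))).
  apply: cvgB; apply: cvgM; try exact: cvg_cst.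
    have [|||||_ //] := @Rintegral_dominated_cvg _ _ R leb `[0, +oo[%classic
      (fun n v => (a (t + e n * v) + a (t - e n * v)) / oneDsqr v)
      (fun v => (a (t + y * v) + a (t - y * v)) / oneDsqr v) (fun v => 2 * M * (oneDsqr v)^-1).
    - exact: mD.
    - move=> n; apply: continuous_measurable_on => s; apply: cvgM; last exact: continuous_oneDsqrV.
      by apply: cvgD; [exact: clin|exact: clinN].
    - move=> s _; apply: cvgM; last exact: cvg_cst.
      by apply: cvgD; [exact: cvg_shift|exact: cvg_shiftN].
    - by apply: integrable_scale => //; exact: integrable_oneDsqrV.
    - move=> n s _; rewrite normrM [X in _ * X]ger0_norm//; apply: ler_wpM2r => //.
      by rewrite (le_trans (ler_normD _ _))// mulr_natl mulr2n lerD.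
  have [|||||_ //] := @Rintegral_dominated_cvg _ _ R leb `[0, +oo[%classic
      (fun n v => (e n)^-1 * (b (t + e n * v) - b (t - e n * v)) * (v / oneDsqr v ^+ 2))
      (fun v => q v * (v / oneDsqr v ^+ 2))
      (fun v => 4 * M * (oneDsqr v)^-1).
  - exact: mD.
  - move=> n; apply: continuous_measurable_on => s; apply: cvgM; last exact: cQ.
    apply: cvgM; first exact: cvg_cst.
    by apply: cvgB; [exact: clin|exact: clinN].
  - move=> s; rewrite /= in_itv /= andbT => s0.
    by apply: cvgM; [exact: eq|exact: cvg_cst].
  - by apply: integrable_scale => //; exact: integrable_oneDsqrV.
  - move=> n s; rewrite /= in_itv /= andbT => s0.
    have en := ltW (e0 n).
    (* The Lipschitz constant [2 * M] times the distance [2 * e n * s], divided by [e n], is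
       [4 * M * s]; the kernel absorbs the factor [s], as [s ^ 2 <= oneDsqr s]. *)
    rewrite normrM; apply: (@le_trans _ _ (4 * M * s * `|s / oneDsqr s ^+ 2|)).
      apply: ler_wpM2r => //; rewrite normrM normfV (ger0_norm en).
      rewrite mulrC ler_pdivrMr//; apply: le_trans (bL _ _) _.
      rewrite [X in `|X|](_ : _ = 2 * (e n * s)); last by ring.
      by rewrite ger0_norm ?mulr_ge0//; nra.
    rewrite -mulrA; apply: ler_wpM2l; first by rewrite mulr_ge0.
    rewrite normrM (ger0_norm s0) normfV normrX (gtr0_norm (od s)) mulrA.
    rewrite ler_pdivrMr ?exprn_gt0// expr2 mulrA mulVf ?gt_eqF// mul1r.
    by rewrite /oneDsqr expr2; nra.
split.
  move=> x t x0; apply/(@cvg_nbhsP R R^o (fun y => u y t) x (u x t)) => e ex.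
  have [N _ Ne] := cvgr_gt _ ex _ x0.
  rewrite -(cvg_shiftn N) (uE x t x0).
  apply: (@seqlim t (fun n => e (n + N)%N) x (fun s => x^-1 * (b (t + x * s) - b (t - x * s)))).
  - by move=> n; apply: Ne => /=; exact: leq_addl.
  - by rewrite (cvg_shiftn N).
  have eN : e (n + N)%N @[n --> \oo] --> x by rewrite (cvg_shiftn N).
  move=> s _; apply: cvgM; first by apply: cvgV; rewrite ?gt_eqF.
  by apply: cvgB; [exact: cvg_shift|exact: cvg_shiftN].
have := lipschitz_derivable_ae bL; apply: ae_imply => t dbt.
pose d := 'D_1 b t.
(* The limit is the instance [y = 0] of [seqlim], where the quotients tend to [2 d s]. It is left in
   the shape that [seqlim] produces. *)
apply/cvg_ex; exists (pi^-1 * \int[leb]_(v in `[(0 : R), +oo[) ((a (t + 0 * v) + a (t - 0 * v)) / oneDsqr v)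
      - 2 / pi * \int[leb]_(v in `[(0 : R), +oo[) (2 * d * v * (v / oneDsqr v ^+ 2))).
apply/cvg_at_rightP => e [e0 ec]; apply: seqlim => // s.
rewrite le_eqVlt => /predU1P[<-|s0].
  rewrite mulr0 (_ : (fun n => _) = fun=> 0); first exact: cvg_cst.
  by apply/funext => n; rewrite mulr0 addr0 subr0 subrr mulr0.
have db : h^-1 * (b (h + t) - b t) @[h --> 0^'] --> d.
  have := dbt; rewrite /derivable => /cvg_ex[l bl].
  have : l = d by apply/esym; apply: cvg_lim.
  move=> <-; apply: cvg_trans bl; apply: near_eq_cvg; apply: nearW => h.
  by rewrite /= /GRing.scale /= mulr1.
have dbs (r : nat -> R) : (forall n, r n != 0) -> r n @[n --> \oo] --> 0 ->
    (r n)^-1 * (b (r n + t) - b t) @[n --> \oo] --> d.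
  by move=> r0 rc; move/cvgr_dnbhsP: db; apply.
have es : e n * s @[n --> \oo] --> 0.
  by rewrite -(mul0r s); apply: cvgM; [exact: ec|exact: cvg_cst].
have es0 n : e n * s != 0 by rewrite mulf_neq0 ?gt_eqF.
(* The symmetric quotient is [s] times the sum of the difference quotients with increments [e n * s]
   and [- (e n * s)], each tending to [d]. *)
rewrite (_ : (fun n => _) = (fun n => s * ((e n * s)^-1 * (b (e n * s + t) - b t) +
    (- (e n * s))^-1 * (b (- (e n * s) + t) - b t)))); last first.
  apply/funext => n; rewrite [t + _]addrC [t - _]addrC.
  have e1 : e n != 0 by rewrite gt_eqF.
  have s1 : s != 0 by rewrite gt_eqF.
  rewrite invrN; move: (b _) (b _) (b _) => b1 b2 b3; field.
  by rewrite ?s1 ?e1.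
rewrite (_ : 2 * d * s = s * (d + d)); last by ring.
apply: cvgM; first exact: cvg_cst.
apply: cvgD; apply: dbs => //; first by move=> n; rewrite oppr_eq0.
by rewrite -oppr0; exact: cvgN.
Qed.

(** * Complex numbers and the torus *)

Lemma ReD (R : realType) (x y : Cplx R) : complex.Re (x + y) = complex.Re x + complex.Re y.
Proof. by case: x; case: y. Qed.

Lemma ImD (R : realType) (x y : Cplx R) : complex.Im (x + y) = complex.Im x + complex.Im y.
Proof. by case: x; case: y. Qed.

Lemma ReN (R : realType) (x : Cplx R) : complex.Re (- x) = - complex.Re x.
Proof. by case: x. Qed.

Lemma ImN (R : realType) (x : Cplx R) : complex.Im (- x) = - complex.Im x.
Proof. by case: x. Qed.

Lemma ReM (R : realType) (x y : Cplx R) : complex.Re (x * y) = complex.Re x * complex.Re y - complex.Im x * complex.Im y.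
Proof. by case: x; case: y. Qed.

Lemma ImM (R : realType) (x y : Cplx R) : complex.Im (x * y) = complex.Re x * complex.Im y + complex.Im x * complex.Re y.
Proof. by case: x => a b; case: y => c d. Qed.

Lemma ReJ (R : realType) (x : Cplx R) : complex.Re (x^*) = complex.Re x.
Proof. by case: x. Qed.

Lemma ImJ (R : realType) (x : Cplx R) : complex.Im (x^*) = - complex.Im x.
Proof. by case: x. Qed.

Lemma complex_eq (R : realType) (x y : Cplx R) : complex.Re x = complex.Re y -> complex.Im x = complex.Im y -> x = y.
Proof. by case: x => a b; case: y => c d /= -> ->. Qed.

Lemma Re_sum (R : realType) (I : Type) (s : seq I) (P : pred I) (f : I -> Cplx R) :
  complex.Re (\sum_(i <- s | P i) f i) = \sum_(i <- s | P i) complex.Re (f i).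
Proof.
elim: s => [|i s IH]; first by rewrite !big_nil.
by rewrite !big_cons; case: (P i) => //; rewrite ReD IH.
Qed.

Lemma Im_sum (R : realType) (I : Type) (s : seq I) (P : pred I) (f : I -> Cplx R) :
  complex.Im (\sum_(i <- s | P i) f i) = \sum_(i <- s | P i) complex.Im (f i).
Proof.
elim: s => [|i s IH]; first by rewrite !big_nil.
by rewrite !big_cons; case: (P i) => //; rewrite ImD IH.
Qed.

Lemma norm_Re_le (R : realType) (x : Cplx R) (M : R) : `|x| <= M%:C%C -> `|complex.Re x| <= M.
Proof.
move=> xM; have := le_trans (normc_ge_Re x) xM; by rewrite lecR.
Qed.

Lemma norm_Im_le (R : realType) (x : Cplx R) (M : R) : `|x| <= M%:C%C -> `|complex.Im x| <= M.
Proof.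
rewrite normc_def lecR => xM; apply: le_trans xM.
rewrite -sqrtr_sqr; apply: ler_wsqrtr; first by rewrite lerDr sqr_ge0.
Qed.

Lemma norm_le_parts (R : realType) (x : Cplx R) : `|x| <= (`|complex.Re x| + `|complex.Im x|)%:C%C.
Proof.
rewrite normc_def lecR -[leRHS]ger0_norm ?addr_ge0// -(sqrtr_sqr (_ + _)).
apply: ler_wsqrtr; rewrite sqrrD !real_normK ?num_real// addrAC lerDl.
by rewrite mulrn_wge0// mulr_ge0.
Qed.

Lemma cvg_complex (R : realType) (T : Type) (F : set_system T) (FF : Filter F) (f : T -> Cplx R) (a b : R) :
  complex.Re (f x) @[x --> F] --> a -> complex.Im (f x) @[x --> F] --> b ->
  f @ F --> (Complex a b : Cplx R).
Proof.
move=> fa fb; apply/cvgrPdist_lt => e e0.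
have [e1 e10 eE] : exists2 e1 : R, 0 < e1 & e = e1%:C%C :> Cplx R.
  case: e e0 => e1 e2; rewrite ltcE /= => /andP[/eqP -> e10].
  by exists e1.
have e2 : 0 < e1 / 2 by rewrite divr_gt0.
near=> x; rewrite eE; apply: le_lt_trans (norm_le_parts _) _.
rewrite ltcR ReD ImD ReN ImN /= [ltRHS]splitr; apply: ltrD.
  by near: x; move/cvgrPdist_lt: fa; apply.
by near: x; move/cvgrPdist_lt: fb; apply.
Unshelve. all: by end_near. Qed.



Lemma measurable_coord_Re (R : realType) j :
  measurable_fun setT (fun tau : torus R => complex.Re (sval (tau j))).
Proof.
move=> _ B mB; rewrite setTI; apply: sub_sigma_algebra.
by exists j, B; split => //; left.
Qed.

Lemma measurable_coord_Im (R : realType) j :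
  measurable_fun setT (fun tau : torus R => complex.Im (sval (tau j))).
Proof.
move=> _ B mB; rewrite setTI; apply: sub_sigma_algebra.
by exists j, B; split => //; right.
Qed.

Lemma measurable_to_torus (R : realType) d (T : measurableType d) (f : T -> torus R) :
  (forall j, measurable_fun setT (fun x => complex.Re (sval (f x j)))) ->
  (forall j, measurable_fun setT (fun x => complex.Im (sval (f x j)))) ->
  measurable_fun setT f.
Proof.
move=> fR fI; apply: (@measurability _ _ _ (torus R) setT f (@torus_generators R) erefl).
move=> _ [A [j [B [mB AE]]] <-].
case: AE => ->; [have := fR j measurableT _ mB|have := fI j measurableT _ mB]; by rewrite !setTI.
Qed.

Lemma measurable_torus_mul (R : realType) (a : torus R) : measurable_fun setT (torus_mul a).
Proof.
apply: measurable_to_torus => j; rewrite /torus_mul /circle_mul /=.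
  under eq_fun do rewrite ReM; apply: measurable_funB; apply: measurable_funM => //.
    exact: measurable_coord_Re.
  exact: measurable_coord_Im.
under eq_fun do rewrite ImM; apply: measurable_funD; apply: measurable_funM => //.
  exact: measurable_coord_Im.
exact: measurable_coord_Re.
Qed.

(** Joint measurability in time and point, for the use of Fubini on the product of the line and the
    torus. *)
Lemma measurable_kronecker_flow (R : realType) :
  measurable_fun setT (fun z : measurableTypeR R * torus R => kronecker_flow z.1 z.2).
Proof.
have mcos j : measurable_fun setT (fun z : measurableTypeR R * torus R => complex.Re (prime_twist z.1 j)).
  apply: (measurableT_comp (f := fun t : measurableTypeR R => complex.Re (prime_twist t j))) measurable_fst.
  apply: continuous_measurable_on => t; apply: (cvg_comp (fun t : R => t * ln (nth_prime j)%:R) cos).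
    by apply: cvgM; [exact: cvg_id|exact: cvg_cst].
  exact: continuous_cos.
have msin j : measurable_fun setT (fun z : measurableTypeR R * torus R => complex.Im (prime_twist z.1 j)).
  apply: (measurableT_comp (f := fun t : measurableTypeR R => complex.Im (prime_twist t j))) measurable_fst.
  apply: continuous_measurable_on => t; apply: cvgN.
  apply: (cvg_comp (fun t : R => t * ln (nth_prime j)%:R) sin).
    by apply: cvgM; [exact: cvg_id|exact: cvg_cst].
  exact: continuous_sin.
have mRe j : measurable_fun setT (fun z : measurableTypeR R * torus R => complex.Re (sval (z.2 j))).
  exact: (measurableT_comp (measurable_coord_Re j) measurable_snd).
have mIm j : measurable_fun setT (fun z : measurableTypeR R * torus R => complex.Im (sval (z.2 j))).
  exact: (measurableT_comp (measurable_coord_Im j) measurable_snd).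
apply: measurable_to_torus => j.
  rewrite (_ : (fun z => _) = (fun z : measurableTypeR R * torus R =>
      complex.Re (prime_twist z.1 j) * complex.Re (sval (z.2 j)) -
      complex.Im (prime_twist z.1 j) * complex.Im (sval (z.2 j)))).
    by apply: measurable_funB; apply: measurable_funM.
  by apply/funext => z; exact: ReM.
rewrite (_ : (fun z => _) = (fun z : measurableTypeR R * torus R =>
      complex.Re (prime_twist z.1 j) * complex.Im (sval (z.2 j)) +
      complex.Im (prime_twist z.1 j) * complex.Re (sval (z.2 j)))).
  by apply: measurable_funD; apply: measurable_funM.
by apply/funext => z; exact: ImM.
Qed.

(** * Boxes of multi-indices and Fejer's kernel *)

(** The common form of monomials, Fejer weights and the geometric majorants [r ^ |a|]; sums of such
    functions over boxes factor. *)
Definition mulfun (K : comNzRingType) (g : nat -> int -> K) (a : multi_index) : K :=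
  \prod_(j <- finsupp a) g j (a j).

Lemma mulfun_with (K : comNzRingType) (g : nat -> int -> K) (a : multi_index) n (k : int) :
  a n = 0 -> k != 0 -> mulfun g [fsfun a with n |-> k] = mulfun g a * g n k.
Proof.
move=> an k0; rewrite /mulfun finsupp_with (negbTE k0) big_fsetU1 ?mem_finsupp ?an ?eqxx//=.
rewrite fsfun_with mulrC; congr (_ * _); apply: eq_big_seq => j.
rewrite mem_finsupp fsfun_withE => aj; case: eqP => // jn.
by rewrite jn an eqxx in aj.
Qed.

Lemma mulfun_sub (K : comNzRingType) (g : nat -> int -> K) (a : multi_index) (D : {fset nat}) :
  (forall j, g j 0 = 1) -> (finsupp a `<=` D)%fset -> mulfun g a = \prod_(j <- D) g j (a j).
Proof.
move=> g0 aD; rewrite /mulfun; apply: big_fset_incl => // j jD.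
by rewrite mem_finsupp negbK => /eqP ->.
Qed.

Lemma mulfunM (K : comNzRingType) (g h : nat -> int -> K) (a : multi_index) :
  mulfun g a * mulfun h a = mulfun (fun j k => g j k * h j k) a.
Proof. by rewrite /mulfun -big_split. Qed.

Definition nonzero_ints (N : nat) : seq int :=
  [seq (k.+1%:Z) | k <- iota 0 N] ++ [seq - (k.+1%:Z) | k <- iota 0 N].

Lemma mem_nonzero_ints N k : (k \in nonzero_ints N) = (k != 0) && (`|k| <= N)%N.
Proof.
rewrite /nonzero_ints mem_cat; apply/idP/idP.
  case/orP; case/mapP => i; rewrite mem_iota => /andP[_ iN] ->.
    by rewrite absz_nat.
  by rewrite abszN absz_nat oppr_eq0.
case/andP; case: k => [[//|k]|k] _ /= kN.
  by apply/orP; left; apply/mapP; exists k; rewrite ?mem_iota.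
by apply/orP; right; apply/mapP; exists k; rewrite ?mem_iota// NegzE.
Qed.

Lemma uniq_nonzero_ints N : uniq (nonzero_ints N).
Proof.
rewrite cat_uniq; apply/and3P; split.
- by rewrite map_inj_uniq ?iota_uniq// => i j [].
- apply/hasPn => _ /mapP[i _ ->]; apply/negP => /mapP[j _].
  by rewrite -NegzE.
- by rewrite map_inj_uniq ?iota_uniq// => i j /oppr_inj[].
Qed.

(** The multi-indices supported on the first [n] variables with entries of modulus at most [N].
    Those involving the last variable are appended, so that a box in fewer variables is a prefix. *)
Fixpoint box (n N : nat) : seq multi_index :=
  if n is m.+1 then
    box m N ++ [seq [fsfun a with m |-> k] | a <- box m N, k <- nonzero_ints N]
  else [:: [fsfun]].

Lemma boxP n N (a : multi_index) :
  reflect ((forall j, (n <= j)%N -> a j = 0) /\ (forall j, (`|a j| <= N)%N)) (a \in box n N).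
Proof.
elim: n a => [|n IH] a.
  rewrite inE; apply: (iffP eqP) => [->|[a0 _]].
    by split => j; rewrite fsfunE.
  by apply/fsfunP => j; rewrite a0// fsfunE.
rewrite /= mem_cat; apply: (iffP orP) => [[/IH[a0 aN]|/allpairsP[[b k] [/= /IH[b0 bN]]]]|[a0 aN]].
- by split => // j nj; apply: a0; exact: ltnW.
- rewrite mem_nonzero_ints => /andP[k0 kN] ->; split => j; rewrite fsfun_withE.
    by case: eqP => [->|_ nj]; [rewrite ltnn|apply: b0; exact: ltnW].
  by case: eqP.
have [an|an] := eqVneq (a n) 0.
  left; apply/IH; split => // j; rewrite leq_eqVlt => /predU1P[<-//|]; exact: a0.
right; apply/allpairsP; exists ([fsfun a with n |-> 0], a n); split => /=.
- apply/IH; split => j; rewrite fsfun_withE; case: eqP => // /eqP jn.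
    by move=> nj; apply: a0; rewrite ltn_neqAle eq_sym jn.
- by rewrite mem_nonzero_ints an aN.
- by apply/fsfunP => j; rewrite !fsfun_withE; case: eqP => [->|].
Qed.

Lemma uniq_box n N : uniq (box n N).
Proof.
elim: n => //= n IH; rewrite cat_uniq IH /=; apply/andP; split.
  apply/hasPn => c /allpairsP[[a k] [/= /boxP[a0 _]]].
  rewrite mem_nonzero_ints => /andP[k0 _] ->; apply/negP => /boxP[/(_ n (leqnn n)) + _].
  by rewrite fsfun_with; exact/eqP.
apply: allpairs_uniq => //; first exact: uniq_nonzero_ints.
move=> [a k] [b l] /allpairsP[[a' k'] [/= /boxP[a0 _] _ [-> ->]]].
move=> /allpairsP[[b' l'] [/= /boxP[b0 _] _ [-> ->]]] /fsfunP ab.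
congr (_, _); last by have := ab n; rewrite !fsfun_with.
apply/fsfunP => j; have := ab j; rewrite !fsfun_withE; case: eqP => // -> _.
by rewrite a0// b0.
Qed.

Lemma sum_box (K : comNzRingType) (g : nat -> int -> K) n N :
  \sum_(a <- box n N) mulfun g a = \prod_(j < n) (1 + \sum_(k <- nonzero_ints N) g j k).
Proof.
elim: n => [|n IH]; first by rewrite big_seq1 big_ord0 /mulfun finsupp0 big_seq_fset0.
rewrite [LHS]big_cat big_ord_recr /= -IH mulrDr mulr1; apply: f_equal2 => //.
rewrite big_allpairs_dep mulr_suml; apply: eq_big_seq => a /boxP[a0 _].
rewrite mulr_sumr; apply: eq_big_seq => k; rewrite mem_nonzero_ints => /andP[k0 _].
by rewrite mulfun_with// a0.
Qed.

Lemma sum_nonzero_ints (K : comNzRingType) (f : int -> K) N :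
  \sum_(k <- nonzero_ints N) f k = \sum_(k < N) (f (k.+1%:Z) + f (- (k.+1%:Z))).
Proof.
rewrite /nonzero_ints big_cat !big_map -{1 2}[N]subn0 -/(index_iota 0 N) !big_mkord.
by rewrite big_split.
Qed.

(** The power [w ^+ k.+1] arises from the pairs of exponents in [0..N] with difference [k + 1], of
    which there are [N - k]; [v] is the inverse of [w]. *)
Lemma dirichlet_square (K : comNzRingType) (w v : K) (N : nat) : w * v = 1 ->
  (\sum_(i < N.+1) w ^+ i) * (\sum_(i < N.+1) v ^+ i) =
  N.+1%:R + \sum_(k < N) (N - k)%:R * (w ^+ k.+1 + v ^+ k.+1).
Proof.
move=> wv; have key (x y : K) n : x * y = 1 ->
    x ^+ n.+1 * (\sum_(i < n.+1) y ^+ i) = \sum_(k < n.+1) x ^+ k.+1.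
  move=> xy; rewrite mulr_sumr (reindex_inj rev_ord_inj) /=; apply: eq_bigr => k _.
  rewrite subSS [X in x ^+ X * _](_ : n.+1 = (k.+1 + (n - k))%N); last first.
    by rewrite addSn subnKC// -ltnS.
  by rewrite exprD -mulrA -exprMn xy expr1n mulr1.
elim: N => [|n IH]; first by rewrite !big_ord1 big_ord0 !expr0 mulr1 addr0.
rewrite big_ord_recr [X in _ * X]big_ord_recr /= mulrDl !mulrDr IH.
rewrite -exprMn wv expr1n key// [X in _ + X + _]mulrC key 1?mulrC//.
rewrite [in RHS]big_ord_recr /= subSnn.
rewrite [X in _ = _ + (X + _)](eq_bigr (fun k : 'I_n => (n - k)%:R * (w ^+ k.+1 + v ^+ k.+1) + (w ^+ k.+1 + v ^+ k.+1))); last first.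
  by move=> k _; rewrite subSn ?(ltnW (ltn_ord k))// -natr1 mulrDl mul1r.
rewrite big_split/= !big_split/= !big_ord_recr/= -[n.+2%:R]natr1; ring.
Qed.

(** There is no cut-off at zero: the weight is nonnegative for [|k| <= N], which is the range met in
    boxes. *)
Definition fejer (R : realType) (N : nat) (k : int) : R := 1 - `|k|%N%:R / N.+1%:R.

Lemma fejer_itv (R : realType) N k : (`|k| <= N)%N -> 0 <= fejer R N k <= 1.
Proof.
move=> kN; rewrite /fejer subr_ge0 ler_pdivrMr ?ltr0n// mul1r ler_nat (leq_trans kN)//=.
Qed.

Lemma cvg_fejer (R : realType) k : fejer R N k @[N --> \oo] --> (1 : R).
Proof.
rewrite -[X in _ --> X]subr0; apply: cvgB; first exact: cvg_cst.
by rewrite -(mulr0 `|k|%N%:R); apply: cvgM; [exact: cvg_cst|exact: cvg_harmonic].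
Qed.

Lemma norm1_inv (R : realType) (w : Cplx R) : `|w| = 1 -> w^-1 = w^*.
Proof. by move=> w1; rewrite invC_norm w1 expr1n invr1 mul1r. Qed.

(* Fejer's kernel is the square of a Dirichlet sum divided by [N.+1]. *)
Lemma fejer_kernel_ge0 (R : realType) (w : Cplx R) N : `|w| = 1 ->
  0 <= 1 + \sum_(k <- nonzero_ints N) (fejer R N k)%:C%C * w ^ k.
Proof.
move=> w1; have w0 : w != 0 by rewrite -normr_gt0 w1.
have wv : w * w^-1 = 1 by rewrite divff.
have N0 : (N.+1%:R : Cplx R) != 0 by rewrite pnatr_eq0.
have -> : 1 + \sum_(k <- nonzero_ints N) (fejer R N k)%:C%C * w ^ k =
    N.+1%:R^-1 * `|\sum_(i < N.+1) w ^+ i| ^+ 2.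
  apply: (mulfI N0); rewrite mulrA divff// mul1r normCK rmorph_sum/=.
  rewrite [X in _ = _ * X](eq_bigr (fun i : 'I_N.+1 => w^-1 ^+ i)); last first.
    by move=> i _; rewrite rmorphXn/= norm1_inv.
  rewrite (dirichlet_square N wv) mulrDr mulr1; congr (_ + _).
  rewrite sum_nonzero_ints mulr_sumr; apply: eq_bigr => k _.
  rewrite /fejer abszN absz_nat -mulrDr mulrA; congr (_ * (_ + _)); last by rewrite exprVn.
  rewrite rmorphB rmorph1 rmorphM fmorphV !rmorph_nat.
  rewrite mulrBr mulr1 mulrCA divff// mulr1 natrB ?(ltnW (ltn_ord k))//.
  by rewrite -!natr1 opprD addrACA subrr addr0.
by rewrite mulr_ge0// exprn_ge0.
Qed.

(** * Fourier coefficients and Fejer means *)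

(** The bound is on real and imaginary parts separately, matching [complex_integral], a pair of real
    integrals. *)
Definition bounded_measurable d (T : measurableType d) (R : realType) (f : T -> Cplx R) : Prop :=
  complex_measurable f /\
  exists M : R, forall x, `|complex.Re (f x)| <= M /\ `|complex.Im (f x)| <= M.

Lemma probability_integrable d (T : measurableType d) (R : realType)
    (m : probability T R) (g : T -> R) (M : R) :
  measurable_fun setT g -> (forall x, `|g x| <= M) -> m.-integrable setT (EFin \o g).
Proof.
move=> mg gM; apply: (integrable_dominated (g := fun=> M)) => //.
exact: finite_measure_integrable_cst.
Qed.

Lemma probability_Rintegral_le d (T : measurableType d) (R : realType)
    (m : probability T R) (g h : T -> R) (M : R) :
  measurable_fun setT g -> m.-integrable setT (EFin \o h) -> (forall x, `|g x| <= M * h x) ->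
  `|\int[m]_x g x| <= M * \int[m]_x h x.
Proof.
move=> mg ih gh; have iM := integrable_scale M measurableT ih.
have ig : m.-integrable setT (EFin \o g).
  by apply: (integrable_dominated measurableT mg _ iM) => x _; exact: gh.
apply: le_trans (le_normr_Rintegral measurableT ig) _.
rewrite -RintegralZl//; apply: le_Rintegral => //; exact: integrable_norm.
Qed.

Lemma bounded_measurable_Re d (T : measurableType d) (R : realType)
    (m : probability T R) (f : T -> Cplx R) :
  bounded_measurable f -> m.-integrable setT (EFin \o (fun x => complex.Re (f x))).
Proof. by case=> -[mR _] [M fM]; apply: (@probability_integrable _ _ _ _ _ M) => // x; case: (fM x). Qed.

Lemma bounded_measurable_Im d (T : measurableType d) (R : realType)
    (m : probability T R) (f : T -> Cplx R) :
  bounded_measurable f -> m.-integrable setT (EFin \o (fun x => complex.Im (f x))).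
Proof. by case=> -[_ mI] [M fM]; apply: (@probability_integrable _ _ _ _ _ M) => // x; case: (fM x). Qed.

Lemma bounded_measurable_cst d (T : measurableType d) (R : realType) (c : Cplx R) :
  bounded_measurable (fun _ : T => c).
Proof.
split; first by split; exact: measurable_cst.
by exists (Num.max `|complex.Re c| `|complex.Im c|) => _; rewrite !le_max !lexx orbT.
Qed.

Lemma bounded_measurable_add d (T : measurableType d) (R : realType) (f g : T -> Cplx R) :
  bounded_measurable f -> bounded_measurable g -> bounded_measurable (fun x => f x + g x).
Proof.
move=> [[fR fI] [M fM]] [[gR gI] [N gN]]; split.
  split; [rewrite (funext (fun x => ReD (f x) (g x)))|rewrite (funext (fun x => ImD (f x) (g x)))].
    exact: measurable_funD.
  exact: measurable_funD.
exists (M + N) => x; have [f1 f2] := fM x; have [g1 g2] := gN x.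
by rewrite ReD ImD; split; apply: le_trans (ler_normD _ _) _; exact: lerD.
Qed.

Lemma bounded_measurable_mul d (T : measurableType d) (R : realType) (f g : T -> Cplx R) :
  bounded_measurable f -> bounded_measurable g -> bounded_measurable (fun x => f x * g x).
Proof.
move=> [[fR fI] [M fM]] [[gR gI] [N gN]]; split.
  split; [rewrite (funext (fun x => ReM (f x) (g x)))|rewrite (funext (fun x => ImM (f x) (g x)))].
    by apply: measurable_funB; exact: measurable_funM.
  by apply: measurable_funD; exact: measurable_funM.
exists (M * N + M * N) => x; have [f1 f2] := fM x; have [g1 g2] := gN x.
rewrite ReM ImM; split.
  by apply: le_trans (ler_normB _ _) _; rewrite !normrM; apply: lerD; apply: ler_pM.
by apply: le_trans (ler_normD _ _) _; rewrite !normrM; apply: lerD; apply: ler_pM.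
Qed.

Lemma bounded_measurable_conj d (T : measurableType d) (R : realType) (f : T -> Cplx R) :
  bounded_measurable f -> bounded_measurable (fun x => (f x)^*).
Proof.
move=> [[fR fI] [M fM]]; split.
  split; first by rewrite (funext (fun x => ReJ (f x))).
  by rewrite (funext (fun x => ImJ (f x))); exact: measurable_funN.
by exists M => x; rewrite ReJ ImJ normrN.
Qed.

Lemma bounded_measurable_sum d (T : measurableType d) (R : realType) (I : eqType) (s : seq I)
    (f : I -> T -> Cplx R) :
  {in s, forall i, bounded_measurable (f i)} -> bounded_measurable (fun x => \sum_(i <- s) f i x).
Proof.
elim: s => [|i s IH] fs.
  rewrite (funext (fun x => big_nil _ _ _ _)); exact: bounded_measurable_cst.
rewrite (funext (fun x => big_cons _ _ _ _ _ _)) /=; apply: bounded_measurable_add.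
  by apply: fs; exact: mem_head.
by apply: IH => j js; apply: fs; exact: mem_behead.
Qed.

Lemma bounded_measurable_prod d (T : measurableType d) (R : realType) (I : eqType) (s : seq I)
    (f : I -> T -> Cplx R) :
  {in s, forall i, bounded_measurable (f i)} -> bounded_measurable (fun x => \prod_(i <- s) f i x).
Proof.
elim: s => [|i s IH] fs.
  rewrite (funext (fun x => big_nil _ _ _ _)); exact: bounded_measurable_cst.
rewrite (funext (fun x => big_cons _ _ _ _ _ _)) /=; apply: bounded_measurable_mul.
  by apply: fs; exact: mem_head.
by apply: IH => j js; apply: fs; exact: mem_behead.
Qed.

Lemma complex_integralD d (T : measurableType d) (R : realType) (m : probability T R)
    (f g : T -> Cplx R) : bounded_measurable f -> bounded_measurable g ->
  complex_integral m (fun x => f x + g x) = complex_integral m f + complex_integral m g.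
Proof.
move=> bf bg; apply: complex_eq.
  rewrite ReD /= (funext (fun x => ReD (f x) (g x))).
  by rewrite RintegralD//; exact: bounded_measurable_Re.
rewrite ImD /= (funext (fun x => ImD (f x) (g x))).
by rewrite RintegralD//; exact: bounded_measurable_Im.
Qed.

Lemma complex_integralZ d (T : measurableType d) (R : realType) (m : probability T R)
    (c : Cplx R) (f : T -> Cplx R) : bounded_measurable f ->
  complex_integral m (fun x => c * f x) = c * complex_integral m f.
Proof.
move=> bf; have bR := bounded_measurable_Re m bf; have bI := bounded_measurable_Im m bf.
apply: complex_eq.
  rewrite ReM /= (funext (fun x => ReM c (f x))).
  by rewrite RintegralB ?RintegralZl//; exact: integrable_scale.
rewrite ImM /= (funext (fun x => ImM c (f x))).
by rewrite RintegralD ?RintegralZl//; exact: integrable_scale.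
Qed.

Lemma complex_integral_sum d (T : measurableType d) (R : realType) (m : probability T R)
    (I : eqType) (s : seq I) (c : I -> Cplx R) (f : I -> T -> Cplx R) :
  (forall i, bounded_measurable (f i)) ->
  complex_integral m (fun x => \sum_(i <- s) c i * f i x) =
  \sum_(i <- s) c i * complex_integral m (f i).
Proof.
move=> bf; elim: s => [|i s IH].
  rewrite big_nil (funext (fun x => big_nil _ _ _ _)) /complex_integral /=.
  by rewrite Rintegral_cst// mul0r.
rewrite big_cons (funext (fun x => big_cons _ _ _ _ _ _)) /= -IH -complex_integralZ//.
rewrite complex_integralD//.
  by apply: bounded_measurable_mul => //; exact: bounded_measurable_cst.
apply: bounded_measurable_sum => j _.
by apply: bounded_measurable_mul => //; exact: bounded_measurable_cst.
Qed.

Lemma complex_integral_dominated d (T : measurableType d) (R : realType) (m : probability T R)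
    (f_ : nat -> T -> Cplx R) (f : T -> Cplx R) (M : R) :
  (forall n, complex_measurable (f_ n)) ->
  (forall n x, `|complex.Re (f_ n x)| <= M /\ `|complex.Im (f_ n x)| <= M) ->
  (forall x, complex.Re (f_ n x) @[n --> \oo] --> complex.Re (f x)) ->
  (forall x, complex.Im (f_ n x) @[n --> \oo] --> complex.Im (f x)) ->
  complex.Re (complex_integral m (f_ n)) @[n --> \oo] --> complex.Re (complex_integral m f) /\
  complex.Im (complex_integral m (f_ n)) @[n --> \oo] --> complex.Im (complex_integral m f).
Proof.
move=> mf fM cR cI; have iM := finite_measure_integrable_cst m M measurableT.
split.
  have [|||||_ //] := @Rintegral_dominated_cvg _ _ R m setT (fun n x => complex.Re (f_ n x))
    (fun x => complex.Re (f x)) (fun=> M) => //.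
  - by move=> n; case: (mf n).
  - by move=> n x _; case: (fM n x).
have [|||||_ //] := @Rintegral_dominated_cvg _ _ R m setT (fun n x => complex.Im (f_ n x))
    (fun x => complex.Im (f x)) (fun=> M) => //.
- by move=> n; case: (mf n).
- by move=> n x _; case: (fM n x).
Qed.

Lemma complex_integral_ae d (T : measurableType d) (R : realType) (m : probability T R)
    (f g : T -> Cplx R) : complex_measurable f -> complex_measurable g ->
  (\forall x \ae m, f x = g x) -> complex_integral m f = complex_integral m g.
Proof.
move=> [fR fI] [gR gI] fg; rewrite /complex_integral /Rintegral; congr (Complex (fine _) (fine _)).
  apply: ae_eq_integral => //; try exact/measurable_EFinP.
  by apply: ae_imply fg => x -> _.
apply: ae_eq_integral => //; try exact/measurable_EFinP.
by apply: ae_imply fg => x -> _.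
Qed.

Definition cis (R : realType) (x : R) : Cplx R := Complex (cos x) (sin x).

Lemma cisD (R : realType) (x y : R) : cis (x + y) = cis x * cis y.
Proof. by apply: complex_eq; rewrite ?ReM ?ImM /= ?cosD ?sinD// addrC. Qed.

Lemma cis0 (R : realType) : cis (0 : R) = 1.
Proof. by rewrite /cis cos0 sin0. Qed.

Lemma norm_cis (R : realType) (x : R) : `|cis x| = 1.
Proof. by rewrite normc_def /= cos2Dsin2 sqrtr1. Qed.

Lemma cisN (R : realType) (x : R) : cis (- x) = (cis x)^-1.
Proof.
have c0 : cis x != 0 by rewrite -normr_gt0 norm_cis.
by apply: (mulfI c0); rewrite -cisD subrr cis0 divff.
Qed.

Lemma cisX (R : realType) (x : R) n : cis x ^+ n = cis (n%:R * x).
Proof.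
elim: n => [|n IH]; first by rewrite expr0 mul0r cis0.
by rewrite exprS IH -cisD -natr1 mulrDl mul1r addrC.
Qed.

Lemma cisXz (R : realType) (x : R) (k : int) : cis x ^ k = cis (k%:~R * x).
Proof.
case: k => n; first by rewrite -exprnP cisX pmulrn.
by rewrite NegzE -exprnN cisX -cisN mulrNz mulNr -pmulrn.
Qed.

Lemma norm_exprz1 (R : realType) (w : Cplx R) (k : int) : `|w| = 1 -> `|w ^ k| = 1.
Proof.
move=> w1; case: k => n; first by rewrite -exprnP normrX w1 expr1n.
by rewrite NegzE -exprnN normfV normrX w1 expr1n invr1.
Qed.

Lemma bounded_measurable_coord (R : realType) j (k : int) :
  bounded_measurable (fun tau : torus R => sval (tau j) ^ k).
Proof.
have b1 : bounded_measurable (fun tau : torus R => sval (tau j)).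
  split; first by split; [exact: measurable_coord_Re|exact: measurable_coord_Im].
  exists 1 => tau; have t1 := eqP (svalP (tau j)).
  by split; [apply: norm_Re_le|apply: norm_Im_le]; rewrite t1.
have bX n : bounded_measurable (fun tau : torus R => sval (tau j) ^+ n).
  elim: n => [|n IH]; first exact: bounded_measurable_cst.
  by under eq_fun do rewrite exprS; exact: bounded_measurable_mul.
case: k => n; first exact: bX.
rewrite (_ : (fun tau : torus R => _) = (fun tau : torus R => (sval (tau j) ^+ n.+1)^*)).
  by apply: bounded_measurable_conj.
apply/funext => tau; rewrite NegzE -exprnN; apply: norm1_inv.
by rewrite normrX (eqP (svalP (tau j))) expr1n.
Qed.

Lemma bounded_measurable_monomial (R : realType) (a : multi_index) :
  bounded_measurable (fun tau : torus R => monomial (coords tau) a).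
Proof. by apply: bounded_measurable_prod => j _; exact: bounded_measurable_coord. Qed.

Lemma norm_monomial (R : realType) (tau : torus R) (a : multi_index) :
  `|monomial (coords tau) a| = 1.
Proof.
rewrite /monomial normr_prod big1// => j _; apply: norm_exprz1.
exact: (eqP (svalP (tau j))).
Qed.

Lemma monomialM (R : realType) (z w : nat -> Cplx R) (a : multi_index) :
  monomial (fun j => z j * w j) a = monomial z a * monomial w a.
Proof. by rewrite /monomial -big_split; apply: eq_bigr => j _; rewrite expfzMl. Qed.

Lemma Rintegral_haar (R : realType) (m : probability (torus R) R) (a : torus R)
    (f : torus R -> R) : is_haar m ->
  measurable_fun setT f -> m.-integrable setT (EFin \o (f \o torus_mul a)) ->
  \int[m]_x f (torus_mul a x) = \int[m]_x f x.
Proof.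
move=> mh mf fi; rewrite /Rintegral; congr fine.
have := @integral_pushforward _ _ _ _ R (torus_mul a) (@measurable_torus_mul R a) m setT
  (EFin \o f) _ _ measurableT.
rewrite preimage_setT => <- //; last exact/measurable_EFinP.
apply: eq_measure_integral; first exact: measurable_torus_mul.
by move=> ? A mA _; exact: mh.
Qed.

Lemma bounded_measurable_comp d (T : measurableType d) d' (T' : measurableType d') (R : realType)
    (f : T' -> Cplx R) (h : T -> T') :
  measurable_fun setT h -> bounded_measurable f -> bounded_measurable (f \o h).
Proof.
move=> mh [[fR fI] [M fM]]; split; last by exists M => x; exact: fM.
by split; [exact: (measurableT_comp fR mh)|exact: (measurableT_comp fI mh)].
Qed.

Lemma complex_integral_haar (R : realType) (m : probability (torus R) R) (a : torus R)
    (f : torus R -> Cplx R) : is_haar m -> bounded_measurable f ->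
  complex_integral m (fun x => f (torus_mul a x)) = complex_integral m f.
Proof.
move=> mh bf; have bfa := bounded_measurable_comp (@measurable_torus_mul R a) bf.
rewrite /complex_integral; congr Complex.
  apply: Rintegral_haar => //; first by case: bf => -[].
  exact: (bounded_measurable_Re m bfa).
apply: Rintegral_haar => //; first by case: bf => -[].
exact: (bounded_measurable_Im m bfa).
Qed.

(** Some rotation of the torus changes the sign of the integrand when [b] and [a] differ, and Haar
    measure does not see the rotation. *)
Lemma integral_monomial_orthonormal (R : realType) (m : probability (torus R) R) (a b : multi_index) :
  is_haar m -> complex_integral m (fun s => monomial (coords s) b * (monomial (coords s) a)^*) =
  (b == a)%:R.
Proof.
move=> mh; have [->|ba] := eqVneq b a.
  rewrite (_ : (fun _ => _) = (fun=> 1)); last first.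
    by apply/funext => s; rewrite -normCK norm_monomial expr1n.
  rewrite /complex_integral /= !Rintegral_cst// mul0r mul1r.
  by apply: complex_eq => //=; exact: (congr1 fine (probability_setT m)).
have [i ai] : exists i, b i != a i.
  apply: contrapT => h; move/negP: ba; apply; apply/eqP/fsfunP => j.
  by apply: contrapT => abj; apply: h; exists j; exact/eqP.
(* Rotating the coordinate [i] by this angle multiplies the integrand by [exp (i pi) = -1]. *)
pose x : R := pi / (b i - a i)%:~R.
pose w j : Cplx R := if j == i then cis x else 1.
have w1 j : `|w j| == 1 by rewrite /w; case: ifP => _; rewrite ?norm_cis ?normr1.
pose al : torus R := fun j => exist _ (w j) (w1 j).
have wE c : monomial w c = cis ((c i)%:~R * x).
  rewrite /monomial; have [ci|] := boolP (i \in finsupp c).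
    rewrite (big_fsetD1 i)//= /w eqxx cisXz big1_fset ?mulr1// => j.
    by rewrite !inE => /andP[/negbTE -> _] _; rewrite exp1rz.
  rewrite mem_finsupp negbK => /eqP ci; rewrite ci mul0r cis0 big1_fset// => j jc _.
  by rewrite /w; case: eqP => [ji|_]; [rewrite ji ci expr0z|rewrite exp1rz].
have alE : monomial w b * (monomial w a)^* = -1.
  rewrite !wE -norm1_inv ?norm_cis// -cisN -cisD -mulNr -mulrDl -intrN -intrD.
  rewrite /x mulrC divfK ?intr_eq0 ?subr_eq0// /cis cospi sinpi.
  by apply: complex_eq => //=; rewrite oppr0.
have bm : bounded_measurable (fun s : torus R => monomial (coords s) b * (monomial (coords s) a)^*).
  apply: bounded_measurable_mul; first exact: bounded_measurable_monomial.
  by apply: bounded_measurable_conj; exact: bounded_measurable_monomial.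
have := complex_integral_haar al mh bm.
rewrite (_ : (fun s => _) =
  (fun s : torus R => -1 * (monomial (coords s) b * (monomial (coords s) a)^*))); last first.
  apply/funext => s; rewrite -alE (_ : coords (torus_mul al s) = fun j => w j * coords s j)//.
  by rewrite !monomialM rmorphM /=; ring.
rewrite complex_integralZ// mulN1r.
by move=> /eqP; rewrite eq_sym -addr_eq0 -mulr2n mulrn_eq0 => /orP[//|/eqP //].
Qed.

Lemma norm_coords (R : realType) (tau : torus R) j : `|coords tau j| = 1.
Proof. exact: (eqP (svalP (tau j))). Qed.

Definition fejer_weight (R : realType) N (a : multi_index) : Cplx R :=
  mulfun (fun _ k => (fejer R N k)%:C%C) a.

Definition fejer_sum (R : realType) (m : probability (torus R) R) (F : torus R -> Cplx R)
    n N (z : nat -> Cplx R) : Cplx R :=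
  \sum_(a <- box n N) fejer_weight R N a * fourier m F a * monomial z a.

Lemma monomial_conj (R : realType) (z : nat -> Cplx R) (a : multi_index) :
  monomial (fun j => (z j)^*) a = (monomial z a)^*.
Proof. by rewrite /monomial rmorph_prod; apply: eq_bigr => j _; rewrite /= fmorphXz. Qed.

(** By [sum_box] this is the product over the first [n] coordinates of one-variable Fejer kernels at
    [tau_j] times the conjugate of [sigma_j], which explains its positivity. *)
Definition torus_kernel (R : realType) n N (tau sigma : torus R) : Cplx R :=
  \sum_(a <- box n N) fejer_weight R N a * monomial (fun j => coords tau j * (coords sigma j)^*) a.

Lemma torus_kernel_ge0 (R : realType) n N (tau sigma : torus R) : 0 <= torus_kernel n N tau sigma.
Proof.
rewrite /torus_kernel.
rewrite (eq_bigr (fun a => mulfun (fun j k => (fejer R N k)%:C%C *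
  (coords tau j * (coords sigma j)^*) ^ k) a)); last first.
  by move=> a _; rewrite -mulfunM.
rewrite sum_box; apply: prodr_ge0 => j _; apply: fejer_kernel_ge0.
by rewrite normrM norm_conjC !norm_coords mulr1.
Qed.

Lemma torus_kernelE (R : realType) n N (tau sigma : torus R) :
  torus_kernel n N tau sigma = \sum_(a <- box n N)
    (fejer_weight R N a * monomial (coords tau) a) * (monomial (coords sigma) a)^*.
Proof. by apply: eq_bigr => a _; rewrite monomialM monomial_conj mulrA. Qed.

Lemma bounded_measurable_kernel (R : realType) n N (tau : torus R) :
  bounded_measurable (torus_kernel n N tau).
Proof.
rewrite (funext (torus_kernelE n N tau)); apply: bounded_measurable_sum => a _.
apply: bounded_measurable_mul; first exact: bounded_measurable_cst.
by apply: bounded_measurable_conj; exact: bounded_measurable_monomial.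
Qed.

Lemma monomial0 (R : realType) (z : nat -> Cplx R) : monomial z [fsfun] = 1.
Proof. by rewrite /monomial finsupp0 big_seq_fset0. Qed.

Lemma fejer_weight0 (R : realType) N : fejer_weight R N [fsfun] = 1.
Proof. by rewrite /fejer_weight /mulfun finsupp0 big_seq_fset0. Qed.

Lemma integral_torus_kernel (R : realType) (m : probability (torus R) R) n N (tau : torus R) :
  is_haar m -> complex_integral m (torus_kernel n N tau) = 1.
Proof.
move=> mh; rewrite (funext (torus_kernelE n N tau)) complex_integral_sum; last first.
  by move=> a; apply: bounded_measurable_conj; exact: bounded_measurable_monomial.
have z0 : ([fsfun] : multi_index) \in box n N by apply/boxP; split => j; rewrite fsfunE.
have E a : complex_integral m (fun s => (monomial (coords s) a)^*) = ([fsfun] == a)%:R.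
  rewrite -(integral_monomial_orthonormal a [fsfun] mh); congr complex_integral.
  by apply/funext => s; rewrite monomial0 mul1r.
rewrite (bigD1_seq _ z0 (uniq_box n N)) /= fejer_weight0 monomial0 E eqxx !mulr1.
by rewrite big1 ?addr0// => a a0; rewrite E eq_sym (negbTE a0) mulr0.
Qed.

Lemma fejer_sumE (R : realType) (m : probability (torus R) R) (F : torus R -> Cplx R)
    n N (tau : torus R) : bounded_measurable F ->
  fejer_sum m F n N (coords tau) = complex_integral m (fun s => F s * torus_kernel n N tau s).
Proof.
move=> bF; rewrite (_ : (fun s => _) = (fun s => \sum_(a <- box n N)
    (fejer_weight R N a * monomial (coords tau) a) * (F s * (monomial (coords s) a)^*))).
  rewrite complex_integral_sum; last first.
    move=> a; apply: bounded_measurable_mul => //.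
    by apply: bounded_measurable_conj; exact: bounded_measurable_monomial.
  by apply: eq_bigr => a _; rewrite mulrAC.
apply/funext => s; rewrite torus_kernelE mulr_sumr; apply: eq_bigr => a _.
by rewrite mulrCA.
Qed.

(** The mean is an average of [F] against a kernel that is real, nonnegative and of mass one; real
    and imaginary parts are averaged separately, and [M] serves for all [n] and [N]. *)
Lemma fejer_sum_le (R : realType) (m : probability (torus R) R) (F : torus R -> Cplx R)
    (M : R) n N (tau : torus R) : is_haar m -> complex_measurable F ->
  (forall s, `|complex.Re (F s)| <= M /\ `|complex.Im (F s)| <= M) ->
  `|complex.Re (fejer_sum m F n N (coords tau))| <= M /\
  `|complex.Im (fejer_sum m F n N (coords tau))| <= M.
Proof.
move=> mh mF FM; have bF : bounded_measurable F by split => //; exists M.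
have bK := bounded_measurable_kernel n N tau.
(* In the order on [Cplx], a nonnegative number has zero imaginary part. *)
have [K0 K1] : (forall s, complex.Im (torus_kernel n N tau s) = 0) /\
    (forall s, 0 <= complex.Re (torus_kernel n N tau s)).
  by split => s; have := torus_kernel_ge0 n N tau s; rewrite lecE /= => /andP[/eqP].
have iK := bounded_measurable_Re m bK.
have IK : \int[m]_s complex.Re (torus_kernel n N tau s) = 1.
  by have /(congr1 (@complex.Re R)) := integral_torus_kernel n N tau mh.
have [[mR mI] _] := bF; have [[mK _] _] := bK.
rewrite fejer_sumE//=; split.
  rewrite (_ : (fun s => complex.Re _) =
    (fun s => complex.Re (F s) * complex.Re (torus_kernel n N tau s))); last first.
    by apply/funext => s; rewrite ReM K0 mulr0 subr0.
  rewrite -[M]mulr1 -IK; apply: probability_Rintegral_le => //; first exact: measurable_funM.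
  by move=> s; rewrite normrM [X in _ * X]ger0_norm// ler_wpM2r//; case: (FM s).
rewrite (_ : (fun s => complex.Im _) =
  (fun s => complex.Im (F s) * complex.Re (torus_kernel n N tau s))); last first.
  by apply/funext => s; rewrite ImM K0 mulr0 add0r.
rewrite -[M]mulr1 -IK; apply: probability_Rintegral_le => //; first exact: measurable_funM.
by move=> s; rewrite normrM [X in _ * X]ger0_norm// ler_wpM2r//; case: (FM s).
Qed.

(** * Frequencies of monomials along the flow *)

Lemma nth_prime_lt j : (nth_prime j < nth_prime j.+1)%N.
Proof. by rewrite /=; case: ex_minnP => p /andP[]. Qed.

Lemma nth_prime_homo i j : (i <= j)%N -> (nth_prime i <= nth_prime j)%N.
Proof.
by apply: (homo_leq leqnn (@leq_trans)) => k; exact/ltnW/nth_prime_lt.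
Qed.

Lemma nth_prime_ge j : (j.+2 <= nth_prime j)%N.
Proof. by elim: j => // j IH; apply: leq_ltn_trans IH (nth_prime_lt j). Qed.

Lemma nth_prime_gt0 (R : realType) j : 0 < (nth_prime j)%:R :> R.
Proof. by rewrite ltr0n (leq_trans _ (nth_prime_ge j)). Qed.

Lemma ln_nth_prime_homo (R : realType) i j : (i <= j)%N ->
  ln (nth_prime i)%:R <= ln (nth_prime j)%:R :> R.
Proof.
by move=> ij; rewrite ler_ln ?posrE ?nth_prime_gt0// ler_nat; exact: nth_prime_homo.
Qed.

Lemma ln_nth_prime_ge0 (R : realType) j : 0 <= ln (nth_prime j)%:R :> R.
Proof. by apply: ln_ge0; rewrite (ler_nat R 1) (leq_trans _ (nth_prime_ge j)). Qed.

Definition nonneg (a : multi_index) : bool := all (fun j => 0 <= a j) (finsupp a).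

Lemma nonnegP (a : multi_index) : reflect (forall j, 0 <= a j) (nonneg a).
Proof.
apply: (iffP allP) => [h j|h j _ //].
by have [/h//|] := boolP (j \in finsupp a); rewrite mem_finsupp negbK => /eqP ->.
Qed.

(** The logarithm of the product of the [p_j ^ a_j]; along [theta + i t] the monomial [a] behaves as
    [exp (- freq (theta + i t))]. *)
Definition freq (R : realType) (a : multi_index) : R :=
  \sum_(j <- finsupp a) (a j)%:~R * ln (nth_prime j)%:R.

Lemma freq_ge0 (R : realType) (a : multi_index) : nonneg a -> 0 <= freq R a.
Proof.
move=> /nonnegP a0; apply: sumr_ge0 => j _; apply: mulr_ge0; last exact: ln_nth_prime_ge0.
by rewrite ler0z.
Qed.

Lemma freq_ge (R : realType) (a : multi_index) n j : nonneg a -> (n <= j)%N -> a j != 0 ->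
  ln (nth_prime n)%:R <= freq R a.
Proof.
move=> na nj aj; have /nonnegP a0 := na.
rewrite /freq (big_fsetD1 j) ?mem_finsupp//=.
apply: (le_trans (ln_nth_prime_homo R nj)); rewrite -[leLHS]addr0; apply: lerD.
  rewrite -[leLHS]mul1r; apply: ler_wpM2r; first exact: ln_nth_prime_ge0.
  by rewrite (ler_int R 1) -gtz0_ge1 lt0r aj a0.
apply: sumr_ge0 => k _; apply: mulr_ge0; last exact: ln_nth_prime_ge0.
by rewrite ler0z.
Qed.

Lemma monomial_cst (R : realType) (g : nat -> R) (a : multi_index) :
  monomial (fun j => (g j)%:C%C : Cplx R) a = (\prod_(j <- finsupp a) g j ^ a j)%:C%C.
Proof.
by rewrite /monomial rmorph_prod; apply: eq_bigr => j _; rewrite /= fmorphXz.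
Qed.

Lemma expR_sum (R : realType) (I : Type) (s : seq I) (f : I -> R) :
  expR (\sum_(i <- s) f i) = \prod_(i <- s) expR (f i).
Proof. exact: (big_morph _ (@expRD R) (@expR0 R)). Qed.

Lemma expRM_int (R : realType) (k : int) (x : R) : expR (k%:~R * x) = expR x ^ k.
Proof.
case: k => n; first by rewrite -pmulrn expRM_natl.
by rewrite NegzE -exprnN mulrNz mulNr expRN -pmulrn expRM_natl.
Qed.

Lemma monomial_b_theta (R : realType) (x : R) (tau : torus R) (a : multi_index) :
  monomial (b_theta x tau) a = (expR (- (freq R a * x)))%:C%C * monomial (coords tau) a.
Proof.
rewrite /b_theta monomialM monomial_cst; congr (_%:C%C * _).
rewrite /freq mulr_suml -sumrN expR_sum; apply: eq_bigr => j _.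
rewrite /powR gt_eqF ?nth_prime_gt0// -expRM_int; congr expR; ring.
Qed.

Lemma cis_sum (R : realType) (I : Type) (s : seq I) (f : I -> R) :
  cis (\sum_(i <- s) f i) = \prod_(i <- s) cis (f i).
Proof. exact: (big_morph _ (@cisD R) (@cis0 R)). Qed.

Lemma monomial_flow (R : realType) (t : R) (tau : torus R) (a : multi_index) :
  monomial (coords (kronecker_flow t tau)) a = cis (- (freq R a * t)) * monomial (coords tau) a.
Proof.
rewrite /coords /kronecker_flow /torus_mul /circle_mul /= monomialM; congr (_ * _).
rewrite /freq mulr_suml -sumrN cis_sum; apply: eq_bigr => j _.
rewrite (_ : prime_twist t j = cis (- (t * ln (nth_prime j)%:R))).
  by rewrite cisXz; congr cis; ring.
by rewrite /prime_twist /cis cosN sinN.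
Qed.

Lemma b_theta0 (R : realType) (tau : torus R) : b_theta 0 tau = coords tau.
Proof. by apply/funext => j; rewrite /b_theta oppr0 powRr0 mul1r. Qed.

Lemma kronecker_flow0 (R : realType) (tau : torus R) : kronecker_flow 0 tau = tau.
Proof.
apply/funext => j; apply/val_inj => /=.
by rewrite /prime_twist mul0r cos0 sin0 oppr0 mul1r.
Qed.

Definition poly_sum (R : realType) (w : multi_index -> Cplx R) (s : seq multi_index)
  (z : nat -> Cplx R) : Cplx R := \sum_(a <- s) w a * monomial z a.

(** Multi-indices with a negative entry are filtered out to make all frequencies nonnegative; for
    analytic [w] their coefficients vanish. The base point is absorbed in the coefficients. *)
Definition terms (R : realType) (w : multi_index -> Cplx R) (tau : torus R)
    (s : seq multi_index) : seq (R * R * R) :=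
  [seq (complex.Re (w a * monomial (coords tau) a), complex.Im (w a * monomial (coords tau) a),
        freq R a) | a <- s & nonneg a].

Definition analytic (R : realType) (w : multi_index -> Cplx R) :=
  forall a, ~~ nonneg a -> w a = 0.

Lemma expsum_terms (R : realType) (w : multi_index -> Cplx R) (tau : torus R) s (x t : R) :
  analytic w ->
  expsum (terms w tau s) x t = complex.Re (poly_sum w s (b_theta x (kronecker_flow t tau))) /\
  expsum (rot (terms w tau s)) x t = complex.Im (poly_sum w s (b_theta x (kronecker_flow t tau))).
Proof.
move=> w0; rewrite /poly_sum (bigID nonneg) /= [X in _ + X]big1 ?addr0; last first.
  by move=> a /w0 ->; rewrite mul0r.
rewrite Re_sum Im_sum /expsum /rot /terms !big_map !big_filter /=.
have E a : w a * monomial (b_theta x (kronecker_flow t tau)) a =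
    (expR (- (freq R a * x)))%:C%C * (cis (- (freq R a * t)) * (w a * monomial (coords tau) a)).
  by rewrite monomial_b_theta monomial_flow; ring.
split; apply: eq_bigr => a _; rewrite E; move: (w a * _) => c.
  by rewrite !ReM ImM /= cosN sinN; ring.
by rewrite !ImM ReM /= cosN sinN; ring.
Qed.

Lemma poly_sum_cat (R : realType) (w : multi_index -> Cplx R) s1 s2 z :
  poly_sum w (s1 ++ s2) z = poly_sum w s1 z + poly_sum w s2 z.
Proof. exact: big_cat. Qed.

Lemma box_prefix n k N : (n <= k)%N -> exists s, box k N = box n N ++ s.
Proof.
move=> /subnK <-; elim: (k - n)%N => [|i [s E]]; first by exists [::]; rewrite cats0.
by rewrite addSn /= E -catA; eexists.
Qed.

(* On the flow line through [tau] the difference is an exponential sum whose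
   frequencies are all at least [ln (nth_prime n)]. *)
Lemma poly_sum_box_decay (R : realType) (w : multi_index -> Cplx R) (M : R) n k N
    (tau : torus R) (x : R) : analytic w -> (n <= k)%N -> 0 <= x ->
  (forall i s, `|complex.Re (poly_sum w (box i N) (coords s))| <= M /\
               `|complex.Im (poly_sum w (box i N) (coords s))| <= M) ->
  let d := poly_sum w (box k N) (b_theta x tau) - poly_sum w (box n N) (b_theta x tau) in
  `|complex.Re d| <= 4 * M * expR (- (ln (nth_prime n)%:R * x)) /\
  `|complex.Im d| <= 4 * M * expR (- (ln (nth_prime n)%:R * x)).
Proof.
move=> w0 nk x0 wM d; have [s E] := box_prefix N nk.
have dE z : poly_sum w s z = poly_sum w (box k N) z - poly_sum w (box n N) z.
  by rewrite E poly_sum_cat addrC addKr.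
have sl : {in terms w tau s, forall p, ln (nth_prime n)%:R <= p.2}.
  move=> _ /mapP[a + ->] /=; rewrite mem_filter => /andP[na as_].
  have /boxP[_ aN] : a \in box k N by rewrite E mem_cat as_ orbT.
  have an : a \notin box n N.
    have := uniq_box k N; rewrite E cat_uniq => /and3P[_ /hasPn/(_ a as_) + _].
    by [].
  have [j nj aj] : exists2 j, (n <= j)%N & a j != 0.
    apply: contrapT => naj; move/negP: an; apply; apply/boxP; split => // j nj.
    by apply: contrapT => aj; apply: naj; exists j => //; exact/eqP.
  exact: freq_ge aj.
have b0 t : `|expsum (terms w tau s) 0 t| <= 2 * M /\ `|expsum (rot (terms w tau s)) 0 t| <= 2 * M.
  have [-> ->] := expsum_terms tau s 0 t w0.
  rewrite b_theta0 dE !ReD !ImD !ReN !ImN.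
  have [k1 k2] := wM k (kronecker_flow t tau); have [n1 n2] := wM n (kronecker_flow t tau).
  split; apply: le_trans (ler_normB _ _) _; lra.
have [] := expsum_terms tau s x 0 w0; rewrite kronecker_flow0 dE -/d => <- <-.
(* One factor [2] comes from the difference of two bounded sums, the other from [expsum_decay]. *)
have -> : 4 * M = 2 * (2 * M) by ring.
split; apply: expsum_decay => //.
- by move=> t; case: (b0 t).
- by move=> t; case: (b0 t).
- by move=> _ /mapP[p /sl lp ->].
- by move=> t; case: (b0 t).
- by move=> t; rewrite expsum_rotK normrN; case: (b0 t).
Qed.

(** * Unordered sums *)

#[global] Existing Instance totally_filter.

Lemma partial_sumE (I : choiceType) (V : zmodType) (g : I -> V) (A : {fset I}) :
  partial_sum g A = \sum_(i <- A) g i.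
Proof. by rewrite /partial_sum [RHS]big_seq_fsetE. Qed.

Lemma fset_sum_le (R : realType) (I : choiceType) (g : I -> R) (A B : {fset I}) :
  (forall i, 0 <= g i) -> (A `<=` B)%fset -> \sum_(i <- A) g i <= \sum_(i <- B) g i.
Proof.
move=> g0 AB.
have -> : \sum_(i <- A) g i = \sum_(i <- A) (if i \in A then g i else 0).
  by apply: eq_big_seq => i ->.
rewrite (@big_fset_incl _ _ _ _ A B)//; last by move=> i _ /negbTE ->.
by apply: ler_sum => i _; case: ifP.
Qed.

(** The sum is the supremum of the finite partial sums. Weights at most one keep the weighted sums
    below it, and a finite set [A] that nearly attains the supremum is eventually covered, with
    weights close to one, which bounds them from below. *)
Lemma unordered_sum_ge0 (R : realType) (I : choiceType) (g : I -> R) (B : R)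
    (s : nat -> seq I) (w : nat -> I -> R) :
  (forall i, 0 <= g i) -> (forall A : {fset I}, \sum_(i <- A) g i <= B) ->
  (forall n, uniq (s n)) -> (forall i, g i != 0 -> \forall n \near \oo, i \in s n) ->
  (forall n i, i \in s n -> 0 <= w n i <= 1) -> (forall i, w n i @[n --> \oo] --> (1 : R)) ->
  exists L : R, (partial_sum g @ totally --> L) /\
    \sum_(i <- s n) w n i * g i @[n --> \oo] --> L.
Proof.
move=> g0 gB us sg w01 w1.
pose E := [set \sum_(i <- A) g i | A in [set: {fset I}]].
have Es : has_sup E.
  by split; [exists (\sum_(i <- fset0) g i); exists fset0|exists B => _ [A _ <-]].
have Eub (A : {fset I}) : \sum_(i <- A) g i <= sup E by apply: sup_upper_bound => //; exists A.
exists (sup E); split.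
  apply/cvgrPdist_lt => e e0; have [_ [A _ <-] Ae] := sup_adherent e0 Es.
  exists A => // C /= AC; rewrite partial_sumE ger0_norm ?subr_ge0//.
  by rewrite ltrBlDr addrC -ltrBlDr (lt_le_trans Ae)// fset_sum_le.
apply/cvgrPdist_lt => e e0; have e2 : 0 < e / 2 by rewrite divr_gt0.
have [_ [A _ <-] Ae] := sup_adherent e2 Es.
have cA : \sum_(i <- A) w n i * g i @[n --> \oo] --> \sum_(i <- A) g i.
  rewrite (eq_bigr (fun i => 1 * g i)); last by move=> i _; rewrite mul1r.
  by apply: cvg_big => [|i _]; [exact: add_continuous|apply: cvgM; [exact: w1|exact: cvg_cst]].
have inA : \forall n \near \oo, forall i, i \in A -> g i != 0 -> i \in s n.
  have h (l : seq I) : \forall n \near \oo, forall i, i \in l -> g i != 0 -> i \in s n.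
    elim: l => [|j l IH]; first by near=> n.
    have [j0|j0] := eqVneq (g j) 0.
      near=> n => i; rewrite inE => /orP[/eqP ->|il]; first by rewrite j0 eqxx.
      by move: i il; near: n.
    near=> n => i; rewrite inE => /orP[/eqP -> _|il].
      by near: n; exact: sg.
    by move: i il; near: n.
  exact: (h A).
have /cvgrPdist_lt/(_ _ e2) cA2 := cA.
have sE n (f : I -> R) : \sum_(i <- [fset i in s n]%fset) f i = \sum_(i <- s n) f i.
  by apply: perm_big; apply: uniq_perm => // i; rewrite !inE.
near=> n.
have inn : forall i, i \in A -> g i != 0 -> i \in s n by near: n; exact: inA.
have up : \sum_(i <- s n) w n i * g i <= sup E.
  apply: le_trans (Eub [fset i in s n]%fset).
  rewrite sE.
  rewrite [leLHS]big_seq [leRHS]big_seq; apply: ler_sum => i /w01 /andP[_ wi1].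
  by rewrite -[leRHS]mul1r ler_wpM2r.
have lo : \sum_(i <- A) w n i * g i <= \sum_(i <- s n) w n i * g i.
  rewrite -sE.
  pose h i := if i \in s n then w n i * g i else 0.
  have h0 i : 0 <= h i.
    by rewrite /h; case: ifP => // /w01 /andP[wi0 _]; exact: mulr_ge0.
  have -> : \sum_(i <- A) w n i * g i = \sum_(i <- A) h i.
    apply: eq_big_seq => i iA; rewrite /h; case: ifPn => // is_.
    have [->|gi0] := eqVneq (g i) 0; first by rewrite mulr0.
    by rewrite inn in is_.
  rewrite (_ : \sum_(i <- [fset i in s n]%fset) _ = \sum_(i <- [fset i in s n]%fset) h i); last first.
    by apply: eq_big_seq => i; rewrite inE /= /h => ->.
  rewrite [leRHS](@big_fset_incl _ _ _ _ _ (A `|` [fset i in s n])%fset).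
  - by apply: fset_sum_le => //; exact: fsubsetUl.
  - exact: fsubsetUr.
  - by move=> i _; rewrite inE /= /h => /negbTE ->.
have An : `|\sum_(i <- A) g i - \sum_(i <- A) w n i * g i| < e / 2 by near: n; exact: cA2.
rewrite ger0_norm ?subr_ge0//; have := ler_norm (\sum_(i <- A) g i - \sum_(i <- A) w n i * g i).
lra.
Unshelve. all: by end_near.
Qed.

Lemma unordered_sum (R : realType) (I : choiceType) (g : I -> R) (B : R)
    (s : nat -> seq I) (w : nat -> I -> R) :
  (forall A : {fset I}, \sum_(i <- A) `|g i| <= B) ->
  (forall n, uniq (s n)) -> (forall i, g i != 0 -> \forall n \near \oo, i \in s n) ->
  (forall n i, i \in s n -> 0 <= w n i <= 1) -> (forall i, w n i @[n --> \oo] --> (1 : R)) ->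
  exists L : R, (partial_sum g @ totally --> L) /\
    \sum_(i <- s n) w n i * g i @[n --> \oo] --> L.
Proof.
move=> gB us sg w01 w1.
pose p i := Num.max (g i) 0; pose q i := Num.max (- g i) 0.
have pq i : g i = p i - q i by rewrite /p /q !maxEle; case: ifP; case: ifP; lra.
have p0 i : 0 <= p i by rewrite le_max lexx orbT.
have q0 i : 0 <= q i by rewrite le_max lexx orbT.
have pg i : p i <= `|g i| by rewrite ge_max ler_norm normr_ge0.
have qg i : q i <= `|g i| by rewrite ge_max -normrN ler_norm normr_ge0.
have [||||||L1 [P1 P2]] := @unordered_sum_ge0 R I p B s w => //.
- by move=> A; apply: le_trans (gB A); apply: ler_sum.
- by move=> i pi; apply: sg; apply: contraNneq pi => gi; rewrite /p gi maxxx.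
have [||||||L2 [Q1 Q2]] := @unordered_sum_ge0 R I q B s w => //.
- by move=> A; apply: le_trans (gB A); apply: ler_sum.
- by move=> i pi; apply: sg; apply: contraNneq pi => gi; rewrite /q gi oppr0 maxxx.
exists (L1 - L2); split.
  rewrite (_ : partial_sum g = fun A => partial_sum p A - partial_sum q A).
    exact: cvgB.
  by apply/funext => A; rewrite /partial_sum -sumrB; apply: eq_bigr => i _.
rewrite (_ : (fun n => _) = fun n => \sum_(i <- s n) w n i * p i - \sum_(i <- s n) w n i * q i).
  exact: cvgB.
by apply/funext => n; rewrite -sumrB; apply: eq_bigr => i _; rewrite -mulrBr -pq.
Qed.

(** * Point values as limits of Fejer means *)

(** The sum factors over the [n] variables, and each two-sided geometric series is at most
    [(1 + r) / (1 - r) <= 2 / (1 - r)]. *)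
Lemma box_rho_le (R : realType) (r : R) n N : 0 <= r -> r < 1 ->
  \sum_(a <- box n N) mulfun (fun _ k => r ^+ `|k|%N) a <= (2 / (1 - r)) ^+ n.
Proof.
move=> r0 r1; have r1' : 0 < 1 - r by rewrite subr_gt0.
rewrite sum_box -[in leRHS](card_ord n) -prodr_const; apply: ler_prod => j _.
rewrite sum_nonzero_ints; apply/andP; split.
  by rewrite addr_ge0// sumr_ge0// => k _; rewrite addr_ge0// exprn_ge0.
have E : (1 - r) * \sum_(k < N.+1) r ^+ k = 1 - r ^+ N.+1.
  by rewrite -[LHS]opprK -mulNr opprB -subrX1 opprB.
have F : 1 + \sum_(k < N) (r ^+ `|k.+1%:Z|%N + r ^+ `|- k.+1%:Z|%N) =
    2 * (\sum_(k < N.+1) r ^+ k) - 1.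
  rewrite big_ord_recl /= expr0 (eq_bigr (fun k : 'I_N => 2 * r ^+ k.+1)); last first.
    by move=> k _; ring.
  by rewrite -mulr_sumr; ring.
rewrite F ler_pdivlMr// mulrC.
have : 0 <= r ^+ N.+1 by exact: exprn_ge0.
rewrite mulrBr mulrCA E; lra.
Qed.

Definition real_fejer_weight (R : realType) N (a : multi_index) : R :=
  mulfun (fun _ k => fejer R N k) a.

Lemma fejer_weightE (R : realType) N (a : multi_index) :
  fejer_weight R N a = (real_fejer_weight R N a)%:C%C.
Proof. by rewrite /real_fejer_weight /mulfun rmorph_prod. Qed.

Lemma real_fejer_weight_itv (R : realType) n N (a : multi_index) : a \in box n N ->
  0 <= real_fejer_weight R N a <= 1.
Proof.
move=> /boxP[_ aN]; apply/andP; split.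
  by apply: prodr_ge0 => j _; case/andP: (fejer_itv R (aN j)).
by apply: prodr_ile1 => j _; exact: fejer_itv.
Qed.

Lemma cvg_real_fejer_weight (R : realType) (a : multi_index) :
  real_fejer_weight R N a @[N --> \oo] --> (1 : R).
Proof.
rewrite [X in _ --> X](_ : 1 = \prod_(j <- finsupp a) (1 : R)); last by rewrite big1.
by apply: cvg_big => [|j _]; [exact: mul_continuous|exact: cvg_fejer].
Qed.

Lemma first_indicesP n (a : multi_index) : a \in first_indices n ->
  \forall N \near \oo, a \in box n N.
Proof.
rewrite inE => -[_ an]; exists (\sum_(j <- finsupp a) `|a j|%N)%N => // N /= aN.
apply/boxP; split => // j; apply: leq_trans aN.
have [ja|] := boolP (j \in finsupp a); first by rewrite (big_fsetD1 j)//= leq_addr.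
by rewrite mem_finsupp negbK => /eqP ->.
Qed.

Lemma norm_monomial_le (R : realType) (z : nat -> Cplx R) (r : R) (a : multi_index) :
  nonneg a -> (forall j, `|z j| <= r%:C%C) ->
  `|monomial z a| <= (mulfun (fun _ k => r ^+ `|k|%N) a)%:C%C.
Proof.
move=> /nonnegP a0 zr; rewrite /monomial normr_prod rmorph_prod; apply: ler_prod => j _.
rewrite normr_ge0/= rmorphXn /=; case: (a j) (a0 j) => // k _.
by rewrite -exprnP normrX lerXn2r// ?nnegrE ?normr_ge0// (le_trans _ (zr j)).
Qed.

(** The indices of a finite set at which [g] may be nonzero all lie in one box, where the product
    bound applies; its right-hand side does not depend on the box. *)
Lemma summable_bound (R : realType) (g : multi_index -> R) (C r : R) n :
  0 <= C -> 0 <= r -> r < 1 ->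
  (forall a, a \notin first_indices n -> g a = 0) ->
  (forall a, `|g a| <= C * mulfun (fun _ k => r ^+ `|k|%N) a) ->
  forall A : {fset multi_index}, \sum_(a <- A) `|g a| <= C * (2 / (1 - r)) ^+ n.
Proof.
move=> C0 r0 r1 g0 gC A.
pose rho := mulfun (fun _ k => r ^+ `|k|%N).
have rho0 a : 0 <= rho a by apply: prodr_ge0 => j _; exact: exprn_ge0.
have [N AN] : exists N, forall a, a \in A -> a \in first_indices n -> a \in box n N.
  have h (l : seq multi_index) :
      \forall N \near \oo, forall a, a \in l -> a \in first_indices n -> a \in box n N.
    elim: l => [|b l IH]; first by near=> N.
    have [bn|bn] := boolP (b \in first_indices n).
      near=> N => a; rewrite inE => /orP[/eqP -> _|al].
        by near: N; exact: first_indicesP.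
      by move: a al; near: N.
    near=> N => a; rewrite inE => /orP[/eqP ->|al]; first by rewrite (negbTE bn).
    by move: a al; near: N.
  by have [N _ /(_ N (leqnn N))] := h A; exists N.
have sE (f : multi_index -> R) : \sum_(a <- [fset a in box n N]%fset) f a = \sum_(a <- box n N) f a.
  by apply: perm_big; apply: uniq_perm; rewrite ?uniq_box// => a; rewrite !inE.
apply: (@le_trans _ _ (\sum_(a <- A) if a \in box n N then C * rho a else 0)).
  rewrite big_seq [leRHS]big_seq; apply: ler_sum => a aA; case: ifPn => [_|an]; first exact: gC.
  rewrite g0 ?normr0//; apply/negP => af; by rewrite AN in an.
apply: le_trans (_ : \sum_(a <- A `|` [fset a in box n N]) _ <= _)%fset.
  apply: fset_sum_le; last exact: fsubsetUl.
  by move=> a; case: ifP => // _; exact: mulr_ge0.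
rewrite -(@big_fset_incl _ _ _ _ [fset a in box n N]%fset); last 2 first.
- exact: fsubsetUr.
- by move=> a _; rewrite inE /= => /negbTE ->.
rewrite sE (eq_big_seq (fun a => C * rho a)); last by move=> a ->.
by rewrite -mulr_sumr ler_wpM2l// box_rho_le.
Unshelve. all: by end_near.
Qed.

(** For a fixed number of variables the series converges absolutely at [z], so the unordered sum
    exists and removing the Fejer weights in the limit does not change it. Box indices outside
    [first_indices n] have zero coefficient because [c] is analytic. *)
Lemma cvg_point_terms (R : realType) (c : multi_index -> Cplx R) (C r : R) (z : nat -> Cplx R) n :
  analytic c -> (forall a, `|c a| <= C%:C%C) -> 0 <= r -> r < 1 -> (forall j, `|z j| <= r%:C%C) ->
  exists L : Cplx R, [/\ partial_sum (fun b => if b \in first_indices n then c b * monomial z b else 0)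
      @ totally --> L,
    complex.Re (poly_sum (fun a => fejer_weight R N a * c a) (box n N) z) @[N --> \oo] --> complex.Re L &
    complex.Im (poly_sum (fun a => fejer_weight R N a * c a) (box n N) z) @[N --> \oo] --> complex.Im L].
Proof.
move=> c0 cC r0 r1 zr.
pose g (b : multi_index) : Cplx R := if b \in first_indices n then c b * monomial z b else 0.
pose rho : multi_index -> R := mulfun (fun _ k => r ^+ `|k|%N).
have rho0 a : 0 <= rho a by apply: prodr_ge0 => j _; exact: exprn_ge0.
have C0 : 0 <= C.
  by have := le_trans (normr_ge0 _) (cC [fsfun]); rewrite lecR.
have gC a : `|g a| <= (C * rho a)%:C%C.
  rewrite /g; case: ifPn => [|_]; last by rewrite normr0 lecR mulr_ge0.
  rewrite inE => -[a0 _]; rewrite normrM rmorphM; apply: ler_pM => //.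
  by apply: norm_monomial_le => //; exact/nonnegP.
have gz a : a \notin first_indices n -> g a = 0 by rewrite /g => /negbTE ->.
have bR := @summable_bound R (fun a => complex.Re (g a)) C r n C0 r0 r1
  (fun a ga => congr1 (@complex.Re R) (gz a ga)) (fun a => norm_Re_le (gC a)).
have bI := @summable_bound R (fun a => complex.Im (g a)) C r n C0 r0 r1
  (fun a ga => congr1 (@complex.Im R) (gz a ga)) (fun a => norm_Im_le (gC a)).
have gbox a : g a != 0 -> \forall N \near \oo, a \in box n N.
  by move=> ga; apply: first_indicesP; apply: contraNT ga => /gz ->.
have gR a : complex.Re (g a) != 0 -> \forall N \near \oo, a \in box n N.
  by move=> ga; apply: gbox; apply: contraNneq ga => ->.
have gI a : complex.Im (g a) != 0 -> \forall N \near \oo, a \in box n N.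
  by move=> ga; apply: gbox; apply: contraNneq ga => ->.
have [LR [PR QR]] := unordered_sum bR (uniq_box n) gR (@real_fejer_weight_itv R n)
    (@cvg_real_fejer_weight R).
have [LI [PI QI]] := unordered_sum bI (uniq_box n) gI (@real_fejer_weight_itv R n)
    (@cvg_real_fejer_weight R).
have sE N : poly_sum (fun a => fejer_weight R N a * c a) (box n N) z =
    \sum_(a <- box n N) (real_fejer_weight R N a)%:C%C * g a.
  apply: eq_big_seq => a /boxP[an _]; rewrite fejer_weightE -mulrA; congr (_ * _).
  rewrite /g; case: ifPn => // af; rewrite c0 ?mul0r//.
  by apply: contraNN af => /nonnegP a0; rewrite inE.
exists (Complex LR LI); split.
- apply: cvg_complex.
    suff E : (fun A => complex.Re (partial_sum g A)) = partial_sum (fun a => complex.Re (g a)).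
      by rewrite -E in PR; exact: PR.
    by apply/funext => A; exact: Re_sum.
  suff E : (fun A => complex.Im (partial_sum g A)) = partial_sum (fun a => complex.Im (g a)).
    by rewrite -E in PI; exact: PI.
  by apply/funext => A; exact: Im_sum.
- under eq_fun do rewrite sE Re_sum.
  rewrite (_ : (fun N => _) = (fun N => \sum_(a <- box n N) real_fejer_weight R N a * complex.Re (g a)))//.
  by apply/funext => N; apply: eq_bigr => a _; rewrite ReM/= mul0r subr0.
- under eq_fun do rewrite sE Im_sum.
  rewrite (_ : (fun N => _) = (fun N => \sum_(a <- box n N) real_fejer_weight R N a * complex.Im (g a)))//.
  by apply/funext => N; apply: eq_bigr => a _; rewrite ImM/= mul0r addr0.
Qed.

Lemma norm_fourier_le (R : realType) (m : probability (torus R) R) (F : torus R -> Cplx R)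
    (M : R) a : complex_measurable F ->
  (forall s, `|complex.Re (F s)| <= M /\ `|complex.Im (F s)| <= M) ->
  `|fourier m F a| <= (4 * M)%:C%C.
Proof.
move=> mF FM; have bF : bounded_measurable F by split => //; exists M.
have bm := bounded_measurable_conj (bounded_measurable_monomial R a).
have [[mR mI] _] := bounded_measurable_mul bF bm.
have m1 (tau : torus R) : `|complex.Re ((monomial (coords tau) a)^*)| <= 1 /\
    `|complex.Im ((monomial (coords tau) a)^*)| <= 1.
  by split; [apply: norm_Re_le|apply: norm_Im_le]; rewrite norm_conjC norm_monomial.
have i1 : m.-integrable setT (EFin \o (fun=> 1 : R)) by exact: finite_measure_integrable_cst.
have I1 : \int[m]_x (1 : R) = 1.
  by rewrite Rintegral_cst// mul1r; exact: (congr1 fine (probability_setT m)).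
have key (g : torus R -> R) : measurable_fun setT g -> (forall s, `|g s| <= 2 * M) ->
    `|\int[m]_s g s| <= 2 * M.
  move=> mg gM; have gM1 s : `|g s| <= 2 * M * 1 by rewrite mulr1.
  by have := probability_Rintegral_le mg i1 gM1; rewrite I1 mulr1.
apply: le_trans (norm_le_parts _) _; rewrite lecR.
suff : `|complex.Re (fourier m F a)| <= 2 * M /\ `|complex.Im (fourier m F a)| <= 2 * M.
  by move=> []; lra.
have prod (x y : R) : `|x| <= M -> `|y| <= 1 -> `|x * y| <= M.
  by move=> xM y1; rewrite normrM -[M]mulr1 ler_pM.
split; apply: key => // s; have [r1 r2] := m1 s; have [f1 f2] := FM s.
  rewrite ReM; apply: le_trans (ler_normB _ _) _.
  by rewrite mulr_natl mulr2n lerD// prod.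
rewrite ImM; apply: le_trans (ler_normD _ _) _.
by rewrite mulr_natl mulr2n lerD// prod.
Qed.

Lemma diagonal_cvg (R : realType) (q : nat -> nat -> R) (p e : nat -> R) :
  (forall n k N, (n <= k)%N -> `|q k N - q n N| <= e n) ->
  (forall n, q n N @[N --> \oo] --> p n) -> e n @[n --> \oo] --> (0 : R) ->
  exists l : R, (p n @[n --> \oo] --> l) /\ q n n @[n --> \oo] --> l.
Proof.
move=> qe qp e0.
have pe n k : (n <= k)%N -> `|p k - p n| <= e n.
  move=> nk; have c : `|q k N - q n N| @[N --> \oo] --> `|p k - p n|.
    by apply: cvg_norm; apply: cvgB.
  by apply: (cvgr_to_le c); near=> N; exact: qe.
have cp : cvg (p n @[n --> \oo]).
  apply/cauchy_cvgP/cauchy_exP => eps eps0.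
  have /cvgrPdist_lt/(_ _ eps0) [n0 _ en0] := e0.
  exists (p n0), n0 => // k /= nk; rewrite -ball_normE /ball_ /= distrC.
  apply: le_lt_trans (pe _ _ nk) _; have := en0 n0 (leqnn _).
  by rewrite sub0r normrN => /(le_lt_trans (ler_norm _)).
exists (lim (p n @[n --> \oo])); split => //.
have pl n : `|lim (p k @[k --> \oo]) - p n| <= e n.
  have c : `|p k - p n| @[k --> \oo] --> `|lim (p k @[k --> \oo]) - p n|.
    by apply: cvg_norm; apply: cvgB => //; exact: cvg_cst.
  by apply: (cvgr_to_le c); near=> k; apply: pe; near: k; exact: nbhs_infty_ge.
apply/cvgrPdist_lt => eps eps0; have e3 : 0 < eps / 3 by rewrite divr_gt0.
have /cvgrPdist_lt/(_ _ e3) [n0 _ /(_ n0 (leqnn _))] := e0.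
rewrite sub0r normrN => /(le_lt_trans (ler_norm _)) en0.
have /cvgrPdist_lt/(_ _ e3) qn := qp n0.
near=> k.
have n0k : (n0 <= k)%N by near: k; exact: nbhs_infty_ge.
have h1 := pl n0; have h2 := qe n0 k k n0k.
have h3 : `|p n0 - q n0 k| < eps / 3 by near: k.
rewrite (_ : _ - _ = (lim (p k @[k --> \oo]) - p n0) + (p n0 - q n0 k) - (q k k - q n0 k)); last by ring.
apply: le_lt_trans (ler_normB _ _) _; have := ler_normD (lim (p k @[k --> \oo]) - p n0) (p n0 - q n0 k).
lra.
Unshelve. all: by end_near.
Qed.

Lemma cvg_expR_ln_prime (R : realType) (C x : R) : 0 < x ->
  C * expR (- (ln (nth_prime n)%:R * x)) @[n --> \oo] --> (0 : R).
Proof.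
move=> x0; rewrite -(mulr0 C); apply: cvgM; first exact: cvg_cst.
apply/cvgrPdist_lt => e e0; pose K := - ln e / x; near=> n.
rewrite sub0r normrN ger0_norm ?expR_ge0// -[ltRHS](lnK (e0 : e \is Num.pos)) ltr_expR ltrNl.
rewrite -ltr_pdivrMr// -/K -(expRK K) ltr_ln ?posrE ?expR_gt0 ?nth_prime_gt0//.
apply: lt_trans (_ : n%:R < _); last by rewrite ltr_nat (leq_trans _ (nth_prime_ge n)).
by near: n; exact: nbhs_infty_gtr.
Unshelve. all: by end_near.
Qed.

Lemma norm_b_theta (R : realType) (x : R) (tau : torus R) j : 0 < x ->
  `|b_theta x tau j| <= (expR (- (ln 2 * x)))%:C%C.
Proof.
move=> x0; rewrite /b_theta normrM (eqP (svalP (tau j))) mulr1 normc_def /= expr0n addr0 sqrtr_sqr.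
rewrite lecR ger0_norm ?powR_ge0// /powR gt_eqF ?nth_prime_gt0// ler_expR mulNr lerN2 mulrC.
by apply: ler_wpM2l; [exact: ltW|exact: (@ln_nth_prime_homo R 0 j)].
Qed.

(** For fixed [n] the means tend to [point_value_n] as the degree grows, and the decay in [n] is
    uniform in the degree, so the diagonal converges. The existence of the limit defining
    [point_value] at these points is obtained on the way. *)
Lemma fejer_sum_cvg (R : realType) (m : probability (torus R) R) (F : torus R -> Cplx R)
    (M : R) (tau : torus R) (x : R) : is_haar m -> complex_measurable F ->
  (forall s, `|complex.Re (F s)| <= M /\ `|complex.Im (F s)| <= M) ->
  analytic (fourier m F) -> 0 < x ->
  complex.Re (fejer_sum m F n n (b_theta x tau)) @[n --> \oo] -->
    complex.Re (point_value m F (b_theta x tau)) /\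
  complex.Im (fejer_sum m F n n (b_theta x tau)) @[n --> \oo] -->
    complex.Im (point_value m F (b_theta x tau)).
Proof.
move=> mh mF FM an x0; pose z := b_theta x tau; rewrite -/z.
have ln2 : 0 < ln 2 :> R by rewrite ln_gt0// ltr1n.
have r1 : expR (- (ln 2 * x)) < 1 :> R by rewrite expR_lt1 oppr_lt0 mulr_gt0.
have pn n : complex.Re (fejer_sum m F n N z) @[N --> \oo] --> complex.Re (point_value_n m F n z) /\
    complex.Im (fejer_sum m F n N z) @[N --> \oo] --> complex.Im (point_value_n m F n z).
  have [L [PL RL IL]] := cvg_point_terms n an (fun a => norm_fourier_le m a mF FM)
    (expR_ge0 _) r1 (fun j => norm_b_theta tau j x0).
  have -> : point_value_n m F n z = L by apply: cvg_lim PL; exact: norm_hausdorff.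
  by split.
pose e n := 4 * M * expR (- (ln (nth_prime n)%:R * x)).
have e0 : e n @[n --> \oo] --> (0 : R) by exact: cvg_expR_ln_prime.
have dec n k N : (n <= k)%N ->
    `|complex.Re (fejer_sum m F k N z) - complex.Re (fejer_sum m F n N z)| <= e n /\
    `|complex.Im (fejer_sum m F k N z) - complex.Im (fejer_sum m F n N z)| <= e n.
  move=> nk; rewrite -ReN -ReD -ImN -ImD.
  apply: (@poly_sum_box_decay R (fun a => fejer_weight R N a * fourier m F a) M) => //.
  - by move=> a /an ->; rewrite mulr0.
  - exact: ltW.
  - by move=> i s; exact: fejer_sum_le.
have [l1 [P1 Q1]] := diagonal_cvg (fun n k N nk => (dec n k N nk).1) (fun n => (pn n).1) e0.
have [l2 [P2 Q2]] := diagonal_cvg (fun n k N nk => (dec n k N nk).2) (fun n => (pn n).2) e0.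
have -> : point_value m F z = Complex l1 l2.
  by apply: cvg_lim; [exact: norm_hausdorff|exact: cvg_complex].
by split.
Qed.

Lemma point_value_fatou (R : realType) (m : probability (torus R) R) (F : torus R -> Cplx R)
    (M : R) (tau : torus R) (G := fun x t => point_value m F (b_theta x (kronecker_flow t tau))) :
  is_haar m -> complex_measurable F ->
  (forall s, `|complex.Re (F s)| <= M /\ `|complex.Im (F s)| <= M) ->
  analytic (fourier m F) ->
  ((forall x t : R, 0 < x -> complex.Re (G y t) @[y --> x] --> complex.Re (G x t)) /\
   \forall t \ae lebesgue_measure, cvg (complex.Re (G x t) @[x --> 0^'+])) /\
  ((forall x t : R, 0 < x -> complex.Im (G y t) @[y --> x] --> complex.Im (G x t)) /\
   \forall t \ae lebesgue_measure, cvg (complex.Im (G x t) @[x --> 0^'+])).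
Proof.
move=> mh mF FM an.
pose w n a := fejer_weight R n a * fourier m F a.
have wan n : analytic (w n) by move=> a /an; rewrite /w => ->; rewrite mulr0.
pose L n := terms (w n) tau (box n n).
have E n x t := @expsum_terms R (w n) tau (box n n) x t (wan n).
have cvL x t : 0 < x -> expsum (L n) x t @[n --> \oo] --> complex.Re (G x t) /\
    expsum (rot (L n)) x t @[n --> \oo] --> complex.Im (G x t).
  move=> x0; have := fejer_sum_cvg (kronecker_flow t tau) mh mF FM an x0.
  by rewrite (funext (fun n => (E n x t).1)) (funext (fun n => (E n x t).2)).
have L0 n : {in L n, forall p, 0 <= p.2}.
  by move=> _ /mapP[a + ->]; rewrite mem_filter => /andP[na _]; exact: freq_ge0.
have rL0 n : {in rot (L n), forall p, 0 <= p.2}.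
  by move=> _ /mapP[p pL ->]; exact: L0 pL.
have bL n t : `|expsum (L n) 0 t| <= M /\ `|expsum (rot (L n)) 0 t| <= M.
  have [-> ->] := E n 0 t; rewrite b_theta0.
  exact: (fejer_sum_le n n (kronecker_flow t tau) mh mF FM).
split.
  apply: (@limit_expsum_fatou R L M (fun x t => complex.Re (G x t))
    (fun x t => complex.Im (G x t)) L0 (fun n t => (bL n t).1) (fun n t => (bL n t).2)).
    by move=> x t x0; case: (cvL x t x0).
  by move=> x t x0; case: (cvL x t x0).
(* Multiplication by [- i] makes the imaginary part a real part, with conjugate [- Re]. *)
apply: (@limit_expsum_fatou R (fun n => rot (L n)) M
  (fun x t => complex.Im (G x t)) (fun x t => - complex.Re (G x t)) rL0).
- by move=> n t; case: (bL n t).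
- by move=> n t; rewrite expsum_rotK normrN; case: (bL n t).
- by move=> x t x0; case: (cvL x t x0).
- move=> x t x0; rewrite (funext (fun n => expsum_rotK (L n) x t)).
  by apply: cvgN; case: (cvL x t x0).
Qed.

(** * Uniqueness of Fourier coefficients *)

(* The factor [n] in the exponent settles the value [y = 2^-1]. *)
Lemma cvg_step_poly (R : realType) (y : R) : 0 <= y <= 1 ->
  (1 - y ^+ n) ^+ (n * 2 ^ n) @[n --> \oo] --> ((y < 2^-1)%R%:R : R).
Proof.
move=> /andP[y0 y1].
have y01 n : 0 <= 1 - y ^+ n by rewrite subr_ge0 exprn_ile1.
have E n : (n * 2 ^ n)%:R * y ^+ n = n%:R * (2 * y) ^+ n.
  by rewrite natrM natrX exprMn; ring.
have [yh|yh] := ltP y 2^-1; last first.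
  have h : expR (-1) ^+ n @[n --> \oo] --> (0 : R).
    by apply: cvg_expr; rewrite ger0_norm ?expR_ge0// expR_lt1 oppr_lt0.
  apply: (squeeze_cvgr _ (cvg_cst _) h); near=> n; rewrite exprn_ge0//=.
  (* From [1 - u <= exp (- u)]; the exponent becomes [- n (2 y) ^ n <= - n], since [2 y >= 1]. *)
  have : (1 - y ^+ n) ^+ (n * 2 ^ n) <= expR (- (y ^+ n)) ^+ (n * 2 ^ n).
    by rewrite lerXn2r// ?nnegrE ?expR_ge0//; exact: expR_ge1Dx.
  move=> /le_trans; apply; rewrite -!expRM_natl ler_expR mulrN E mulrN1 lerN2.
  rewrite -[leLHS]mulr1; apply: ler_wpM2l => //; apply: exprn_ege1; lra.
have q0 : n%:R * (2 * y) ^+ n @[n --> \oo] --> (0 : R).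
  have [->|yn0] := eqVneq y 0.
    rewrite -cvg_shiftS mulr0 (_ : (fun n => _) = fun=> 0); first exact: cvg_cst.
    by apply/funext => n; rewrite expr0n mulr0.
  have yp : 0 < 2 * y by rewrite mulr_gt0// lt0r yn0.
  pose d := - ln (2 * y); have d0 : 0 < d by rewrite oppr_gt0 ln_lt0// yp; lra.
  have yE n : (2 * y) ^+ n = (expR (n%:R * d))^-1.
    by rewrite expRM_natl -exprVn -expRN opprK lnK.
  (* The quadratic term of [exp (n d)] bounds [n exp (- n d)] by [2 / (d ^ 2 n)]. *)
  have h : 2 / d ^+ 2 / n%:R @[n --> \oo] --> (0 : R).
    rewrite -cvg_shiftS; have := cvgM (cvg_cst (2 / d ^+ 2)) (@cvg_harmonic R).
    by rewrite mulr0; apply.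
  apply: (squeeze_cvgr _ (cvg_cst _) h); near=> n.
  have n0 : 0 < n%:R :> R by rewrite ltr0n; near: n; exact: nbhs_infty_gt.
  apply/andP; split; first by apply: mulr_ge0; [exact: ltW|apply: exprn_ge0; exact: ltW].
  rewrite yE ler_pdivrMr ?expR_gt0//.
  have := @expR_ge1Dxn R (n%:R * d) 1 (mulr_ge0 (ltW n0) (ltW d0)).
  rewrite /= => h2; have {}h2 : (n%:R * d) ^+ 2 / 2 <= expR (n%:R * d).
    by apply: le_trans h2; rewrite lerDr.
  apply: le_trans (ler_wpM2l _ h2); last by rewrite !divr_ge0 ?exprn_ge0 ?ltW.
  by rewrite [leRHS](_ : _ = n%:R)//; field; rewrite !gt_eqF.
have h : 1 - n%:R * (2 * y) ^+ n @[n --> \oo] --> (1 : R).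
  by rewrite -[X in _ --> X]subr0; apply: cvgB => //; exact: cvg_cst.
apply: (squeeze_cvgr _ h (cvg_cst _)); near=> n; apply/andP; split.
  (* Bernoulli's inequality gives the matching lower bound [1 - n (2 y) ^ n]. *)
  have bern k (u : R) : 0 <= u <= 1 -> 1 - k%:R * u <= (1 - u) ^+ k.
    move=> /andP[u0 u1]; elim: k => [|k IH]; first by rewrite mul0r subr0 expr0.
    rewrite exprS; apply: le_trans (ler_wpM2l _ IH); last by rewrite subr_ge0.
    rewrite -natr1; have : 0 <= k%:R * (u * u) by rewrite !mulr_ge0.
    lra.
  by rewrite -E; apply: bern; rewrite exprn_ge0//= exprn_ile1.
by apply: exprn_ile1 => //; rewrite lerBlDr lerDl exprn_ge0.
Unshelve. all: by end_near.
Qed.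

Definition annihilated (R : realType) (m : probability (torus R) R) (h f : torus R -> Cplx R) :=
  bounded_measurable f /\
  forall a, complex_integral m (fun s => f s * (h s * (monomial (coords s) a)^*)) = 0.

(** Preserving every annihilated function, rather than only annihilating the coefficients of
    [u * h], is what makes multipliers closed under products. *)
Definition multiplier (R : realType) (m : probability (torus R) R) (h u : torus R -> Cplx R) :=
  bounded_measurable u /\ forall f, annihilated m h f -> annihilated m h (fun s => u s * f s).

Lemma bounded_measurable_coef (R : realType) (h : torus R -> Cplx R) a :
  bounded_measurable h -> bounded_measurable (fun s => h s * (monomial (coords s) a)^*).
Proof.
move=> bh; apply: bounded_measurable_mul => //; apply: bounded_measurable_conj.
exact: bounded_measurable_monomial.
Qed.

Lemma multiplier_cst (R : realType) (m : probability (torus R) R) (h : torus R -> Cplx R) c :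
  bounded_measurable h -> multiplier m h (fun=> c).
Proof.
move=> bh; split; first exact: bounded_measurable_cst.
move=> f [bf f0]; split; first by apply: bounded_measurable_mul => //; exact: bounded_measurable_cst.
move=> a; rewrite (_ : (fun s => _) = (fun s => c * (f s * (h s * (monomial (coords s) a)^*)))).
  rewrite complex_integralZ ?f0 ?mulr0//; apply: bounded_measurable_mul => //.
  exact: bounded_measurable_coef.
by apply/funext => s; exact/esym/mulrA.
Qed.

Lemma multiplier_add (R : realType) (m : probability (torus R) R) (h u v : torus R -> Cplx R) :
  bounded_measurable h -> multiplier m h u -> multiplier m h v ->
  multiplier m h (fun s => u s + v s).
Proof.
move=> bh [bu hu] [bv hv]; split; first exact: bounded_measurable_add.
move=> f af; have [buf uf] := hu f af; have [bvf vf] := hv f af.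
split; first by apply: bounded_measurable_mul; [exact: bounded_measurable_add|case: af].
move=> a; rewrite (_ : (fun s => _) = (fun s => u s * f s * (h s * (monomial (coords s) a)^*)
    + v s * f s * (h s * (monomial (coords s) a)^*))).
  have bm := bounded_measurable_coef a bh.
  by rewrite complex_integralD ?uf ?vf ?addr0//; exact: bounded_measurable_mul.
by apply/funext => s; rewrite -!mulrDl.
Qed.

Lemma multiplier_mul (R : realType) (m : probability (torus R) R) (h u v : torus R -> Cplx R) :
  multiplier m h u -> multiplier m h v -> multiplier m h (fun s => u s * v s).
Proof.
move=> [bu hu] [bv hv]; split; first exact: bounded_measurable_mul.
move=> f /hv /hu; rewrite (_ : (fun s => u s * (v s * f s)) = (fun s => u s * v s * f s))//.
by apply/funext => s; rewrite mulrA.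
Qed.

Lemma multiplier_exp (R : realType) (m : probability (torus R) R) (h u : torus R -> Cplx R) n :
  bounded_measurable h -> multiplier m h u -> multiplier m h (fun s => u s ^+ n).
Proof.
move=> bh mu; elim: n => [|n IH].
  by rewrite (_ : (fun s => _) = fun=> 1)//; exact: multiplier_cst.
rewrite (_ : (fun s => _) = fun s => u s * u s ^+ n); last by apply/funext => s; rewrite exprS.
exact: multiplier_mul.
Qed.

Lemma multiplier_lim (R : realType) (m : probability (torus R) R) (h : torus R -> Cplx R)
    (u_ : nat -> torus R -> R) (u : torus R -> R) (M : R) :
  bounded_measurable h -> (forall n, multiplier m h (fun s => (u_ n s)%:C%C)) ->
  (forall n s, `|u_ n s| <= M) -> (forall s, u_ n s @[n --> \oo] --> u s) ->
  multiplier m h (fun s => (u s)%:C%C).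
Proof.
move=> bh mu uM cu.
have mu_ n : measurable_fun setT (u_ n) by have [[[]]] := mu n.
have bu : bounded_measurable (fun s => (u s)%:C%C : Cplx R).
  split; first by split; [exact: (measurable_fun_cvg mu_)|exact: measurable_cst].
  exists M => s /=; rewrite normr0.
  have uMs : `|u s| <= M.
    by apply: (cvgr_to_le (cvg_norm (cu s))); near=> n.
  by split => //; exact: le_trans uMs.
split => // f af; have [bf _] := af.
have buf : bounded_measurable (fun s => (u s)%:C%C * f s) by exact: bounded_measurable_mul.
split => // a; have bm := bounded_measurable_coef a bh.
pose g s := f s * (h s * (monomial (coords s) a)^*).
have [[gR gI] [K gK]] : bounded_measurable g by exact: bounded_measurable_mul.
have un0 n : complex_integral m (fun s => (u_ n s)%:C%C * g s) = 0.
  have [_ /(_ f af)[_ /(_ a)]] := mu n.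
  by rewrite (_ : (fun s => _ * _ * _) = (fun s => (u_ n s)%:C%C * g s))//; apply/funext => s; exact/esym/mulrA.
rewrite (_ : (fun s => _) = (fun s => (u s)%:C%C * g s)); last by apply/funext => s; exact/esym/mulrA.
have RE (x : R) (z : Cplx R) : complex.Re (x%:C%C * z : Cplx R) = x * complex.Re z.
  by rewrite ReM /= mul0r subr0.
have IE (x : R) (z : Cplx R) : complex.Im (x%:C%C * z : Cplx R) = x * complex.Im z.
  by rewrite ImM /= mul0r addr0.
have [] := @complex_integral_dominated _ _ R m (fun n s => (u_ n s)%:C%C * g s)
   (fun s => (u s)%:C%C * g s) (M * K).
- move=> n; split; [rewrite (funext (fun s => RE (u_ n s) (g s)))|rewrite (funext (fun s => IE (u_ n s) (g s)))];
  exact: measurable_funM.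
- by move=> n s; rewrite RE IE !normrM; have [g1 g2] := gK s; split; exact: ler_pM.
- move=> s; under eq_fun do rewrite RE; rewrite RE; apply: cvgM => //; exact: cvg_cst.
- move=> s; under eq_fun do rewrite IE; rewrite IE; apply: cvgM => //; exact: cvg_cst.
under eq_fun do rewrite un0; move=> cR; under eq_fun do rewrite un0; move=> cI.
apply: complex_eq; [rewrite -(cvg_lim (@Rhausdorff R) cR)|rewrite -(cvg_lim (@Rhausdorff R) cI)];
exact: (cvg_lim (@Rhausdorff R) (cvg_cst _)).
Unshelve. all: by end_near.
Qed.

Lemma monomial_with (R : realType) (s : torus R) (a : multi_index) j k :
  monomial (coords s) [fsfun a with j |-> a j + k] = monomial (coords s) a * coords s j ^ k.
Proof.
have z0 : coords s j != 0 by rewrite -normr_gt0 norm_coords.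
pose D := (j |` finsupp a)%fset.
have g0 i : coords s i ^ (0 : int) = 1 by rewrite expr0z.
have E (b : multi_index) : (finsupp b `<=` D)%fset ->
    monomial (coords s) b = \prod_(i <- D) coords s i ^ b i.
  by move=> bD; exact: (mulfun_sub (g := fun i k => coords s i ^ k)).
rewrite !E.
- have jD : j \in D by exact: fset1U1.
  have w1 : [fsfun a with j |-> a j + k] j = a j + k by exact: fsfun_with.
  have w2 i : i != j -> [fsfun a with j |-> a j + k] i = a i.
    by move=> ij; rewrite fsfun_withE (negbTE ij).
  move: w1 w2; move: [fsfun _ with _ |-> _] => b w1 w2.
  rewrite (big_fsetD1 j jD) [in RHS](big_fsetD1 j jD) /= w1 expfzDr// [RHS]mulrAC.
  congr (_ * _); apply: eq_big_seq => i; rewrite !inE => /andP[ij _].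
  by rewrite w2.
- exact: fsubsetU1.
- by rewrite finsupp_with; case: ifP => _; [apply: fsubset_trans (fsubD1set _ _) (fsubsetU1 _ _)|].
Qed.

(** Multiplying by a power of one coordinate shifts the index of the Fourier coefficient, and all
    coefficients vanish. *)
Lemma multiplier_coord (R : realType) (m : probability (torus R) R) (h : torus R -> Cplx R) j (k : int) :
  bounded_measurable h -> multiplier m h (fun s => coords s j ^ k).
Proof.
move=> bh; split; first exact: bounded_measurable_coord.
move=> f [bf f0]; split; first by apply: bounded_measurable_mul => //; exact: bounded_measurable_coord.
move=> a; rewrite -[RHS](f0 [fsfun a with j |-> a j + - k]); congr complex_integral.
apply/funext => s; rewrite monomial_with rmorphM /=.
have -> : (coords s j ^ (- k))^* = coords s j ^ k.
  by rewrite -norm1_inv ?norm_exprz1 ?norm_coords// invr_expz opprK.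
ring.
Qed.

Lemma multiplier_coord_Re (R : realType) (m : probability (torus R) R) (h : torus R -> Cplx R) j :
  bounded_measurable h -> multiplier m h (fun s => (complex.Re (coords s j))%:C%C).
Proof.
move=> bh; rewrite (_ : (fun s => _) =
    (fun s : torus R => (2^-1 : R)%:C%C * (coords s j ^ (1 : int) + coords s j ^ (-1)))).
  apply: multiplier_mul; first exact: multiplier_cst.
  by apply: multiplier_add => //; exact: multiplier_coord.
apply/funext => s; rewrite expr1z exprN1 norm1_inv ?norm_coords//.
by apply: complex_eq; rewrite ?ReM ?ImM ReD ImD ReJ ImJ /=; field.
Qed.

Lemma multiplier_coord_Im (R : realType) (m : probability (torus R) R) (h : torus R -> Cplx R) j :
  bounded_measurable h -> multiplier m h (fun s => (complex.Im (coords s j))%:C%C).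
Proof.
move=> bh; rewrite (_ : (fun s => _) =
    (fun s : torus R => Complex 0 (- 2^-1 : R) *
      (coords s j ^ (1 : int) + (-1) * coords s j ^ (-1)))).
  apply: multiplier_mul; first exact: multiplier_cst.
  apply: multiplier_add => //; first exact: multiplier_coord.
  by apply: multiplier_mul; [exact: multiplier_cst|exact: multiplier_coord].
apply/funext => s; rewrite expr1z exprN1 norm1_inv ?norm_coords// mulN1r.
by apply: complex_eq; rewrite ?ReM ?ImM ReD ImD ReN ImN ReJ ImJ /=; field.
Qed.

Lemma multiplier_step (R : realType) (m : probability (torus R) R) (h : torus R -> Cplx R)
    (X : torus R -> R) (x : R) : bounded_measurable h ->
  multiplier m h (fun s => (X s)%:C%C) -> (forall s, `|X s| <= 1) ->
  multiplier m h (fun s => ((X s < x)%R%:R : R)%:C%C).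
Proof.
(* As [|X s - x| <= 1 + |x|], this slope carries the range of [X] into [[0, 1]], with the threshold
   [x] sent to [1 / 2]. *)
move=> bh mX X1; pose c : R := (2 * (1 + `|x|))^-1.
have x1 : 0 < 1 + `|x| by rewrite ltr_pwDl.
pose Y s := 2^-1 + c * (X s - x).
have Y01 s : 0 <= Y s <= 1.
  have : `|X s - x| <= 1 + `|x| by apply: le_trans (ler_normB _ _) _; rewrite lerD2r.
  rewrite ler_norml => /andP[h1 h2]; rewrite /Y.
  have c0 : 0 <= c by rewrite invr_ge0 mulr_ge0// ltW.
  have cE : c * (1 + `|x|) = 2^-1 by rewrite /c; field; rewrite gt_eqF.
  have := ler_wpM2l c0 h1; have := ler_wpM2l c0 h2; rewrite mulrN cE.
  by move=> ? ?; apply/andP; split; lra.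
have YE s : (X s < x) = (Y s < 2^-1).
  by rewrite /Y gtrDl pmulr_rlt0 ?subr_lt0// invr_gt0 mulr_gt0.
have mY : multiplier m h (fun s => (Y s)%:C%C).
  rewrite (_ : (fun s => _) = (fun s => (2^-1 - c * x)%:C%C + c%:C%C * (X s)%:C%C)).
    apply: multiplier_add => //; first exact: multiplier_cst.
    by apply: multiplier_mul => //; exact: multiplier_cst.
  by apply/funext => s; rewrite /Y -rmorphM -rmorphD /=; congr (_%:C%C); ring.
pose u_ n s := (1 - Y s ^+ n) ^+ (n * 2 ^ n).
apply: (@multiplier_lim _ m h u_ _ 1) => //.
- move=> n; rewrite (_ : (fun s => _) =
      (fun s => (1 + (-1) * (Y s)%:C%C ^+ n) ^+ (n * 2 ^ n))); last first.
    by apply/funext => s; rewrite /u_ mulN1r rmorphXn rmorphB rmorph1 rmorphXn.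
  apply: multiplier_exp => //; apply: multiplier_add => //; first exact: multiplier_cst.
  by apply: multiplier_mul; [exact: multiplier_cst|exact: multiplier_exp].
- move=> n s; have /andP[y0 y1] := Y01 s.
  have yn : 0 <= 1 - Y s ^+ n by rewrite subr_ge0 exprn_ile1.
  rewrite ger0_norm ?exprn_ge0//; apply: exprn_ile1 => //.
  by rewrite lerBlDr lerDl exprn_ge0.
- by move=> s; rewrite YE; exact: cvg_step_poly.
Qed.

Definition multiplier_set (R : realType) (m : probability (torus R) R) (h : torus R -> Cplx R)
    (A : set (torus R)) := multiplier m h (fun s => ((s \in A)%:R : R)%:C%C).

Lemma sigma_algebra_multiplier_set (R : realType) (m : probability (torus R) R)
    (h : torus R -> Cplx R) : bounded_measurable h -> sigma_algebra setT (multiplier_set m h).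
Proof.
move=> bh.
have C A : multiplier_set m h A -> multiplier_set m h (setT `\` A).
  move=> hA; rewrite /multiplier_set (_ : (fun s => _) =
      (fun s => 1 + (-1) * ((s \in A)%:R : R)%:C%C)).
    apply: multiplier_add => //; first exact: multiplier_cst.
    by apply: multiplier_mul => //; exact: multiplier_cst.
  apply/funext => s; rewrite setTD in_setC mulN1r.
  by case: (s \in A) => /=; apply: complex_eq; rewrite ?ReD ?ImD ?ReN ?ImN /=; ring.
have s0 : multiplier_set m h set0.
  rewrite /multiplier_set (_ : (fun s => _) = fun=> 0); first exact: multiplier_cst.
  by apply/funext => s; rewrite in_set0.
have I A B : multiplier_set m h A -> multiplier_set m h B -> multiplier_set m h (A `&` B).
  move=> hA hB; rewrite /multiplier_set (_ : (fun s => _) =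
      (fun s => ((s \in A)%:R : R)%:C%C * ((s \in B)%:R : R)%:C%C)).
    exact: multiplier_mul.
  by apply/funext => s; rewrite in_setI -rmorphM /=; case: (s \in A); rewrite ?mul1r ?mul0r.
have U A B : multiplier_set m h A -> multiplier_set m h B -> multiplier_set m h (A `|` B).
  by move=> /C hA /C hB; rewrite -[_ `|` _]setCK setCU -!setTD; exact/C/I.
split => // A hA.
have hU n : multiplier_set m h (\bigcup_(k in `I_n) A k).
  elim: n => [|n IH]; first by rewrite II0 bigcup_set0.
  by rewrite IIS bigcup_setU bigcup_set1; exact: U.
(* At each point the indicators of the finite unions are eventually constant, so the countable union
   is a bounded limit. *)
apply: (@multiplier_lim _ m h (fun n s => (s \in \bigcup_(k in `I_n) A k)%:R) _ 1) => //.
  by move=> n s; case: (_ \in _); rewrite ?normr1 ?normr0.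
move=> s; apply: cvg_near_cst; have [|sA] := boolP (s \in \bigcup_k A k).
  rewrite inE => -[k _ Ak]; near=> n; congr (_%:R); rewrite mem_set//.
  by exists k => //=; near: n; exact: nbhs_infty_gt.
near=> n; rewrite (_ : (s \in _) = false)//; apply/negbTE; apply: contraNN sA; rewrite !inE => -[k _ Ak].
by exists k.
Unshelve. all: by end_near.
Qed.

Lemma multiplier_set_preimage (R : realType) (m : probability (torus R) R)
    (h : torus R -> Cplx R) (X : torus R -> R) (B : set R) : bounded_measurable h ->
  multiplier m h (fun s => (X s)%:C%C) -> (forall s, `|X s| <= 1) ->
  measurable B -> multiplier_set m h (X @^-1` B).
Proof.
move=> bh mX X1 mB; have [s0 sC sU] := sigma_algebra_multiplier_set m bh.
have : (RGenInftyO.G (R:=R)).-sigma.-measurable B by rewrite -RGenInftyO.measurableE.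
apply: (@smallest_sub _ _ _ [set B | multiplier_set m h (X @^-1` B)]).
  split.
  - by rewrite /= preimage_set0.
  - by move=> A hA /=; rewrite setTD preimage_setC -setTD; exact: sC.
  - by move=> A hA /=; rewrite preimage_bigcup; exact: sU.
move=> _ [x ->] /=; have := multiplier_step x bh mX X1.
rewrite /multiplier_set (_ : (fun s => _) = (fun s => ((s \in X @^-1` `]-oo, x[%classic)%:R : R)%:C%C))//.
apply/funext => s; rewrite (_ : (s \in X @^-1` `]-oo, x[%classic) = (X s < x))//.
by apply/idP/idP => [|Xx]; [rewrite inE /= in_itv|rewrite mem_set//= in_itv].
Qed.

(* The sets whose indicators are multipliers form a sigma-algebra; it contains the
   generators because indicators of half lines are bounded limits of polynomials. *)
Lemma fourier_eq0 (R : realType) (m : probability (torus R) R) (h : torus R -> Cplx R) :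
  bounded_measurable h -> (forall a, fourier m h a = 0) -> \forall s \ae m, h s = 0.
Proof.
move=> bh h0.
have cRe (s : torus R) j : `|complex.Re (coords s j)| <= 1 by apply: norm_Re_le; rewrite norm_coords.
have cIm (s : torus R) j : `|complex.Im (coords s j)| <= 1 by apply: norm_Im_le; rewrite norm_coords.
have hA (A : set (torus R)) : measurable A -> multiplier_set m h A.
  move: A; apply: smallest_sub; first exact: sigma_algebra_multiplier_set.
  move=> _ [j [B [mB [->|->]]]].
    exact: (@multiplier_set_preimage _ m h (fun s => complex.Re (coords s j)) B bh
      (multiplier_coord_Re m j bh) (fun s => cRe s j) mB).
  exact: (@multiplier_set_preimage _ m h (fun s => complex.Im (coords s j)) B bh
      (multiplier_coord_Im m j bh) (fun s => cIm s j) mB).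
have one : annihilated m h (fun=> 1).
  split; first exact: bounded_measurable_cst.
  by move=> a; rewrite -[RHS](h0 a); congr complex_integral; apply/funext => s; rewrite mul1r.
(* Taking the annihilated function [1] and the zero multi-index leaves the integral of [h] over
   [A]. *)
have iA A : measurable A -> complex_integral m (fun s => ((s \in A)%:R : R)%:C%C * h s) = 0.
  move=> mA; have [_ /(_ _ one)[_ /(_ [fsfun])]] := hA A mA.
  rewrite (_ : (fun s => _) = (fun s => ((s \in A)%:R : R)%:C%C * h s))//.
  by apply/funext => s; rewrite monomial0 rmorph1 !mulr1.
have iR := bounded_measurable_Re m bh; have iI := bounded_measurable_Im m bh.
have zero (g : torus R -> R) : m.-integrable setT (EFin \o g) -> measurable_fun setT g ->
    (forall A : set (torus R), measurable A -> \int[m]_x (((x \in A)%:R : R) * g x) = 0) ->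
    \forall s \ae m, g s = 0.
  move=> ig mg g0.
  have : ae_eq m setT (EFin \o g) (cst 0%E).
    apply: integral_ae_eq => // E _ mE; rewrite integral0.
    have e := congr1 (@EFin R) (g0 E mE); move: e; rewrite /Rintegral.
    have E1 : (fun x => ((x \in E)%:R * g x)%:E) = (EFin \o g) \_ E.
      by apply/funext => x; rewrite patchE /=; case: (x \in E); rewrite ?mul1r ?mul0r.
    rewrite E1 -integral_mkcond fineK//.
    exact: integrable_fin_num (integrableS measurableT mE (@subsetT _ _) ig).
  by apply: ae_imply => s /(_ I)[].
have zR : \forall s \ae m, complex.Re (h s) = 0.
  apply: zero => //; first by case: bh => -[].
  move=> A /iA /(congr1 (@complex.Re R)) /= <-; apply: eq_Rintegral => s _.
  by rewrite ReM /= mul0r subr0.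
have zI : \forall s \ae m, complex.Im (h s) = 0.
  apply: zero => //; first by case: bh => -[].
  move=> A /iA /(congr1 (@complex.Im R)) /= <-; apply: eq_Rintegral => s _.
  by rewrite ImM /= mul0r addr0.
by apply: filterS2 zR zI => s hR hI; exact: complex_eq.
Qed.

(** * The exceptional set *)

(** Only countably many conditions, on the values [r p] and the tolerances [1 / (k + 1)], are
    imposed, so that the set of convergence becomes measurable. *)
Lemma cvg_at_right0P (R : realType) (r : nat -> R) (h : R -> R) :
  (forall a b : R, a < b -> exists p, a < r p < b) ->
  (forall x : R, 0 < x -> h y @[y --> x] --> h x) ->
  (forall k, exists2 q, 0 < r q & forall p, 0 < r p <= r q -> `|h (r p) - h (r q)| <= k.+1%:R^-1) ->
  cvg (h x @[x --> 0^'+]).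
Proof.
move=> rd ch hc; apply/cauchy_cvgP/cauchy_exP => e e0.
have [k ke] : exists k, k.+1%:R^-1 < e.
  have /cvgrPdist_lt/(_ _ e0) [k _ /(_ k (leqnn _))] := @cvg_harmonic R.
  by rewrite sub0r normrN ger0_norm ?invr_ge0// => ke; exists k.
have [q q0 hq] := hc k; exists (h (r q)).
change (\forall x \near (0 : R)^'+, ball (h (r q)) e (h x)).
near=> x; have x0 : 0 < x by near: x; exact: nbhs_right_gt.
have xq : x < r q by near: x; exact: nbhs_right_lt.
rewrite -ball_normE /ball_ /=; apply: le_lt_trans ke; rewrite distrC leNgt; apply/negP => hx.
(* An excess at [x] would persist, by continuity, at some [r p] slightly to the right of [x], where
   [hc] excludes it. *)
have d0 : 0 < `|h x - h (r q)| - k.+1%:R^-1 by rewrite subr_gt0.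
have := ch x x0 => /cvgrPdist_lt/(_ _ d0)[d /= dp hd].
have [p /andP[p1 p2]] : exists p, x < r p < Num.min (x + d) (r q).
  by apply: rd; rewrite lt_min xq andbT ltrDl.
move: p2; rewrite lt_min => /andP[pd pq].
have := hd (r p); rewrite /ball_ /= distrC gtr0_norm ?subr_gt0// ltrBlDl => /(_ pd) h1.
have h2 : `|h (r p) - h (r q)| <= k.+1%:R^-1 by apply: hq; rewrite (lt_trans x0 p1) ltW.
have h3 : `|h x - h (r q)| <= `|h x - h (r p)| + `|h (r p) - h (r q)|.
  by apply: le_trans (ler_normD _ _); rewrite addrA subrK.
by have := le_lt_trans h3 (ltr_leD h1 h2); rewrite subrK ltxx.
Unshelve. all: by end_near.
Qed.

Lemma cvg_at_right0_cauchy (R : realType) (r : nat -> R) (h : R -> R) :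
  (forall a b : R, a < b -> exists p, a < r p < b) ->
  cvg (h x @[x --> 0^'+]) ->
  forall k, exists2 q, 0 < r q & forall p, 0 < r p <= r q -> `|h (r p) - h (r q)| <= k.+1%:R^-1.
Proof.
move=> rd ch k; have e0 : 0 < k.+1%:R^-1 / 2 :> R by rewrite divr_gt0.
have /cvgrPdist_lt/(_ _ e0)[d /= d0 hd] := ch.
have [q /andP[q0 qd]] := rd 0 d d0; exists (q) => // p /andP[p0 pq].
have hE x : 0 < x -> x < d -> `|lim (h x @[x --> 0^'+]) - h x| < k.+1%:R^-1 / 2.
  by move=> x0 xd; apply: hd => //; rewrite /ball_ /= sub0r normrN gtr0_norm.
have h1 := hE _ p0 (le_lt_trans pq qd); have h2 := hE _ q0 qd.
rewrite (_ : _ - _ = (lim (h x @[x --> 0^'+]) - h (r q)) - (lim (h x @[x --> 0^'+]) - h (r p))); last by ring.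
by rewrite [leRHS]splitr; apply: le_trans (ler_normB _ _) (lerD (ltW h2) (ltW h1)).
Qed.

(** Numbers that code no rational are sent to [0]; only the density of the values matters. *)
Definition rat_enum (R : realType) (p : nat) : R := 
  ratr (odflt 0 (@choice.unpickle rat p)).

Lemma rat_enum_dense (R : realType) (a b : R) : a < b -> exists p, a < rat_enum R p < b.
Proof.
move=> /rat_in_itvoo[q]; rewrite in_itv /= => qab.
by exists (choice.pickle q); rewrite /rat_enum choice.pickleK.
Qed.

(* By continuity, Cauchy's criterion at [0] only has to be tested on rationals. *)
Lemma convergence_set d (T : measurableType d) (R : realType) (g : R -> T -> R) :
  (forall x, 0 < x -> measurable_fun setT (g x)) ->
  exists A : set T, [/\ measurable A,
    forall s, cvg (g x s @[x --> 0^'+]) -> A s &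
    forall s, (forall x : R, 0 < x -> g y s @[y --> x] --> g x s) -> A s ->
      cvg (g x s @[x --> 0^'+])].
Proof.
move=> mg; pose r := rat_enum R; have rd := @rat_enum_dense R.
exists (\bigcap_k \bigcup_(q in [set q | 0 < r q]) \bigcap_(p in [set p | 0 < r p <= r q])
  [set s | `|g (r p) s - g (r q) s| <= k.+1%:R^-1]); split.
- apply: bigcapT_measurable => k; apply: bigcup_measurable => q q0.
  apply: bigcap_measurable => [|p /andP[p0 _]]; first by exists q; rewrite /= q0 lexx.
  have mf : measurable_fun setT (fun s => `|g (r p) s - g (r q) s|).
    by apply: measurableT_comp => //; apply: measurable_funB; exact: mg.
  have := mf measurableT _ (measurable_itv `]-oo, k.+1%:R^-1 : R]); rewrite setTI.
  by congr (measurable _); apply/seteqP; split => s /=; rewrite in_itv.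
- move=> s /(cvg_at_right0_cauchy rd) hs k _.
  have [q q0 hq] := hs k; exists q => // p; exact: hq.
- move=> s cs As; apply: (cvg_at_right0P rd cs) => k.
  by have [q q0 hq] := As k I; exists q => // p; exact: hq.
Qed.

(** Fubini for the set of pairs with time in [[0, 1]]: the section at a point is null by hypothesis,
    and the section at a time has measure [m B] by invariance, so the total is both [0] and
    [m B]. *)
Lemma haar_null_of_orbits (R : realType) (m : probability (torus R) R) (B : set (torus R)) :
  is_haar m -> measurable B ->
  (forall tau, \forall t \ae (@lebesgue_measure R), ~ B (kronecker_flow t tau)) -> m B = 0.
Proof.
move=> mh mB B0.
pose S := [set z : measurableTypeR R * torus R | z.1 \in `[0, 1] /\ B (kronecker_flow z.1 z.2)].
have mS : measurable S.
  rewrite (_ : S = ((fun z : measurableTypeR R * torus R => z.1) @^-1` `[0 : R, 1]%classic) `&`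
      ((fun z : measurableTypeR R * torus R => kronecker_flow z.1 z.2) @^-1` B)).
    apply: measurableI; rewrite -[X in measurable X]setTI.
      exact: (@measurable_fst _ _ (measurableTypeR R) (torus R) measurableT _ (measurable_itv _)).
    exact: (@measurable_kronecker_flow R measurableT _ mB).
  by apply/seteqP; split => z /=.
have := indic_fubini_tonelli (@lebesgue_measure R) m mS.
rewrite (indic_fubini_tonelli_FE m mS) (indic_fubini_tonelli_GE (@lebesgue_measure R) mS).
rewrite [X in _ = X]integral0_eq => [|tau _ /=]; last first.
  apply: measure_negligible; first exact: measurable_ysection.
  apply: negligibleS (B0 tau) => t /=; rewrite ysectionE /S /= => -[_ Bt] /(_ Bt).
  by [].
have -> : m \o xsection S = (cst (m B)) \_ `[0 : measurableTypeR R, 1]%classic.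
  apply/funext => t; rewrite patchE /= xsectionE; case: ifPn => t01.
    rewrite -(mh (fun j => exist _ (prime_twist t j) (prime_twist_subproof t j)) B mB).
    congr (m _); apply/seteqP; split => s /=; first by case.
    by split => //; move: t01; rewrite inE.
  rewrite (_ : _ @^-1` _ = set0) ?measure0//; apply/seteqP; split => s //= [t01' _].
  by move/negP: t01; apply; rewrite inE.
rewrite -integral_mkcond integral_cst//= lebesgue_measure_itv /= lte_fin ltr01 oppr0 addr0.
by rewrite mule1.
Qed.

(** * Slices at a fixed [theta] and their Fourier coefficients *)

Lemma bounded_measurable_poly_sum (R : realType) (w : multi_index -> Cplx R) s (x : R) :
  bounded_measurable (fun tau : torus R => poly_sum w s (b_theta x tau)).
Proof.
apply: bounded_measurable_sum => a _; rewrite (funext (fun tau => congr1 _ (monomial_b_theta x tau a))).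
apply: bounded_measurable_mul; first exact: bounded_measurable_cst.
apply: bounded_measurable_mul; first exact: bounded_measurable_cst.
exact: bounded_measurable_monomial.
Qed.

Lemma fourier_poly_sum (R : realType) (m : probability (torus R) R) (w : multi_index -> Cplx R)
    s (x : R) a : is_haar m -> uniq s -> a \in s ->
  fourier m (fun tau => poly_sum w s (b_theta x tau)) a = (expR (- (freq R a * x)))%:C%C * w a.
Proof.
move=> mh us as_; rewrite /fourier (_ : (fun tau => _) = (fun tau => \sum_(b <- s)
   ((expR (- (freq R b * x)))%:C%C * w b) * (monomial (coords tau) b * (monomial (coords tau) a)^*))).
  rewrite complex_integral_sum; last first.
    move=> b; apply: bounded_measurable_mul; first exact: bounded_measurable_monomial.
    by apply: bounded_measurable_conj; exact: bounded_measurable_monomial.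
  rewrite (bigD1_seq a)//= integral_monomial_orthonormal// eqxx mulr1 big1 ?addr0// => b ba.
  by rewrite integral_monomial_orthonormal// (negbTE ba) mulr0.
apply/funext => tau; rewrite /poly_sum mulr_suml; apply: eq_bigr => b _.
by rewrite monomial_b_theta; ring.
Qed.

Lemma box_exhausts (a : multi_index) : \forall N \near \oo, a \in box N N.
Proof.
exists (\sum_(j <- finsupp a) (j.+1 + `|a j|))%N => // N /= aN.
have h j : j \in finsupp a -> (j.+1 + `|a j| <= N)%N.
  by move=> ja; apply: leq_trans aN; rewrite (big_fsetD1 j)//= leq_addr.
apply/boxP; split => j.
  have [/h jN|] := boolP (j \in finsupp a); last by rewrite mem_finsupp negbK => /eqP.
  by move=> Nj; have := leq_trans (leq_trans (leq_addr _ _) jN) Nj; rewrite ltnn.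
have [/h jN|] := boolP (j \in finsupp a); last by rewrite mem_finsupp negbK => /eqP ->.
exact: leq_trans (leq_addl _ _) jN.
Qed.

Lemma fourier_cvg (R : realType) (m : probability (torus R) R) (f : nat -> torus R -> Cplx R)
    (g : torus R -> Cplx R) (M : R) a :
  (forall n, complex_measurable (f n)) ->
  (forall n s, `|complex.Re (f n s)| <= M /\ `|complex.Im (f n s)| <= M) ->
  (forall s, complex.Re (f n s) @[n --> \oo] --> complex.Re (g s)) ->
  (forall s, complex.Im (f n s) @[n --> \oo] --> complex.Im (g s)) ->
  complex.Re (fourier m (f n) a) @[n --> \oo] --> complex.Re (fourier m g a) /\
  complex.Im (fourier m (f n) a) @[n --> \oo] --> complex.Im (fourier m g a).
Proof.
move=> mf fM cR cI; pose k (s : torus R) := (monomial (coords s) a)^*.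
have [[kR kI] _] : bounded_measurable k.
  by apply: bounded_measurable_conj; exact: bounded_measurable_monomial.
have k1 s : `|complex.Re (k s)| <= 1 /\ `|complex.Im (k s)| <= 1.
  by split; [apply: norm_Re_le|apply: norm_Im_le]; rewrite norm_conjC norm_monomial.
have prod (u v : R) : `|u| <= M -> `|v| <= 1 -> `|u * v| <= M.
  by move=> uM v1; rewrite normrM -[M]mulr1 ler_pM.
apply: (@complex_integral_dominated _ _ R m (fun n s => f n s * k s) (fun s => g s * k s) (M + M)).
- move=> n; have [mR mI] := mf n; split.
    rewrite (funext (fun s => ReM (f n s) (k s))).
    by apply: measurable_funB; exact: measurable_funM.
  rewrite (funext (fun s => ImM (f n s) (k s))).
  by apply: measurable_funD; exact: measurable_funM.
- move=> n s; have [f1 f2] := fM n s; have [k1' k2'] := k1 s; rewrite ReM ImM; split.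
    by apply: le_trans (ler_normB _ _) _; apply: lerD; exact: prod.
  by apply: le_trans (ler_normD _ _) _; apply: lerD; exact: prod.
- move=> s; rewrite (funext (fun n => ReM (f n s) (k s))) ReM.
  by apply: cvgB; apply: cvgM => //; exact: cvg_cst.
- move=> s; rewrite (funext (fun n => ImM (f n s) (k s))) ImM.
  by apply: cvgD; apply: cvgM => //; exact: cvg_cst.
Qed.

(** Used with Fejer weights for the slices and with damping factors [exp (- freq x)] for the
    boundary function: both tend to one in front of a fixed coefficient. *)
Lemma fourier_limit (R : realType) (m : probability (torus R) R) (f : nat -> torus R -> Cplx R)
    (g : torus R -> Cplx R) (M : R) (w : nat -> R) (e : Cplx R) a :
  (forall n, complex_measurable (f n)) ->
  (forall n s, `|complex.Re (f n s)| <= M /\ `|complex.Im (f n s)| <= M) ->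
  (forall s, complex.Re (f n s) @[n --> \oo] --> complex.Re (g s)) ->
  (forall s, complex.Im (f n s) @[n --> \oo] --> complex.Im (g s)) ->
  w n @[n --> \oo] --> (1 : R) ->
  (\forall n \near \oo, fourier m (f n) a = (w n)%:C%C * e) -> fourier m g a = e.
Proof.
move=> mf fM cR cI w1 fE; have [hR hI] := fourier_cvg m a mf fM cR cI.
apply: complex_eq.
  apply: (cvg_unique (@Rhausdorff R) hR).
  have : w n * complex.Re e @[n --> \oo] --> 1 * complex.Re e.
    by apply: cvgM => //; exact: cvg_cst.
  rewrite mul1r; apply: cvg_trans; apply: near_eq_cvg; near=> n.
  by rewrite (near fE n)// ReM /= mul0r subr0.
apply: (cvg_unique (@Rhausdorff R) hI).
have : w n * complex.Im e @[n --> \oo] --> 1 * complex.Im e.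
  by apply: cvgM => //; exact: cvg_cst.
rewrite mul1r; apply: cvg_trans; apply: near_eq_cvg; near=> n.
by rewrite (near fE n)// ImM /= mul0r addr0.
Unshelve. all: by end_near.
Qed.

(** The coefficients of the slice are those of [F] up to a factor tending to one as [x -> 0]; this
    will identify the limit function. *)
Lemma point_value_slice (R : realType) (m : probability (torus R) R) (F : torus R -> Cplx R)
    (M x : R) (P := fun tau => point_value m F (b_theta x tau)) :
  is_haar m -> complex_measurable F ->
  (forall s, `|complex.Re (F s)| <= M /\ `|complex.Im (F s)| <= M) ->
  analytic (fourier m F) -> 0 < x ->
  [/\ complex_measurable P,
    forall s, `|complex.Re (P s)| <= M /\ `|complex.Im (P s)| <= M &
    forall a, fourier m P a = (expR (- (freq R a * x)))%:C%C * fourier m F a].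
Proof.
move=> mh mF FM an x0.
pose f n tau := fejer_sum m F n n (b_theta x tau).
have bf n : bounded_measurable (f n) by exact: bounded_measurable_poly_sum.
have fP tau := fejer_sum_cvg tau mh mF FM an x0.
have mP : complex_measurable P.
  split.
    apply: (@measurable_fun_cvg _ _ _ _ (fun n tau => complex.Re (f n tau))).
      by move=> n; have [[]] := bf n.
    by move=> tau _; case: (fP tau).
  apply: (@measurable_fun_cvg _ _ _ _ (fun n tau => complex.Im (f n tau))).
    by move=> n; have [[]] := bf n.
  by move=> tau _; case: (fP tau).
(* The bound holds on the torus; the maximum principle on the flow line through [tau], read at time
   [0], carries it to [b_theta x tau]. *)
have fM n tau : `|complex.Re (f n tau)| <= M /\ `|complex.Im (f n tau)| <= M.
  pose w a := fejer_weight R n a * fourier m F a.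
  have wan : analytic w by move=> a /an; rewrite /w => ->; rewrite mulr0.
  have E y t := @expsum_terms R w tau (box n n) y t wan.
  have L0 : {in terms w tau (box n n), forall p, 0 <= p.2}.
    by move=> _ /mapP[a + ->]; rewrite mem_filter => /andP[na _]; exact: freq_ge0.
  have rL0 : {in rot (terms w tau (box n n)), forall p, 0 <= p.2}.
    by move=> _ /mapP[p pL ->]; exact: L0 pL.
  have [eR eI] := E x 0; rewrite kronecker_flow0 in eR eI.
  rewrite -[complex.Re _]eR -[complex.Im _]eI.
  have b t := fejer_sum_le n n (kronecker_flow t tau) mh mF FM.
  split; apply: expsum_le => //; try exact: ltW.
    by move=> t; have [-> _] := E 0 t; rewrite b_theta0; case: (b t).
  by move=> t; have [_ ->] := E 0 t; rewrite b_theta0; case: (b t).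
have PM s : `|complex.Re (P s)| <= M /\ `|complex.Im (P s)| <= M.
  have [c1 c2] := fP s; split.
    by apply: (cvgr_to_le (cvg_norm c1)); near=> n; case: (fM n s).
  by apply: (cvgr_to_le (cvg_norm c2)); near=> n; case: (fM n s).
split => // a.
apply: (@fourier_limit _ m f P M (fun n => real_fejer_weight R n a)) => //.
- by move=> n; case: (bf n).
- by move=> s; case: (fP s).
- by move=> s; case: (fP s).
- exact: cvg_real_fejer_weight.
near=> n; rewrite /f /fejer_sum -/(poly_sum (fun a => fejer_weight R n a * fourier m F a) _ _).
rewrite (fourier_poly_sum (fun a => fejer_weight R n a * fourier m F a)) ?uniq_box//.
  by rewrite fejer_weightE; ring.
by near: n; exact: box_exhausts.
Unshelve. all: by end_near.
Qed.

(** * The boundary function *)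

Lemma ae_and d (T : measurableType d) (R : realType) (mu : {measure set T -> \bar R})
    (P Q : T -> Prop) :
  (\forall x \ae mu, P x) -> (\forall x \ae mu, Q x) -> \forall x \ae mu, P x /\ Q x.
Proof.
move=> aP aQ; apply: negligibleS (negligibleU aP aQ) => x /= nPQ.
by have [Px|] := pselect (P x); [right => Qx; exact: nPQ|left].
Qed.

Lemma boundary_function_bounded (R : realType) (m : probability (torus R) R)
    (F : torus R -> Cplx R) (M : R) : is_haar m -> complex_measurable F ->
  (forall s, `|complex.Re (F s)| <= M /\ `|complex.Im (F s)| <= M) ->
  analytic (fourier m F) ->
  exists Ft : torus R -> Cplx R,
    [/\ complex_measurable Ft,
        (\forall tau \ae m, Ft tau = F tau),
        (\forall tau \ae m,
           point_value m F (b_theta theta tau) @[theta --> (0 : R)^'+] --> Ft tau) &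
        forall tau : torus R,
          \forall t \ae (@lebesgue_measure R),
            point_value m F (b_theta theta (kronecker_flow t tau)) @[theta --> (0 : R)^'+]
              --> Ft (kronecker_flow t tau)].
Proof.
move=> mh mF FM an; pose P x tau := point_value m F (b_theta x tau).
have sl x : 0 < x -> _ := point_value_slice mh mF FM an.
have cont s (x : R) : 0 < x -> complex.Re (P y s) @[y --> x] --> complex.Re (P x s) /\
    complex.Im (P y s) @[y --> x] --> complex.Im (P x s).
  move=> x0; have [[/(_ x 0 x0) + _] [/(_ x 0 x0) + _]] := point_value_fatou s mh mF FM an.
  by rewrite kronecker_flow0.
have [AR [mAR cAR ARc]] := @convergence_set _ (torus R) R (fun x s => complex.Re (P x s))
  (fun x x0 => let: And3 h _ _ := sl x x0 in h.1).
have [AI [mAI cAI AIc]] := @convergence_set _ (torus R) R (fun x s => complex.Im (P x s))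
  (fun x x0 => let: And3 h _ _ := sl x x0 in h.2).
pose A := AR `&` AI; have mA : measurable A by exact: measurableI.
have orb tau : \forall t \ae (@lebesgue_measure R), A (kronecker_flow t tau).
  have [[_ aR] [_ aI]] := point_value_fatou tau mh mF FM an.
  by apply: ae_imply (ae_and aR aI) => t [cR cI]; split; [exact: cAR|exact: cAI].
have aeA : \forall s \ae m, A s.
  exists (~` A); split => //; first exact: measurableC.
  apply: haar_null_of_orbits => //; first exact: measurableC.
  by move=> tau; apply: ae_imply (orb tau) => t At; exact.
(* The value [0] off [A] makes the representative everywhere defined. *)
pose Ft s : Cplx R := if s \in A then
  Complex (lim (complex.Re (P x s) @[x --> 0^'+])) (lim (complex.Im (P x s) @[x --> 0^'+])) else 0.
have cFt s : A s -> complex.Re (P x s) @[x --> 0^'+] --> complex.Re (Ft s) /\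
    complex.Im (P x s) @[x --> 0^'+] --> complex.Im (Ft s).
  move=> As; rewrite /Ft mem_set//=; case: As => sR sI.
  split; first by apply: ARc => // x x0; case: (cont s x x0).
  by apply: AIc => // x x0; case: (cont s x x0).
have cP s : A s -> P x s @[x --> (0 : R)^'+] --> Ft s.
  move=> /cFt[cR cI]; have E : Ft s = Complex (complex.Re (Ft s)) (complex.Im (Ft s)).
    exact: complex_eq.
  by rewrite E; exact: cvg_complex.
(* With the indicator of [A] the slices at [1 / (k + 1)] converge to [Ft] at every point, so [Ft] is
   measurable and dominated convergence applies. *)
pose f k s : Cplx R := ((s \in A)%:R : R)%:C%C * P (k.+1%:R^-1) s.
have k0 k : 0 < k.+1%:R^-1 :> R by rewrite invr_gt0.
have RE (x : R) (z : Cplx R) : complex.Re (x%:C%C * z : Cplx R) = x * complex.Re z.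
  by rewrite ReM /= mul0r subr0.
have IE (x : R) (z : Cplx R) : complex.Im (x%:C%C * z : Cplx R) = x * complex.Im z.
  by rewrite ImM /= mul0r addr0.
have bP k : bounded_measurable (P k.+1%:R^-1).
  by have [mP PM _] := sl _ (k0 k); split => //; exists M.
have bf k : bounded_measurable (f k).
  apply: bounded_measurable_mul => //; split.
    split; last exact: measurable_cst.
    by rewrite (_ : (fun s => _) = \1_A)//; exact: measurable_indic.
  exists 1 => s /=; rewrite normr0; split => //.
  by case: (s \in A); rewrite ?normr1 ?normr0.
have M0 : 0 <= M by apply: le_trans (normr_ge0 _) (FM point).1.
have fM k s : `|complex.Re (f k s)| <= M /\ `|complex.Im (f k s)| <= M.
  have [_ PM _] := sl _ (k0 k); have [p1 p2] := PM s.
  by rewrite /f RE IE; case: (s \in A); rewrite ?mul1r ?mul0r ?normr0.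
have cf s : complex.Re (f k s) @[k --> \oo] --> complex.Re (Ft s) /\
    complex.Im (f k s) @[k --> \oo] --> complex.Im (Ft s).
  rewrite (funext (fun k => RE _ _)) (funext (fun k => IE _ _)).
  have [sA|sA] := boolP (s \in A); last first.
    by rewrite /Ft (negbTE sA) /=; under eq_fun do rewrite mul0r; split; [|under eq_fun do rewrite mul0r]; exact: cvg_cst.
  have [cR cI] := cFt s (set_mem sA).
  under eq_fun do rewrite mul1r; split; [|under eq_fun do rewrite mul1r].
    by move/cvg_at_rightP: cR; apply; split => //; exact: cvg_harmonic.
  by move/cvg_at_rightP: cI; apply; split => //; exact: cvg_harmonic.
have mFt : complex_measurable Ft.
  split.
    apply: (@measurable_fun_cvg _ _ _ _ (fun k s => complex.Re (f k s))).
      by move=> k; have [[]] := bf k.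
    by move=> s _; case: (cf s).
  apply: (@measurable_fun_cvg _ _ _ _ (fun k s => complex.Im (f k s))).
    by move=> k; have [[]] := bf k.
  by move=> s _; case: (cf s).
have FtM s : `|complex.Re (Ft s)| <= M /\ `|complex.Im (Ft s)| <= M.
  have [c1 c2] := cf s; split.
    by apply: (cvgr_to_le (cvg_norm c1)); near=> n; case: (fM n s).
  by apply: (cvgr_to_le (cvg_norm c2)); near=> n; case: (fM n s).
have fourE a : fourier m Ft a = fourier m F a.
  apply: (@fourier_limit _ m f Ft M (fun k => expR (- (freq R a * k.+1%:R^-1)))) => //.
  - by move=> k; case: (bf k).
  - by move=> s; case: (cf s).
  - by move=> s; case: (cf s).
  - have c0 : - (freq R a * k.+1%:R^-1) @[k --> \oo] --> - (freq R a * 0).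
      by apply: cvgN; apply: cvgM; [exact: cvg_cst|exact: cvg_harmonic].
    by rewrite mulr0 oppr0 in c0; have := continuous_cvg _ (@continuous_expR R 0) c0; rewrite expR0; apply.
  (* The set [A] has full measure, so the cut-off slice has the coefficients of the slice itself. *)
  near=> k; have [_ _ <-] := sl _ (k0 k); apply: complex_integral_ae.
  - by have [] := bounded_measurable_coef a (bf k).
  - by have [] := bounded_measurable_coef a (bP k).
  - by apply: filterS aeA => s As; rewrite /f mem_set// mul1r.
exists Ft; split => //.
- have bFt : bounded_measurable Ft by split => //; exists M.
  have bF : bounded_measurable F by split => //; exists M.
  have bN : bounded_measurable (fun s => (-1) * F s).
    by apply: bounded_measurable_mul => //; exact: bounded_measurable_cst.
  have := @fourier_eq0 _ m (fun s => Ft s + (-1) * F s) (bounded_measurable_add bFt bN).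
  move=> h; apply: filterS (h _) => [s /eqP|a]; first by rewrite mulN1r subr_eq0 => /eqP.
  rewrite /fourier (_ : (fun s => _) = (fun s => Ft s * (monomial (coords s) a)^* +
     (-1) * (F s * (monomial (coords s) a)^*))); last by apply/funext => s; ring.
  rewrite complex_integralD ?complex_integralZ ?mulN1r -/(fourier m Ft a) -/(fourier m F a).
  + by rewrite fourE subrr.
  + exact: bounded_measurable_coef.
  + exact: bounded_measurable_coef.
  + apply: bounded_measurable_mul; first exact: bounded_measurable_cst.
    exact: bounded_measurable_coef.
- by apply: filterS aeA => s; exact: cP.
- by move=> tau; apply: ae_imply (orb tau) => t; exact: cP.
Unshelve. all: by end_near.
Qed.

(** [F] is only essentially bounded. Replacing it by zero on a null set gives an everywhere bounded
    function with the same Fourier coefficients, hence the same point values, and equal to [F]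
    almost everywhere. *)
Theorem theorem2 (R : realType) (m : probability (torus R) R)
    (m_haar : is_haar m) (F : torus R -> Cplx R) (F_Hinfty : in_Hinfty m F) :
  exists Ft : torus R -> Cplx R,
    [/\ complex_measurable Ft,
        (\forall tau \ae m, Ft tau = F tau),
        (\forall tau \ae m,
           point_value m F (b_theta theta tau) @[theta --> (0 : R)^'+] --> Ft tau) &
        forall tau : torus R,
          \forall t \ae (@lebesgue_measure R),
            point_value m F (b_theta theta (kronecker_flow t tau)) @[theta --> (0 : R)^'+]
              --> Ft (kronecker_flow t tau)].
Proof.
have [[mF Foo] F0] := F_Hinfty.
have [M FM] : exists M : R, \forall s \ae m, complex.Re `|F s| <= M.
  apply: ess_sup_inf.ess_supr_bounded; move: Foo.
  rewrite unlock /= probability_setT lte01 (_ : abse \o _ = EFin \o (fun s => complex.Re `|F s|))//.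
  apply/funext => s /=; rewrite ger0_norm//.
  by case: (F s) => x y; exact: sqrtr_ge0.
pose B := [set s | `|complex.Re (F s)| <= M] `&` [set s | `|complex.Im (F s)| <= M].
have mB : measurable B.
  have [mR mI] := mF.
  have mle (g : torus R -> R) : measurable_fun setT g -> measurable [set s | `|g s| <= M].
    move=> mg; have := (measurableT_comp (@normr_measurable R setT) mg) measurableT _
      (measurable_itv `]-oo, M]).
    by rewrite setTI; congr (measurable _); apply/seteqP; split => s /=; rewrite in_itv.
  by apply: measurableI; exact: mle.
have BF : \forall s \ae m, B s.
  apply: ae_imply FM => s Fs.
  have FMs : `|F s| <= M%:C%C by rewrite normc_def lecR; move: Fs; rewrite normc_def.
  by split; [exact: norm_Re_le|exact: norm_Im_le].
pose F1 s : Cplx R := ((\1_B s : R)%:C%C) * F s.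
have RE s : complex.Re (F1 s) = \1_B s * complex.Re (F s).
  by rewrite ReM /= mul0r subr0.
have IE s : complex.Im (F1 s) = \1_B s * complex.Im (F s).
  by rewrite ImM /= mul0r addr0.
have mF1 : complex_measurable F1.
  have [mR mI] := mF; split; [rewrite (funext RE)|rewrite (funext IE)];
  by apply: measurable_funM => //; exact: measurable_indic.
have F1F : \forall s \ae m, F1 s = F s.
  by apply: ae_imply BF => s Bs; rewrite /F1 indicE mem_set// mul1r.
have fourE a : fourier m F1 a = fourier m F a.
  have mk (G : torus R -> Cplx R) : complex_measurable G ->
      complex_measurable (fun s => G s * (monomial (coords s) a)^*).
    move=> [GR GI]; have [[kR kI] _] := bounded_measurable_conj (bounded_measurable_monomial R a).
    split.
      rewrite (funext (fun s => ReM (G s) _)).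
      by apply: measurable_funB; exact: measurable_funM.
    rewrite (funext (fun s => ImM (G s) _)).
    by apply: measurable_funD; exact: measurable_funM.
  by apply: complex_integral_ae; [exact: mk|exact: mk|apply: ae_imply F1F => s ->].
have pE : point_value m F1 = point_value m F.
  rewrite /point_value /point_value_n; apply/funext => z.
  by rewrite (funext fourE).
(* The sign of [M] is not known, and off [B] the function [F1] is zero; [|M|] is a bound in both
   cases. *)
have F1M s : `|complex.Re (F1 s)| <= `|M| /\ `|complex.Im (F1 s)| <= `|M|.
  rewrite RE IE !indicE; have [/set_mem[B1 B2]|_] := boolP (s \in B).
    by rewrite !mul1r; split; apply: le_trans (ler_norm M).
  by split; rewrite mulr0n mul0r normr0.
have an : analytic (fourier m F1).
  move=> a na; rewrite fourE; apply: F0; apply: contrapT => h; move/negP: na; apply.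
  by apply/nonnegP => j; rewrite leNgt; apply/negP => aj; apply: h; exists j.
have := boundary_function_bounded m_haar mF1 F1M an.
move: pE; move: (point_value m F1) => G1 ->.
case=> Ft [h1 h2 h3 h4]; exists Ft; split; [exact: h1| |exact: h3|exact: h4].
by apply: ae_imply (ae_and h2 F1F) => s [-> ->].
Qed.
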